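(* Let $\ell\in\mathbb{N}\cup\{0\}$, let $\mathbf{x}\in\mathbb{C}^\ell$, and let $\mathsf{G}_{\mathbf{x}}$ be the Palm measure of the Ginibre point process $\mathsf{G}$ conditioned at $\mathbf{x}$. For $T>0$ define $F_T:Q\to\mathbb{R}$ by $$F_T(\mathsf{s})=\frac1T\int_0^T\big(\mathsf{s}(D_{\sqrt r})-r\big)\,dr,\qquad D_r=\{z\in\mathbb{C}:|z|\le r\}.$$ Then $F_T$ converges weakly in $L^2(Q,\mathsf{G}_{\mathbf{x}})$ as $T\to\infty$, and $$\lim_{T\to\infty}F_T=-\ell .$$
   Context: $Q$ is the set of configurations on $\mathbb{C}$, i.e. Radon measures of the form $\mathsf{s}=\sum_i\delta_{s_i}$ with $\{s_i\}$ a countable sequence in $\mathbb{C}$ (the zero measure included), with the vague topology; $\mathsf{s}(A)$ is the number of points of $\mathsf{s}$ in $A$. Let $\mathsf{g}(dz)=\pi^{-1}e^{-|z|^2}dz$ on $\mathbb{C}$ and $\mathsf{K}(z,w)=e^{z\overline{w}}$. The determinantal point process (DPP) associated with a Hermitian kernel $K$ and a Radon measure $m$ is the unique probability measure on $Q$ whose $k$-point correlation functions with respect to $m$ are $\det[K(z_i,z_j)]_{i,j=1}^k$ for all $k$. The Ginibre point process $\mathsf{G}$ is the DPP associated with $(\mathsf{K},\mathsf{g})$. For $\mathbf{x}\in\mathbb{C}^\ell$, ''Palm measure'' means reduced Palm measure: $\mathsf{G}_{\mathbf{x}}=\mathsf{G}(\,\cdot-\sum_{i=1}^{\ell}\delta_{x_i}\mid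 \mathsf{s}(\{x_i\})\ge1\ \text{for all } i)$, taken in its version that is weakly continuous in $\mathbf{x}\in\mathbb{C}^\ell$. Concretely, $\mathsf{G}_{\mathbf{x}}$ is the DPP associated with $(\mathsf{K}_{\mathbf{x}},\mathsf{g})$, where for distinct $x_1,\dots,x_\ell$ $$\mathsf{K}_{\mathbf{x}}(z,w)=\frac{\det[\mathsf{K}(p_i,q_j)]_{i,j=0}^{\ell}}{\det[\mathsf{K}(x_i,x_j)]_{i,j=1}^{\ell}},\qquad p_0=z,\ q_0=w,\ p_i=q_i=x_i\ (1\le i\le \ell),$$ and for general $\mathbf{x}$ the kernel is the continuous extension in $\mathbf{x}$ of this expression. By convention $\mathsf{G}_{\mathbf{x}}=\mathsf{G}$ if $\ell=0$. *)

(* Defs.v *)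
From HB Require Import structures.
From mathcomp Require Import all_boot all_order all_algebra.
From mathcomp Require Import all_classical all_reals all_analysis.
From mathcomp Require Import measurable_realfun complex.

Set Implicit Arguments.
Unset Strict Implicit.
Unset Printing Implicit Defensive.

Import Order.TTheory GRing.Theory Num.Theory.
Import numFieldNormedType.Exports.

Local Open Scope classical_set_scope.
Local Open Scope ring_scope.

(* As a topological and measurable space, the complex plane is R * R, with
   (a, b) standing for a + ib; complex arithmetic takes place in R[i]. *)
Notation plane R := (R * R)%type.

Section complex_plane.
Context {R : realType}.

Definition toC (z : plane R) : R[i] := (z.1 +i* z.2)%C.

Definition cexp (z : R[i]) : R[i] :=
  ((expR (complex.Re z) * cos (complex.Im z)) +i*
   (expR (complex.Re z) * sin (complex.Im z)))%C.

Definition modulus (z : plane R) : R := Num.sqrt (z.1 ^+ 2 + z.2 ^+ 2).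

Definition disk (r : R) : set (plane R) := [set z | modulus z <= r].

End complex_plane.

Section gaussian_measure.
Context {R : realType}.

Definition gaussian_density (z : plane R) : R :=
  pi^-1 * expR (- modulus z ^+ 2).

Definition gaussian (A : set (plane R)) : \bar R :=
  (\int[lebesgue_measure \x lebesgue_measure]_(z in A)
     (gaussian_density z)%:E)%E.

Lemma gaussian_density_ge0 z : 0 <= gaussian_density z.
Proof. by rewrite mulr_ge0 ?invr_ge0 ?pi_ge0 ?expR_ge0. Qed.

Lemma measurable_gaussian_density :
  measurable_fun [set: plane R] gaussian_density.
Proof.
have -> : gaussian_density =
    fun z => pi^-1 * expR (- (z.1 ^+ 2 + z.2 ^+ 2)).
  by apply/funext => z; rewrite /gaussian_density sqr_sqrtr// addr_ge0 ?sqr_ge0.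
apply: measurable_funM => //; apply: measurableT_comp => //.
apply: measurableT_comp => //; apply: measurable_funD; apply: measurable_funX.
  exact: measurable_fst.
exact: measurable_snd.
Qed.

Let gaussian0 : gaussian set0 = 0%E.
Proof. by rewrite /gaussian integral_set0. Qed.

Let gaussian_ge0 A : (0 <= gaussian A)%E.
Proof.
by apply: integral_ge0 => z _; rewrite lee_fin gaussian_density_ge0.
Qed.

Let gaussian_sigma_additive : semi_sigma_additive gaussian.
Proof.
move=> A mA tA mUA; rewrite /gaussian ge0_integral_bigcup//=.
- apply: is_cvg_ereal_nneg_natsum_cond => n _ _.
  by apply: integral_ge0 => z _; rewrite lee_fin gaussian_density_ge0.
- apply/measurable_EFinP/measurable_funTS.
  exact: measurable_gaussian_density.
- by move=> z _; rewrite lee_fin gaussian_density_ge0.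
Qed.

HB.instance Definition _ := isMeasure.Build _ (plane R) R gaussian
  gaussian0 gaussian_ge0 gaussian_sigma_additive.

End gaussian_measure.

Section configurations.
Variable R : realType.

(* A Radon measure of the form \sum_i \d_(p i), the index set I being an
   arbitrary, possibly finite or empty, set of natural numbers.  The identity
   is imposed on all sets, so that measures that agree on Borel sets but take
   other junk values do not give different configurations. *)
Definition is_configuration (s : {measure set (plane R) -> \bar R}) : Prop :=
  (forall K : set (plane R), compact K -> (s K < +oo)%E) /\
  exists (I : set nat) (p : nat -> plane R),
    forall A : set (plane R), s A = \esum_(i in I) (\d_(p i) A)%E.

Record configuration := Configuration {
  configuration_measure :> {measure set (plane R) -> \bar R};
  configurationP : is_configuration configuration_measure }.

Lemma is_configuration_mzero : is_configuration mzero.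
Proof.
split=> [K _|]; first exact: ltry.
by exists set0, (fun=> (0, 0)) => A; rewrite esum_set0.
Qed.

HB.instance Definition _ := gen_eqMixin configuration.
HB.instance Definition _ := gen_choiceMixin configuration.
HB.instance Definition _ := isPointed.Build configuration
  (Configuration is_configuration_mzero).

Record Cc := mkCc {
  Cc_fun :> plane R -> R;
  Cc_continuous : continuous Cc_fun;
  Cc_compact_support :
    exists2 K, compact K & forall z, ~ K z -> Cc_fun z = 0 }.

Definition vague_map (s : configuration) : {ptws Cc -> R} :=
  fun f => \int[s]_z f z.

HB.instance Definition _ :=
  Topological.copy configuration (initial_topology vague_map).

HB.instance Definition _ :=
  Measurable.copy configuration (g_sigma_algebraType (@open configuration)).

End configurations.

Section determinantal_point_processes.
Context {R : realType}.
Implicit Types (m : {measure set (plane R) -> \bar R})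
  (P : probability (configuration R) R) (K : plane R -> plane R -> R[i]).

(* Integral of f over k copies of the plane, one variable at a time. *)
Fixpoint iterated_integral m (k : nat) :
    (k.-tuple (plane R) -> \bar R) -> \bar R :=
  if k is k'.+1 then
    fun f => (\int[m]_z iterated_integral m
                (fun zs : k'.-tuple (plane R) => f [tuple of z :: zs]))%E
  else fun f => f [tuple].

Definition falling_factorial (x : R) (n : nat) : R :=
  \prod_(i < n) (x - i%:R).

(* rho is the k-point correlation function of P with respect to m:
   for disjoint bounded Borel sets A_i, the integral of rho over a product of k
   of these sets, the j-th factor being A_(c j), equals the expectation of
   \prod_i s(A_i)! / (s(A_i) - k_i)!, where k_i is the number of factors
   equal to A_i. *)
Definition is_correlation_function m P (k : nat)
    (rho : k.-tuple (plane R) -> R) : Prop :=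
  forall (n : nat) (A : 'I_n -> set (plane R)) (c : 'I_k -> 'I_n),
    (forall i, measurable (A i)) -> (forall i, bounded_set (A i)) ->
    trivIset [set: 'I_n] A ->
    (\int[P]_s (\prod_(i < n) falling_factorial (fine (s (A i)))
                                #|[pred j | c j == i]|)%:E)%E =
    iterated_integral m (fun zs =>
      ((\prod_(j < k) \1_(A (c j)) (tnth zs j)) * rho zs)%:E).

(* P is the determinantal point process associated with K and m.  For a
   Hermitian K the determinants are real, so taking the real part only
   changes their type. *)
Definition is_dpp K m P : Prop :=
  forall k : nat, is_correlation_function m P
    (fun zs : k.-tuple (plane R) =>
       complex.Re (\det (\matrix_(i < k, j < k) K (tnth zs i) (tnth zs j)))).

Definition palm_ratio K (l : nat) (x : 'rV[plane R]_l) (z w : plane R) : R[i] :=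
  let p (i : 'I_l.+1) := oapp (x ord0) z (unlift ord0 i) in
  let q (j : 'I_l.+1) := oapp (x ord0) w (unlift ord0 j) in
  \det (\matrix_(i < l.+1, j < l.+1) K (p i) (q j)) /
  \det (\matrix_(i < l, j < l) K (x ord0 i) (x ord0 j)).

(* Continuous extension in x of palm_ratio K x z w from the l-tuples of
   distinct points; R[i]^o is R[i] with the topology of its norm. *)
Definition palm_kernel K (l : nat) (x : 'rV[plane R]_l) (z w : plane R) : R[i] :=
  lim ((palm_ratio K y z w : R[i]^o)
         @[y --> within [set y : 'rV[plane R]_l | injective (y ord0)] (nbhs x)]).

Definition ginibre_kernel (z w : plane R) : R[i] :=
  cexp (toC z * (toC w)^*%C).

Definition is_ginibre_palm (l : nat) (x : 'rV[plane R]_l) P : Prop :=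
  is_dpp (palm_kernel ginibre_kernel x) gaussian P.

End determinantal_point_processes.

Definition weakly_cvg_L2 {d} {T : measurableType d} {R : realType}
    (P : {measure set T -> \bar R}) (F : R -> T -> R) (f : T -> R) : Prop :=
  [/\ forall t, 0 < t -> F t \in Lfun P 2%:E,
      f \in Lfun P 2%:E &
      forall h : T -> R, h \in Lfun P 2%:E ->
        \int[P]_s (F t s * h s) @[t --> +oo] --> \int[P]_s (f s * h s)].

Definition averaged_discrepancy {R : realType} (t : R) (s : configuration R)
    : R :=
  t^-1 * \int[lebesgue_measure]_(r in `[0, t])
           (fine (s (disk (Num.sqrt r))) - r).

(* Main.v *)
From HB Require Import structures.
From mathcomp Require Import all_boot all_order all_algebra.
From mathcomp Require Import all_classical all_reals all_analysis.
From mathcomp Require Import measurable_realfun complex.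
From mathcomp Require Import ring lra.
Require Import Defs.
Set Implicit Arguments. Unset Strict Implicit. Unset Printing Implicit Defensive.
Import Order.TTheory GRing.Theory Num.Theory.
Import numFieldNormedType.Exports.
Import Normc.
Local Open Scope classical_set_scope.
Local Open Scope ring_scope.

(** Write [X_t(s)] for the average over [r] in [0, t] of the number of points of
    [s] in the disk of radius [sqrt r], so that [F_t = X_t - t / 2]. By
    exchanging sums, [X_t] is the linear statistic of the cone
    [tent t z = (1 - `|z|^2 / t)^+], and only the first two moments of these
    statistics matter. Weak convergence follows from three facts about
    [Y_t = F_t + l], by the Hilbert space lemma [weakly_cvg0]: the mean of [Y_t]
    tends to [0], its variance stays bounded, and the covariance of [Y_t] with
    any fixed [Y_q] tends to [0].

    The kernel. Near coinciding points the quotient of determinants defining the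
    Palm kernel degenerates, so the exponentials [exp (z * conj x_i)] are first
    replaced by their divided differences, which are given by the Newton basis.
    The Vandermonde factors cancel ([palm_ratioE]), the new Gram matrix is
    invertible for every [x] ([gram_neq0]), and the Palm kernel is the kernel
    [K] minus an explicit kernel of rank [l] ([palm_kernel_det],
    [palm_defectE]). In the Gaussian [L^2] space of entire functions, where the
    monomials are orthogonal ([fock_isometry]), [K] reproduces the values, and
    the Palm kernel [Kx] is the kernel of the projection to the functions
    orthogonal to the divided differences. Hence the reproducing property
    [\int `|Kx(z, w)|^2 g(dz) = Kx(w, w)] ([integral_palm_corr]) and the trace
    [\int (K - Kx)(z, z) g(dz) = l] ([integral_palm_defect]).

    The moments. The correlation functions of orders one and two, applied to
    disks and annuli, give the joint moments of disk counts
    ([disk_count_product]). Riemann sums over the radius, which converge because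
    counts are monotone in the radius, carry them to the averages [X_t]:
    with [f = tent t] and [h = tent q], the mean of [X_t] is
    [\int f(z) Kx(z, z) g(dz)], and the covariance of [X_t] and [X_q] is
    [\int f(z) h(z) Kx(z, z) g(dz) - \int\int f(z) h(w) `|Kx(z, w)|^2 g(dz) g(dw)].

    The limits. The mean: [\int f(z) K(z, z) g(dz)] is exactly [t / 2], and the
    defect contributes minus its trace in the limit, which is where [- l] comes
    from ([cvg_tent_mean]). The covariance: as [t] grows, [f] tends to [1], and
    the two terms cancel by the reproducing property ([cvg_tent_cov]). The
    variance: again by the reproducing property it equals
    [1/2 \int\int (f(z) - f(w))^2 `|Kx(z, w)|^2], where [f] has slope [1 / t] in
    [`|z|^2] while the kernel only correlates points with [`|z|^2 - `|w|^2] of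
    order [sqrt t]. This gains a factor [1 / t] that balances the [t] points of
    the disk ([tent_energy], [tent_var_bounded]). *)

(** * Complex norms and limits *)

Section complex_limits.
Variable R : realType.
Implicit Types z w : R[i].

Lemma ReD z w : complex.Re (z + w) = complex.Re z + complex.Re w.
Proof. by case: z; case: w. Qed.

Lemma ImD z w : complex.Im (z + w) = complex.Im z + complex.Im w.
Proof. by case: z; case: w. Qed.

Lemma ReN z : complex.Re (- z) = - complex.Re z. Proof. by case: z. Qed.

Lemma ImN z : complex.Im (- z) = - complex.Im z. Proof. by case: z. Qed.

Lemma ReM z w : complex.Re (z * w) =
  complex.Re z * complex.Re w - complex.Im z * complex.Im w.
Proof. by case: z; case: w. Qed.

Lemma ImM z w : complex.Im (z * w) =
  complex.Re z * complex.Im w + complex.Im z * complex.Re w.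
Proof. by case: z; case: w. Qed.

Lemma ReJ z : complex.Re z^*%C = complex.Re z. Proof. by case: z. Qed.

Lemma ImJ z : complex.Im z^*%C = - complex.Im z. Proof. by case: z. Qed.

Lemma Re_sum (I : Type) (r : seq I) (P : pred I) (f : I -> R[i]) :
  complex.Re (\sum_(i <- r | P i) f i) = \sum_(i <- r | P i) complex.Re (f i).
Proof. exact: (big_morph _ ReD). Qed.

Lemma Im_sum (I : Type) (r : seq I) (P : pred I) (f : I -> R[i]) :
  complex.Im (\sum_(i <- r | P i) f i) = \sum_(i <- r | P i) complex.Im (f i).
Proof. exact: (big_morph _ ImD). Qed.

Lemma natrC n : n%:R = (n%:R : R)%:C%C :> R[i].
Proof. by rewrite (rmorph_nat (real_complex R)). Qed.

Lemma natrC_inv n : n%:R^-1 = (n%:R^-1 : R)%:C%C :> R[i].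
Proof. by rewrite natrC (fmorphV (real_complex R)). Qed.

Lemma complex_ext z w :
  complex.Re z = complex.Re w -> complex.Im z = complex.Im w -> z = w.
Proof. by case: z; case: w => a b c d /= -> ->. Qed.

Lemma normrC z : `|z| = (normc z)%:C%C. Proof. by []. Qed.

Lemma normc_ge0 z : 0 <= normc z.
Proof. by case: z => a b; rewrite /normc sqrtr_ge0. Qed.

Lemma normc_Re z : `|complex.Re z| <= normc z.
Proof.
case: z => a b /=; rewrite -sqrtr_sqr ler_wsqrtr//.
by rewrite lerDl sqr_ge0.
Qed.

Lemma normc_Im z : `|complex.Im z| <= normc z.
Proof.
case: z => a b /=; rewrite -sqrtr_sqr ler_wsqrtr//.
by rewrite lerDr sqr_ge0.
Qed.

Lemma normc_sqr z : normc z ^+ 2 = complex.Re z ^+ 2 + complex.Im z ^+ 2.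
Proof. by case: z => a b; rewrite /normc sqr_sqrtr// addr_ge0 ?sqr_ge0. Qed.

Lemma normc_le z : normc z <= `|complex.Re z| + `|complex.Im z|.
Proof.
rewrite -[leRHS]ger0_norm ?addr_ge0// -sqrtr_sqr.
case: z => a b; rewrite /normc ler_wsqrtr//= sqrrD !real_normK ?num_real//.
by rewrite -addrA lerD2l lerDr mulrn_wge0// mulr_ge0.
Qed.

Lemma normc_conj z : normc (z^*)%C = normc z.
Proof. by case: z => a b /=; rewrite sqrrN. Qed.

Lemma normcX z n : normc (z ^+ n) = normc z ^+ n.
Proof.
by elim: n => [|n ih]; rewrite ?expr0 ?normc1// !exprS normcM ih.
Qed.

Lemma normc_real (a : R) : normc a%:C%C = `|a|.
Proof. by rewrite /normc/= expr0n addr0 sqrtr_sqr. Qed.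

Lemma normc_sum (I : Type) (r : seq I) (P : pred I) (f : I -> R[i]) :
  normc (\sum_(i <- r | P i) f i) <= \sum_(i <- r | P i) normc (f i).
Proof.
apply: (big_ind2 (fun x y => normc x <= y)) => [|x1 y1 x2 y2 h1 h2|//].
  by rewrite normc0.
by rewrite (le_trans (le_normcD _ _))// lerD.
Qed.

Lemma mulc_conj z : z * z^*%C = ((normc z) ^+ 2)%:C%C.
Proof.
rewrite normc_sqr; case: z => a b; apply: complex_ext => /=; ring.
Qed.

(** Reduces limits in the norm of [R[i]] to real ones; the series below are
    defined, and proved to converge, one coordinate at a time. *)
Lemma cvg_complexP (T : Type) (F : set_system T) (FF : Filter F)
    (f : T -> R[i]) (l : R[i]) :
  ((f : T -> R[i]^o) @ F --> (l : R[i]^o)) <->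
  ((complex.Re (f x) @[x --> F] --> complex.Re l) /\
   (complex.Im (f x) @[x --> F] --> complex.Im l)).
Proof.
split=> [/cvgrPdist_lt fl|[/cvgrPdist_lt rl /cvgrPdist_lt il]].
  split; apply/cvgrPdist_lt => e e0.
  - have e0' : 0 < e%:C%C by rewrite ltcR.
    apply: filterS (fl _ e0') => t; rewrite normrC ltcR; apply: le_lt_trans.
    by rewrite (le_trans _ (normc_Re _))// ReD ReN.
  - have e0' : 0 < e%:C%C by rewrite ltcR.
    apply: filterS (fl _ e0') => t; rewrite normrC ltcR; apply: le_lt_trans.
    by rewrite (le_trans _ (normc_Im _))// ImD ImN.
apply/cvgrPdist_lt => -[e e']; rewrite ltcE/= => /andP[/eqP -> e0].
have e20 : 0 < e / 2 by rewrite divr_gt0.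
near=> t; rewrite normrC ltcR (le_lt_trans (normc_le _))//.
rewrite ReD ReN ImD ImN [ltRHS]splitr ltrD//; near: t.
- exact: rl.
- exact: il.
Unshelve. all: by end_near. Qed.

Lemma cvg_conjc (T : Type) (F : set_system T) (FF : Filter F)
    (f : T -> R[i]) (l : R[i]) :
  (f : T -> R[i]^o) @ F --> (l : R[i]^o) ->
  ((fun t => (f t)^*%C) : T -> R[i]^o) @ F --> (l^*%C : R[i]^o).
Proof.
move=> /cvg_complexP[fr fi]; apply/cvg_complexP; split.
  by rewrite ReJ; under eq_fun do rewrite ReJ.
by rewrite ImJ; under eq_fun do rewrite ImJ; exact: cvgN.
Qed.

Lemma cvg_sub0 (K : numFieldType) (T : Type) (F : set_system T)
    {FF : Filter F} (f g : T -> K^o) (a : K^o) :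
  f @ F --> a -> g @ F --> (0 : K^o) -> (fun t => f t - g t) @ F --> a.
Proof. by move=> fa g0; rewrite -[a]subr0; exact: cvgB. Qed.

Lemma cvg_bigsum (K : numFieldType) (T I : Type) (F : set_system T)
    (FF : Filter F) (r : seq I) (P : pred I) (f : I -> T -> K^o) (l : I -> K^o) :
  (forall i, P i -> f i @ F --> l i) ->
  (fun t => \sum_(i <- r | P i) f i t) @ F --> \sum_(i <- r | P i) l i.
Proof.
move=> fl; elim: r => [|i r ih].
  by rewrite big_nil; under eq_fun do rewrite big_nil; exact: cvg_cst.
rewrite big_cons; under eq_fun do rewrite big_cons.
by case: ifPn => // Pi; apply: cvgD => //; exact: fl.
Qed.

Lemma cvg_bigprod (K : numFieldType) (T I : Type) (F : set_system T)
    (FF : Filter F) (r : seq I) (P : pred I) (f : I -> T -> K^o) (l : I -> K^o) :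
  (forall i, P i -> f i @ F --> l i) ->
  (fun t => (\prod_(i <- r | P i) (f i t : K) : K^o)) @ F -->
  (\prod_(i <- r | P i) (l i : K) : K^o).
Proof.
move=> fl; elim: r => [|i r ih].
  by rewrite big_nil; under eq_fun do rewrite big_nil; exact: cvg_cst.
rewrite big_cons; under eq_fun do rewrite big_cons.
by case: ifPn => // Pi; apply: cvgM => //; exact: fl.
Qed.

Lemma cvg_det (K : numFieldType) (T : Type) (F : set_system T)
    (FF : Filter F) n (f : T -> 'M[K]_n) (l : 'M[K]_n) :
  (forall i j, (fun t => f t i j : K^o) @ F --> (l i j : K^o)) ->
  (fun t => \det (f t) : K^o) @ F --> (\det l : K^o).
Proof.
move=> fl; apply: cvg_bigsum => s _; apply: cvgM; first exact: cvg_cst.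
by apply: cvg_bigprod => i _; exact: fl.
Qed.

End complex_limits.

(** * Series with factorial denominators *)

Section factorial_series.
Variable R : realType.
Implicit Types (a b : nat -> R[i]) (D B : R).

(** With the weights [1 / k`!], one and the same series gives the values of an
    entire function, for [a k = c k * z ^+ k], and the inner product of two of
    them in the Gaussian [L^2] space, for [a k = c k * (d k)^*]. *)
Definition fact_psum a N : R[i] := \sum_(k < N) a k / k`!%:R.

Definition fact_series a : R[i] :=
  (limn (fun N => complex.Re (fact_psum a N)) +i*
   limn (fun N => complex.Im (fact_psum a N)))%C.

Definition expo_bound D B a := forall n, normc (a n) <= D * B ^+ n.

Lemma expo_bound_D_ge0 D B a : expo_bound D B a -> 0 <= D.
Proof. by move=> /(_ 0)/(le_trans (normc_ge0 _)); rewrite expr0 mulr1. Qed.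

Lemma normc_fact k : normc (k`!%:R^-1 : R[i]) = k`!%:R^-1.
Proof. by rewrite natrC_inv normc_real ger0_norm. Qed.

Lemma normc_fact_psum_sub D B a M N : expo_bound D B a -> (M <= N)%N ->
  normc (fact_psum a N - fact_psum a M) <=
  D * (series (exp_coeff B) N - series (exp_coeff B) M).
Proof.
move=> aB MN; rewrite /fact_psum -!(big_mkord xpredT (fun k => a k / k`!%:R)).
rewrite sub_series_geq// (@big_cat_nat _ _ _ M 0 N)//= [_ + _ - _]addrAC subrr add0r.
rewrite (le_trans (normc_sum _ _ _))// mulr_sumr ler_sum// => k _.
by rewrite normcM normc_fact /exp_coeff/= mulrA ler_wpM2r.
Qed.

Lemma series_exp_le B M N : 0 <= B -> (M <= N)%N ->
  series (exp_coeff B) M <= series (exp_coeff B) N.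
Proof.
move=> B0 MN; rewrite -subr_ge0 sub_series_geq// sumr_ge0// => k _.
exact: exp_coeff_ge0.
Qed.

Lemma series_exp_le_expR B N : 0 <= B -> series (exp_coeff B) N <= expR B.
Proof.
move=> B0; rewrite /expR; apply: nondecreasing_cvgn_le; last first.
  exact: is_cvg_series_exp_coeff.
by move=> m n mn; exact: series_exp_le.
Qed.

Lemma cvg_series_exp B : series (exp_coeff B) @ \oo --> expR B.
Proof. exact: is_cvg_series_exp_coeff. Qed.

Lemma normc_fact_psum D B a N : 0 <= B -> expo_bound D B a ->
  normc (fact_psum a N) <= D * expR B.
Proof.
move=> B0 aB; have D0 := expo_bound_D_ge0 aB.
have := normc_fact_psum_sub aB (leq0n N).
rewrite {2}/fact_psum big_ord0 subr0 [X in _ - X](_ : _ = 0) ?subr0; last first.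
  by rewrite /series/= big_geq.
by move=> /le_trans; apply; rewrite ler_wpM2l// (series_exp_le_expR N B0).
Qed.

Lemma cvg_fact_series D B a : 0 <= B -> expo_bound D B a ->
  (fact_psum a : nat -> R[i]^o) @ \oo --> (fact_series a : R[i]^o).
Proof.
move=> B0 aB; apply/cvg_complexP; have D0 := expo_bound_D_ge0 aB.
have main (r : nat -> R) : (forall k, `|r k| <= normc (a k / k`!%:R)) ->
    cvgn (series r).
  move=> ra; apply: normed_cvg.
  apply: (@series_le_cvg _ _ (D *: exp_coeff B)) => //=.
  - by move=> n; rewrite mulr_ge0// exp_coeff_ge0.
  - move=> n; rewrite (le_trans (ra n))// normcM normc_fact.
    by rewrite /exp_coeff/= [leRHS]mulrA ler_wpM2r.
  - by apply: is_cvg_seriesZ; exact: is_cvg_series_exp_coeff.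
split=> /=.
- rewrite (_ : (fun N => _) = series (fun k => complex.Re (a k / k`!%:R))).
    by apply: main => k; exact: normc_Re.
  by apply/funext => N; rewrite /fact_psum Re_sum /series/= big_mkord.
- rewrite (_ : (fun N => _) = series (fun k => complex.Im (a k / k`!%:R))).
    by apply: main => k; exact: normc_Im.
  by apply/funext => N; rewrite /fact_psum Im_sum /series/= big_mkord.
Qed.

Lemma fact_series_unique a (l : R[i]) :
  (fact_psum a : nat -> R[i]^o) @ \oo --> (l : R[i]^o) -> fact_series a = l.
Proof.
move=> /cvg_complexP[rl il]; rewrite /fact_series.
by apply: complex_ext => /=; exact: cvg_lim.
Qed.

Lemma normc_lim_le (T : Type) (F : set_system T) {FF : ProperFilter F}
    (f : T -> R[i]) (l : R[i]) M :
  (f : T -> R[i]^o) @ F --> (l : R[i]^o) ->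
  (\forall t \near F, normc (f t) <= M) -> normc l <= M.
Proof.
move=> fl fM; apply/ler_addgt0Pr => e e0.
have e0' : 0 < e%:C%C by rewrite ltcR.
move/cvgrPdist_lt : fl => /(_ _ e0') fl.
have [t [flt fMt]] := filter_ex (filterI fl fM).
move: flt; rewrite normrC ltcR => flt.
rewrite -[l](subrK (f t)) (le_trans (le_normcD _ _))// addrC.
by rewrite lerD// ltW.
Qed.

Lemma normc_fact_series D B a : 0 <= B -> expo_bound D B a ->
  normc (fact_series a) <= D * expR B.
Proof.
move=> B0 aB; apply: (normc_lim_le (cvg_fact_series B0 aB)).
by apply: nearW => N; exact: normc_fact_psum.
Qed.

Lemma normc_fact_series_tail D B a N : 0 <= B -> expo_bound D B a ->
  normc (fact_series a - fact_psum a N) <=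
  D * (expR B - series (exp_coeff B) N).
Proof.
move=> B0 aB.
have h : (fun M => fact_psum a M - fact_psum a N : R[i]^o) @ \oo -->
    (fact_series a - fact_psum a N : R[i]^o).
  by apply: cvgB; [exact: cvg_fact_series aB|exact: cvg_cst].
apply: (normc_lim_le h).
exists N => // M /= NM; rewrite (le_trans (normc_fact_psum_sub aB NM))//.
rewrite ler_wpM2l ?(expo_bound_D_ge0 aB)// lerD2r.
exact: series_exp_le_expR.
Qed.

(** Along any filter a uniform exponential bound makes the tails uniformly
    small. This gives the continuity in [x] of the entries of the determinants
    that express the Palm kernel. *)
Lemma cvg_fact_series_dominated (T : Type) (F : set_system T) (FF : Filter F)
    (a : T -> nat -> R[i]) b D B : 0 <= B ->
  expo_bound D B b -> (\forall t \near F, expo_bound D B (a t)) ->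
  (forall n, (fun t => a t n : R[i]^o) @ F --> (b n : R[i]^o)) ->
  (fun t => fact_series (a t) : R[i]^o) @ F --> (fact_series b : R[i]^o).
Proof.
move=> B0 bB aB ab; have D0 := expo_bound_D_ge0 bB.
apply/cvgrPdist_lt => -[e e']; rewrite ltcE/= => /andP[/eqP -> {e'} e0].
have e40 : 0 < e / 4 by rewrite divr_gt0.
have tail0 : D * (expR B - series (exp_coeff B) N) @[N --> \oo] --> (0 : R).
  rewrite -(mulr0 D) -(subrr (expR B)).
  by apply: cvgM; [exact: cvg_cst|apply: cvgB; [exact: cvg_cst|exact: cvg_series_exp]].
have [N HN] : exists N, D * (expR B - series (exp_coeff B) N) < e / 4.
  have := @filter_ex _ _ _ _ (cvgr_lt _ tail0 _ e40); exact.
have psumF : (fun t => fact_psum (a t) N : R[i]^o) @ F --> (fact_psum b N : R[i]^o).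
  apply: cvg_bigsum => k _; apply: cvgM; [exact: ab|exact: cvg_cst].
have e40' : 0 < (e / 4)%:C%C by rewrite ltcR.
move/cvgrPdist_lt : psumF => /(_ _ e40') psumF.
near=> t.
have at_ : expo_bound D B (a t) by near: t.
have : `|fact_psum b N - fact_psum (a t) N| < (e / 4)%:C%C by near: t.
rewrite !normrC !ltcR => h.
have -> : fact_series b - fact_series (a t) =
  (fact_series b - fact_psum b N) + (fact_psum b N - fact_psum (a t) N)
  - (fact_series (a t) - fact_psum (a t) N) by ring.
rewrite (le_lt_trans (le_normcD _ _))// normcN.
have h1 := normc_fact_series_tail N B0 bB.
have h2 := normc_fact_series_tail N B0 at_.
rewrite (le_lt_trans (lerD (le_normcD _ _) (lexx _)))//.
lra.
Unshelve. all: by end_near. Qed.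

Lemma fact_psumD a b N :
  fact_psum (fun n => a n + b n) N = fact_psum a N + fact_psum b N.
Proof.
by rewrite /fact_psum -big_split/=; apply: eq_bigr => k _; rewrite mulrDl.
Qed.

Lemma fact_psumZ (c : R[i]) a N :
  fact_psum (fun n => c * a n) N = c * fact_psum a N.
Proof.
by rewrite /fact_psum mulr_sumr; apply: eq_bigr => k _; rewrite mulrA.
Qed.

Lemma fact_psum_conj a N :
  fact_psum (fun n => (a n)^*%C) N = (fact_psum a N)^*%C.
Proof.
rewrite /fact_psum (big_morph (@conjc R) (rmorphD _) (conjc0 _)).
apply: eq_bigr => k _; rewrite rmorphM; congr (_ * _).
by rewrite fmorphV rmorph_nat.
Qed.

Definition has_expo_bound a := exists D, exists2 B, 0 <= B & expo_bound D B a.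

Lemma has_cvg_fact_series a : has_expo_bound a ->
  (fact_psum a : nat -> R[i]^o) @ \oo --> (fact_series a : R[i]^o).
Proof. by move=> [D [B B0 aB]]; exact: cvg_fact_series aB. Qed.

Lemma fact_seriesD a b : has_expo_bound a -> has_expo_bound b ->
  fact_series (fun n => a n + b n) = fact_series a + fact_series b.
Proof.
move=> ha hb; apply: fact_series_unique; rewrite (funext (fact_psumD _ _)).
by apply: cvgD; exact: has_cvg_fact_series.
Qed.

Lemma fact_seriesZ (c : R[i]) a : has_expo_bound a ->
  fact_series (fun n => c * a n) = c * fact_series a.
Proof.
move=> ha; apply: fact_series_unique; rewrite (funext (fact_psumZ _ _)).
by apply: cvgM; [exact: cvg_cst|exact: has_cvg_fact_series].
Qed.

Lemma fact_series_conj a : has_expo_bound a ->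
  fact_series (fun n => (a n)^*%C) = (fact_series a)^*%C.
Proof.
move=> ha; apply: fact_series_unique; rewrite (funext (fact_psum_conj _)).
by apply: cvg_conjc; exact: has_cvg_fact_series.
Qed.

Lemma fact_series0 : fact_series (fun=> 0) = 0.
Proof.
apply: fact_series_unique; rewrite (_ : fact_psum _ = cst 0).
  exact: cvg_cst.
by apply/funext => N; rewrite /fact_psum big1// => k _; rewrite mul0r.
Qed.

Lemma has_expo_bound0 : has_expo_bound (fun=> 0).
Proof. by exists 0, 0 => // n; rewrite normc0 mul0r. Qed.

Lemma has_expo_boundD a b : has_expo_bound a -> has_expo_bound b ->
  has_expo_bound (fun n => a n + b n).
Proof.
move=> [D [B B0 aB]] [D' [B' B'0 aB']]; exists (D + D'), (B + B') => [|n].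
  by rewrite addr_ge0.
rewrite (le_trans (le_normcD _ _))// mulrDl lerD//.
  rewrite (le_trans (aB n))// ler_wpM2l ?(expo_bound_D_ge0 aB)//.
  by rewrite lerXn2r ?nnegrE ?addr_ge0// lerDl.
rewrite (le_trans (aB' n))// ler_wpM2l ?(expo_bound_D_ge0 aB')//.
by rewrite lerXn2r ?nnegrE ?addr_ge0// lerDr.
Qed.

Lemma has_expo_boundM a b : has_expo_bound a -> has_expo_bound b ->
  has_expo_bound (fun n => a n * b n).
Proof.
move=> [D [B B0 aB]] [D' [B' B'0 aB']]; exists (D * D'), (B * B') => [|n].
  by rewrite mulr_ge0.
rewrite normcM exprMn mulrACA ler_pM// ?normc_ge0//.
Qed.

Lemma has_expo_bound_cst (c : R[i]) : has_expo_bound (fun=> c).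
Proof. by exists (normc c), 1 => // n; rewrite expr1n mulr1. Qed.

Lemma has_expo_boundX (c : R[i]) : has_expo_bound (fun n => c ^+ n).
Proof.
by exists 1, (normc c) => [|n]; rewrite ?normc_ge0// mul1r normcX.
Qed.

Lemma has_expo_bound_conj a : has_expo_bound a ->
  has_expo_bound (fun n => (a n)^*%C).
Proof. by move=> [D [B B0 aB]]; exists D, B => // n; rewrite normc_conj. Qed.

Lemma has_expo_bound_sum (I : Type) (r : seq I) (P : pred I)
    (a : I -> nat -> R[i]) : (forall i, P i -> has_expo_bound (a i)) ->
  has_expo_bound (fun n => \sum_(i <- r | P i) a i n).
Proof.
move=> ha; elim: r => [|i r ih].
  by under eq_fun do rewrite big_nil; exact: has_expo_bound0.
have [Pi|nPi] := boolP (P i).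
  under eq_fun do rewrite big_cons Pi.
  by apply: has_expo_boundD => //; exact: ha.
by under eq_fun do rewrite big_cons (negbTE nPi).
Qed.

Lemma fact_series_sum (I : Type) (r : seq I) (P : pred I)
    (a : I -> nat -> R[i]) : (forall i, P i -> has_expo_bound (a i)) ->
  fact_series (fun n => \sum_(i <- r | P i) a i n) =
  \sum_(i <- r | P i) fact_series (a i).
Proof.
move=> ha; elim: r => [|i r ih].
  by under eq_fun do rewrite big_nil; rewrite big_nil fact_series0.
have [Pi|nPi] := boolP (P i).
  under eq_fun do rewrite big_cons Pi.
  by rewrite big_cons Pi fact_seriesD ?ih//; [exact: ha|exact: has_expo_bound_sum].
by under eq_fun do rewrite big_cons (negbTE nPi); rewrite big_cons (negbTE nPi).
Qed.

Lemma fact_series_lin (I : finType) (f : I -> R[i]) (a : I -> nat -> R[i]) :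
  (forall i, has_expo_bound (a i)) ->
  fact_series (fun n => \sum_i f i * a i n) = \sum_i f i * fact_series (a i).
Proof.
move=> ha; rewrite fact_series_sum; last first.
  by move=> i _; apply: has_expo_boundM => //; exact: has_expo_bound_cst.
by apply: eq_bigr => i _; rewrite fact_seriesZ.
Qed.

Lemma fact_series_bilin (I J : finType) (f : I -> R[i]) (g : J -> R[i])
    (a : I -> nat -> R[i]) (b : J -> nat -> R[i]) :
  (forall i, has_expo_bound (a i)) -> (forall j, has_expo_bound (b j)) ->
  fact_series (fun n => (\sum_i f i * a i n) * (\sum_j g j * b j n)) =
  \sum_i \sum_j f i * g j * fact_series (fun n => a i n * b j n).
Proof.
move=> ha hb; under eq_fun do rewrite mulr_suml.
have hab i j : has_expo_bound (fun n => a i n * b j n) by exact: has_expo_boundM.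
transitivity (fact_series (fun n => \sum_i \sum_j f i * g j * (a i n * b j n))).
  congr fact_series; apply/funext => n; apply: eq_bigr => i _.
  by rewrite mulr_sumr; apply: eq_bigr => j _; ring.
rewrite fact_series_sum; last first.
  move=> i _; apply: has_expo_bound_sum => j _; apply: has_expo_boundM => //.
  exact: has_expo_bound_cst.
by apply: eq_bigr => i _; rewrite fact_series_lin.
Qed.

End factorial_series.

(** * The complex exponential as a power series *)

Section complex_exponential.

(** The binomial theorem, in the form of a Cauchy product. *)
Lemma exp_convolution (K : numFieldType) (z w : K) k :
  \sum_(j < k.+1) (z ^+ j / j`!%:R) * (w ^+ (k - j) / (k - j)`!%:R) =
  (z + w) ^+ k / k`!%:R.
Proof.
rewrite [z + w]addrC exprDn mulr_suml; apply: eq_bigr => -[j /= jk] _.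
rewrite -[X in _ = X / _]mulr_natr.
have -> : k`!%:R = 'C(k, j)%:R * (j`!%:R * (k - j)`!%:R) :> K.
  by rewrite -!natrM bin_fact.
have C0 : 'C(k, j)%:R != 0 :> K by rewrite pnatr_eq0 -lt0n bin_gt0.
have f1 : j`!%:R != 0 :> K by rewrite pnatr_eq0 -lt0n fact_gt0.
have f2 : (k - j)`!%:R != 0 :> K by rewrite pnatr_eq0 -lt0n fact_gt0.
by field; rewrite C0 f1 f2.
Qed.

(** The [k]-th coefficient of the product of the exponential polynomials of
    [z] and [w] truncated at degree [M]. *)
Definition exp_conv (K : numFieldType) M (z w : K) k : K :=
  \sum_(j < k.+1) ((if (j < M)%N then z ^+ j / j`!%:R else 0) *
     (if (k - j < M)%N then w ^+ (k - j) / (k - j)`!%:R else 0)).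

Lemma exp_psumM (K : numFieldType) M (z w : K) :
  (\sum_(k < M) z ^+ k / k`!%:R) * (\sum_(k < M) w ^+ k / k`!%:R) =
  \sum_(k < M) (z + w) ^+ k / k`!%:R + \sum_(M <= k < M + M) exp_conv M z w k.
Proof.
pose p (u : K) : {poly K} := \poly_(k < M) (u ^+ k / k`!%:R).
have pE (u : K) : \sum_(k < M) u ^+ k / k`!%:R = (p u).[1].
  by rewrite horner_poly; apply: eq_bigr => k _; rewrite expr1n mulr1.
rewrite pE (pE w) -hornerM.
have sp : (size (p z * p w)%R <= M + M)%N.
  rewrite (leq_trans (size_polyMleq _ _))// (leq_trans (leq_pred _))// leq_add//.
    exact: size_poly.
  exact: size_poly.
have coefp k : (p z * p w)`_k = exp_conv M z w k.
  by rewrite coefM; apply: eq_bigr => j _; rewrite !coef_poly.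
rewrite (horner_coef_wide _ sp).
under eq_bigr do rewrite expr1n mulr1 coefp.
rewrite -(big_mkord xpredT (exp_conv M z w)) (@big_cat_nat _ _ _ M) ?leq_addr//=.
congr (_ + _); rewrite big_mkord; apply: eq_bigr => -[k /= kM] _.
rewrite -exp_convolution; apply: eq_bigr => -[j /= jk] _.
by rewrite !ifT// ?(leq_ltn_trans (leq_subr _ _))// (leq_ltn_trans _ kM).
Qed.

Variable R : realType.
Implicit Types z w : R[i].

Lemma normc_exp_conv M z w k :
  normc (exp_conv M z w k) <= exp_conv M (normc z) (normc w) k.
Proof.
rewrite (le_trans (normc_sum _ _ _))// ler_sum// => j _.
have nE (b : bool) u n : normc (if b then u ^+ n / n`!%:R else 0 : R[i]) =
    (if b then normc u ^+ n / n`!%:R else 0).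
  by case: b; rewrite ?normc0// normcM normc_fact normcX.
by rewrite normcM !nE.
Qed.

Lemma cvg_exp_series z :
  (fact_psum (fun n => z ^+ n) : nat -> R[i]^o) @ \oo -->
  (fact_series (fun n => z ^+ n) : R[i]^o).
Proof. by apply: has_cvg_fact_series; exact: has_expo_boundX. Qed.

(** The product of the truncated series exceeds the truncated series of the sum
    by terms of degree at least [M]. Their norm is bounded by the same terms at
    [normc z] and [normc w], which tend to [0] because the real exponential is
    multiplicative. *)
Lemma exp_seriesD z w :
  fact_series (fun n => (z + w) ^+ n) =
  fact_series (fun n => z ^+ n) * fact_series (fun n => w ^+ n).
Proof.
apply: fact_series_unique.
have cvgM_ : (fun M => fact_psum (fun n => z ^+ n) M * fact_psum (fun n => w ^+ n) M : R[i]^o)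
   @ \oo --> (fact_series (fun n => z ^+ n) * fact_series (fun n => w ^+ n) : R[i]^o).
  by apply: cvgM; exact: cvg_exp_series.
pose d M : R[i] := \sum_(M <= k < M + M) exp_conv M z w k.
have -> : fact_psum (fun n => (z + w) ^+ n) =
  (fun M => fact_psum (fun n => z ^+ n) M * fact_psum (fun n => w ^+ n) M - d M).
  by apply/funext => M; rewrite /fact_psum exp_psumM addrK.
suff d0 : (d : nat -> R[i]^o) @ \oo --> (0 : R[i]^o).
  exact: cvg_sub0 cvgM_ d0.
have dr M : normc (d M) <= series (exp_coeff (normc z)) M * series (exp_coeff (normc w)) M
    - series (exp_coeff (normc z + normc w)) M.
  rewrite /series/= !big_mkord exp_psumM addrAC subrr add0r.
  rewrite (le_trans (normc_sum _ _ _))// ler_sum// => k _.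
  exact: normc_exp_conv.
have : series (exp_coeff (normc z)) M * series (exp_coeff (normc w)) M
    - series (exp_coeff (normc z + normc w)) M @[M --> \oo] --> (0 : R).
  rewrite -(subrr (expR (normc z + normc w))) {1}expRD.
  apply: cvgB; last exact: cvg_series_exp.
  by apply: cvgM; exact: cvg_series_exp.
move=> /cvgrPdist_lt h.
apply/cvgrPdist_lt => -[e e']; rewrite ltcE/= => /andP[/eqP -> e0].
apply: filterS (h _ e0) => M; rewrite !sub0r !normrN normrC ltcR.
by apply: le_lt_trans; rewrite (le_trans (dr M))// ler_norm.
Qed.

Lemma exp_series_real (x : R) :
  fact_series (fun n => (x%:C%C : R[i]) ^+ n) = (expR x)%:C%C.
Proof.
have E N : fact_psum (fun n => (x%:C%C : R[i]) ^+ n) N =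
    (series (exp_coeff x) N)%:C%C.
  rewrite /fact_psum /series/= big_mkord rmorph_sum/=; apply: eq_bigr => k _.
  by rewrite natrC_inv -rmorphXn -rmorphM.
apply: fact_series_unique; apply/cvg_complexP; split => /=.
  by under eq_fun do rewrite E/=; exact: cvg_series_exp.
by under eq_fun do rewrite E/=; exact: cvg_cst.
Qed.

Lemma imaginaryX (y : R) n : ((0 +i* y)%C ^+ n : R[i]) =
  (((~~ odd n)%:R * (-1) ^+ n./2 * y ^+ n) +i*
   ((odd n)%:R * (-1) ^+ n.-1./2 * y ^+ n))%C.
Proof.
elim: n => [|n ih]; first by apply: complex_ext; rewrite /= ?expr0 ?mulr0n ?mul1r ?mul0r ?mulr1.
rewrite exprS ih /= uphalf_half; case: (boolP (odd n)) => on /=.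
  have -> : n./2 = n.-1./2 by case: n on {ih} => //= n; rewrite uphalf_half => /negbTE ->.
  by apply: complex_ext; rewrite ?ReM ?ImM/= ?add1n !exprS; ring.
by apply: complex_ext; rewrite ?ReM ?ImM/= ?add0n !exprS; ring.
Qed.

Lemma exp_series_imaginary (y : R) :
  fact_series (fun n => (0 +i* y)%C ^+ n) = (cos y +i* sin y)%C.
Proof.
apply: fact_series_unique; apply/cvg_complexP; split => /=.
  have -> : (fun N => complex.Re (fact_psum (fun n => (0 +i* y)%C ^+ n) N)) =
      series (cos_coeff y).
    apply/funext => N; rewrite /fact_psum Re_sum /series/= big_mkord.
    apply: eq_bigr => k _; rewrite natrC_inv imaginaryX /cos_coeff/=.
    by rewrite mulr0 subr0.
  by rewrite unlock; exact: is_cvg_series_cos_coeff.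
have -> : (fun N => complex.Im (fact_psum (fun n => (0 +i* y)%C ^+ n) N)) =
    series (sin_coeff y).
  apply/funext => N; rewrite /fact_psum Im_sum /series/= big_mkord.
  apply: eq_bigr => k _; rewrite natrC_inv imaginaryX /sin_coeff/=.
  by rewrite mulr0 add0r.
by rewrite unlock; exact: is_cvg_series_sin_coeff.
Qed.

(** Turns the polar formula of [cexp] into a power series, on which Gaussian
    integration acts term by term. *)
Lemma cexpE z : cexp z = fact_series (fun n => z ^+ n).
Proof.
case: z => x y; rewrite /cexp/=.
have -> : (x +i* y)%C = x%:C%C + (0 +i* y)%C :> R[i].
  by apply: complex_ext; rewrite /= ?addr0 ?add0r.
rewrite exp_seriesD exp_series_real exp_series_imaginary.
by apply: complex_ext => /=; ring.
Qed.

End complex_exponential.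

(** * Divided differences and the Palm determinant *)

Section newton_basis.
Variable K : numFieldType.
Implicit Types (Y : nat -> K) (t : K).

(** The coefficients of [t ^+ n] in the Newton basis with nodes
    [Y 0, Y 1, ...]; [newton_coef Y n i] is the complete homogeneous symmetric
    polynomial of degree [n - i] in [Y 0, ..., Y i]. *)
Fixpoint newton_coef Y n i : K :=
  if n is n'.+1 then
    Y i * newton_coef Y n' i + (if i is i'.+1 then newton_coef Y n' i' else 0)
  else (i == 0%N)%:R.

Definition newton_basis Y i t := \prod_(k < i) (t - Y k).

(** Multiplication by [t] sends a Newton polynomial to a combination of itself
    and of the next one, which is the recursion of [newton_coef]. *)
Lemma newton_expansion Y M t n : newton_basis Y M t = 0 ->
  t ^+ n = \sum_(i < M) newton_coef Y n i * newton_basis Y i t.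
Proof.
case: M => [|M] YMt; first by move: YMt => /eqP; rewrite /newton_basis big_ord0 oner_eq0.
elim: n => [|n ih].
  rewrite big_ord_recl /= /newton_basis big_ord0 mulr1 big1 ?addr0// => i _.
  by rewrite mul0r.
have step i : t * newton_basis Y i t =
    newton_basis Y i.+1 t + Y i * newton_basis Y i t.
  by rewrite /newton_basis big_ord_recr/=; ring.
rewrite exprS ih mulr_sumr.
under eq_bigr do rewrite mulrCA step mulrDr.
under [RHS]eq_bigr => i _ do rewrite /= mulrDl.
rewrite !big_split/= addrC; congr (_ + _).
  by apply: eq_bigr => i _; rewrite mulrCA mulrA.
rewrite big_ord_recr/= YMt mulr0 addr0 [RHS]big_ord_recl/= mul0r add0r.
by apply: eq_bigr => i _.
Qed.

Lemma newton_coef_lt Y n i : (n < i)%N -> newton_coef Y n i = 0.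
Proof.
elim: n i => [|n ih] [|i]//= ni.
by rewrite !ih ?mulr0 ?addr0// ltnW.
Qed.

Lemma newton_coef_diag Y n : newton_coef Y n n = 1.
Proof. by elim: n => [|n ih]//=; rewrite ih newton_coef_lt// mulr0 add0r. Qed.

(** The first [M] rows of coefficients form a unitriangular matrix. *)
Lemma newton_coef_free Y M (v : 'I_M -> K) :
  (forall n, \sum_(i < M) newton_coef Y n i * v i = 0) -> forall i, v i = 0.
Proof.
move=> h i; case: i => i iM; elim/ltn_ind: i iM => i ih iM.
have := h i; rewrite (bigD1 (Ordinal iM))//= newton_coef_diag mul1r.
rewrite big1 ?addr0// => -[j jM] /= ij.
have [ji|ij'] := ltnP j i; first by rewrite ih// mulr0.
rewrite newton_coef_lt ?mul0r// ltn_neqAle ij' andbT.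
by apply: contra ij => /eqP e; apply/eqP/val_inj.
Qed.

End newton_basis.

Lemma det_schur (K : fieldType) n (a : 'M[K]_1) (u : 'rV[K]_n) (v : 'cV[K]_n)
    (G : 'M[K]_n) : \det G != 0 ->
  \det (block_mx a u v G) = \det G * (a - u *m invmx G *m v) ord0 ord0.
Proof.
move=> G0; have Gu : G \in unitmx by rewrite unitmxE unitfE.
have -> : block_mx a u v G =
    block_mx 1%:M (u *m invmx G) 0 1%:M *m
    block_mx (a - u *m invmx G *m v) 0 v G.
  rewrite mulmx_block !mul1mx !mul0mx !add0r subrK.
  by rewrite -mulmxA mulVmx// mulmx1.
by rewrite det_mulmx det_ublock !det1 !mul1r det_lblock det_mx11 mulrC.
Qed.

Lemma det_border (K : comPzRingType) n (a : 'M[K]_1) (u : 'rV[K]_n) (v : 'cV[K]_n)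
    (G V W : 'M[K]_n) :
  \det (block_mx a (u *m V) (W *m v) (W *m G *m V)) =
  \det W * \det (block_mx a u v G) * \det V.
Proof.
have -> : block_mx a (u *m V) (W *m v) (W *m G *m V) =
    block_mx 1%:M 0 0 W *m block_mx a u v G *m block_mx 1%:M 0 0 V.
  by rewrite !mulmx_block !mul1mx !mul0mx !mulmx1 !mulmx0 !(add0r, addr0).
by rewrite !det_mulmx !det_ublock !det1 !mul1r.
Qed.

Lemma mulf_div_cancel (K : fieldType) (a b v w : K) : v != 0 -> w != 0 ->
  (w * b * v) / (w * a * v) = b / a.
Proof.
move=> v0 w0; have [->|a0] := eqVneq a 0.
  by rewrite mulr0 mul0r invr0 !mulr0.
by field; rewrite v0 w0 a0.
Qed.

Section palm_kernel.
Variable R : realType.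
Variable l : nat.
Implicit Types (x y : 'rV[plane R]_l) (z w : R[i]) (p q : plane R).

(** The points are conjugated so that [ginibre_kernel p (x i)] is
    [cexp (toC p * node x i)]; the value [0] from [l] on extends them to a
    sequence of nodes. *)
Definition node x k : R[i] :=
  if insub k is Some i then (toC (x ord0 (i : 'I_l)))^*%C else 0.

Lemma nodeE x (i : 'I_l) : node x i = (toC (x ord0 i))^*%C.
Proof. by rewrite /node valK. Qed.

Definition ncoef x := newton_coef (node x).

Definition node_bound x (r : R) := forall k, normc (node x k) <= r.

Lemma node_bound_ge0 x r : node_bound x r -> 0 <= r.
Proof. by move=> /(_ 0); apply: le_trans; exact: normc_ge0. Qed.

Lemma normc_ncoef x r n i : node_bound x r ->
  normc (ncoef x n i) <= (1 + r) ^+ n.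
Proof.
move=> xr; have r0 := node_bound_ge0 xr.
rewrite /ncoef; elim: n i => [|n ih] i /=.
  by rewrite natrC normc_real expr0 ger0_norm//; case: eqP.
rewrite (le_trans (le_normcD _ _))// exprS mulrDl mul1r addrC lerD//.
  by case: i => [|i]//; rewrite normc0 exprn_ge0// addr_ge0.
by rewrite normcM ler_pM ?normc_ge0.
Qed.

Lemma node_boundP x : exists r, node_bound x r.
Proof.
exists (\sum_(i < l) normc (node x i)) => k; rewrite {1}/node.
case: insubP => [i _ ik|_]; last by rewrite normc0 sumr_ge0// => *; exact: normc_ge0.
by rewrite (bigD1 i)//= nodeE lerDl sumr_ge0// => *; exact: normc_ge0.
Qed.

Lemma ncoef_expo x i : has_expo_bound (fun n => ncoef x n i).
Proof.
have [r xr] := node_boundP x.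
exists 1, (1 + r) => [|n]; first by rewrite addr_ge0 ?(node_bound_ge0 xr).
by rewrite mul1r normc_ncoef.
Qed.

(** Divided differences of [t |-> exp (z * t)] at the first [i + 1] nodes. *)
Definition dd_exp x i z := fact_series (fun n => ncoef x n i * z ^+ n).

(** The Gram matrix of the functions [dd_exp x k] in the Gaussian [L^2] space. *)
Definition gram x : 'M[R[i]]_l :=
  \matrix_(m, k) fact_series (fun n => (ncoef x n m)^*%C * ncoef x n k).

(** The passage from the divided differences to the exponentials at the points;
    its determinant is the Vandermonde product of the nodes. *)
Definition vander x : 'M[R[i]]_l :=
  \matrix_(i, j) newton_basis (node x) i (node x j).

Definition dd_row x z : 'rV[R[i]]_l := \row_k dd_exp x k z.

Definition adj (m n : nat) (A : 'M[R[i]]_(m, n)) : 'M[R[i]]_(n, m) :=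
  map_mx conjc A^T.

Lemma has_dd x i z : has_expo_bound (fun n => ncoef x n i * z ^+ n).
Proof. by apply: has_expo_boundM; [exact: ncoef_expo|exact: has_expo_boundX]. Qed.

Lemma has_gram x i j :
  has_expo_bound (fun n => (ncoef x n i)^*%C * ncoef x n j).
Proof.
by apply: has_expo_boundM; [apply: has_expo_bound_conj|]; exact: ncoef_expo.
Qed.

Lemma nodeX x (j : 'I_l) n :
  node x j ^+ n = \sum_(k < l) ncoef x n k * vander x k j.
Proof.
rewrite (@newton_expansion _ (node x) l); last first.
  by rewrite /newton_basis (bigD1 j)//= subrr mul0r.
by apply: eq_bigr => k _; rewrite mxE.
Qed.

Lemma exp_node x z (j : 'I_l) :
  cexp (z * node x j) = (dd_row x z *m vander x) ord0 j.
Proof.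
rewrite cexpE !mxE.
transitivity (\sum_(k < l) vander x k j * fact_series (fun n => ncoef x n k * z ^+ n)); last first.
  by apply: eq_bigr => k _; rewrite mulrC [dd_row _ _ _ _]mxE.
rewrite -fact_series_lin; last by move=> k; exact: has_dd.
congr fact_series; apply/funext => n; rewrite exprMn nodeX mulr_sumr.
by apply: eq_bigr => k _; ring.
Qed.

Lemma cexp_conj z : cexp z^*%C = (cexp z)^*%C.
Proof.
rewrite !cexpE -fact_series_conj; last exact: has_expo_boundX.
by congr fact_series; apply/funext => n; rewrite rmorphXn.
Qed.

Lemma conjcM z w : (z * w)^*%C = z^*%C * w^*%C. Proof. exact: rmorphM. Qed.

Lemma ginibre_conj p q : ginibre_kernel q p = (ginibre_kernel p q)^*%C.
Proof. by rewrite /ginibre_kernel -cexp_conj conjcM conjcK mulrC. Qed.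

Lemma exp_node_node x (i j : 'I_l) :
  cexp ((node x i)^*%C * node x j) = (adj (vander x) *m gram x *m vander x) i j.
Proof.
rewrite cexpE.
transitivity (fact_series (fun n =>
   (\sum_(m < l) (vander x m i)^*%C * (ncoef x n m)^*%C) *
   (\sum_(k < l) vander x k j * ncoef x n k))).
  congr fact_series; apply/funext => n.
  rewrite exprMn -rmorphXn/= !nodeX rmorph_sum; congr (_ * _).
    by apply: eq_bigr => m _; rewrite rmorphM/= mulrC.
  by apply: eq_bigr => m _; rewrite mulrC.
rewrite fact_series_bilin; last 2 first.
- by move=> m; apply: has_expo_bound_conj; exact: ncoef_expo.
- by move=> m; exact: ncoef_expo.
rewrite exchange_big mxE/=; apply: eq_bigr => k _.
by rewrite !mxE mulr_suml; apply: eq_bigr => m _; rewrite !mxE; ring.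
Qed.

Definition bordered x p q : 'M[R[i]]_(1 + l) :=
  block_mx (ginibre_kernel p q)%:M (dd_row x (toC p)) (adj (dd_row x (toC q)))
    (gram x).

(** Row and column operations replace the kernel at the points by its divided
    differences. They multiply both determinants by the squared modulus of the
    Vandermonde determinant, and the quotient that remains makes sense at
    coinciding points too. *)
Lemma palm_ratioE x p q : \det (vander x) != 0 ->
  palm_ratio ginibre_kernel x p q = \det (bordered x p q) / \det (gram x).
Proof.
move=> V0; rewrite /palm_ratio.
set A := (X in \det X / _); set B := (X in _ / \det X).
have KxE a j : ginibre_kernel a (x ord0 j) = (dd_row x (toC a) *m vander x) ord0 j.
  by rewrite -exp_node nodeE.
have BE : B = adj (vander x) *m gram x *m vander x.
  by apply/matrixP => i j; rewrite mxE -exp_node_node !nodeE conjcK.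
have AE : (A : 'M[R[i]]_(1 + l)) = block_mx (ginibre_kernel p q)%:M (dd_row x (toC p) *m vander x)
   (adj (vander x) *m adj (dd_row x (toC q))) (adj (vander x) *m gram x *m vander x).
  apply/(@matrixP _ (1 + l) (1 + l)) => i j; rewrite /A mxE.
  case: (@split_ordP 1 l i) => i' ->; case: (@split_ordP 1 l j) => j' ->.
  - rewrite block_mxEul mxE !ord1 eqxx mulr1n.
    by rewrite (_ : lshift l 0 = ord0) ?unlift_none//; apply/val_inj.
  - rewrite block_mxEur !ord1 (_ : lshift l 0 = ord0); last exact/val_inj.
    by rewrite unlift_none rshift1 liftK/= KxE.
  - rewrite block_mxEdl !ord1 (_ : lshift l 0 = ord0); last exact/val_inj.
    rewrite unlift_none rshift1 liftK/= ginibre_conj KxE !mxE rmorph_sum.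
    by apply: eq_bigr => k _; rewrite !mxE rmorphM/= mulrC.
  - rewrite block_mxEdr !rshift1 !liftK/= -BE mxE//.
rewrite AE BE det_border !det_mulmx -/(bordered x p q).
have W0 : \det (adj (vander x)) != 0.
  by rewrite /adj det_map_mx det_tr conjc_eq0.
exact: mulf_div_cancel.
Qed.

Lemma toC_inj : injective (@toC R).
Proof. by move=> [a b] [c d] [-> ->]. Qed.

Lemma vander_neq0 x : injective (x ord0) -> \det (vander x) != 0.
Proof.
move=> xinj; rewrite -det_tr det_trig; last first.
  apply/is_trig_mxP => i j ij; rewrite !mxE /newton_basis.
  by rewrite (bigD1 (Ordinal ij))//= subrr mul0r.
apply/prodf_neq0 => i _; rewrite !mxE; apply/prodf_neq0 => -[k ki] _ /=.
have kl : (k < l)%N by rewrite (ltn_trans ki).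
rewrite subr_eq0 (nodeE x (Ordinal kl)) nodeE.
apply: contraTN ki => /eqP/(can_inj (@conjcK _))/toC_inj/xinj ->.
by rewrite ltnn.
Qed.

(** The Gram matrix is invertible also at points [x] with repetitions: on its
    kernel the form [\sum_n `|\sum_k ncoef x n k * v k|^2 / n`!] vanishes. *)
Lemma gram_neq0 x : \det (gram x) != 0.
Proof.
apply/negP => /det0P[v v0 vG].
pose s n := \sum_(k < l) ncoef x n k * (v ord0 k)^*%C.
have hs : has_expo_bound s.
  apply: has_expo_bound_sum => k _.
  by apply: has_expo_boundM; [exact: ncoef_expo|exact: has_expo_bound_cst].
have hss : has_expo_bound (fun n => (s n)^*%C * s n).
  by apply: has_expo_boundM => //; exact: has_expo_bound_conj.
have s0 : fact_series (fun n => (s n)^*%C * s n) = 0.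
  transitivity (fact_series (fun n =>
     (\sum_(m < l) v ord0 m * (ncoef x n m)^*%C) *
     (\sum_(k < l) (v ord0 k)^*%C * ncoef x n k))).
    congr fact_series; apply/funext => n; rewrite /s rmorph_sum; congr (_ * _).
      by apply: eq_bigr => m _; rewrite rmorphM/= conjcK mulrC.
    by apply: eq_bigr => m _; rewrite mulrC.
  rewrite fact_series_bilin; last 2 first.
  - by move=> m; apply: has_expo_bound_conj; exact: ncoef_expo.
  - by move=> m; exact: ncoef_expo.
  rewrite exchange_big/= big1// => k _.
  transitivity ((v *m gram x) ord0 k * (v ord0 k)^*%C).
    by rewrite mxE mulr_suml; apply: eq_bigr => m _; rewrite !mxE; ring.
  by rewrite vG mxE mul0r.
have sn n : s n = 0.
  apply/eqP; apply: contraTT isT => sn0.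
  have p0 : 0 < normc (s n) ^+ 2 / n`!%:R.
    rewrite divr_gt0 ?ltr0n ?fact_gt0// exprn_gt0// lt_neqAle normc_ge0 andbT.
    by apply: contra sn0 => /eqP/esym/eq0_normc ->.
  have /cvg_complexP[+ _] := has_cvg_fact_series hss.
  rewrite s0/= => /cvgrPdist_lt/(_ _ p0)[N _ /(_ (maxn N n.+1))/=].
  rewrite leq_maxl => /(_ isT); rewrite sub0r normrN /fact_psum Re_sum.
  rewrite ger0_norm; last first.
    apply: sumr_ge0 => k _.
    by rewrite mulrC mulrC [_^*%C * _]mulrC mulc_conj natrC_inv ReM/= mulr0 subr0 mulr_ge0 ?sqr_ge0.
  have nN : (n < maxn N n.+1)%N by rewrite leq_max leqnn orbT.
  rewrite (bigD1 (Ordinal nN))//= [_^*%C * _]mulrC mulc_conj natrC_inv ReM/= mulr0 subr0.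
  rewrite ltNge lerDl sumr_ge0// => k _.
  by rewrite [_^*%C * _]mulrC mulc_conj natrC_inv ReM/= mulr0 subr0 mulr_ge0 ?sqr_ge0.
move: v0 => /eqP; apply; apply/rowP => k; rewrite mxE.
have := newton_coef_free (Y := node x) (v := fun k : 'I_l => (v ord0 k)^*%C) sn k.
by move=> /eqP; rewrite conjc_eq0 => /eqP.
Qed.

End palm_kernel.

(** * Continuity of the Palm kernel in the conditioning points *)

Section palm_kernel_continuity.
Variable R : realType.
Variable l : nat.
Implicit Types (x y : 'rV[plane R]_l) (z w : R[i]) (p q : plane R).

Lemma cvg_fst_comp (T : Type) (F : set_system T) {FF : Filter F}
    (f : T -> plane R) p : f @ F --> p -> (fun t => (f t).1) @ F --> p.1.
Proof. by move=> fp; apply: cvg_comp fp _; exact: cvg_fst. Qed.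

Lemma cvg_snd_comp (T : Type) (F : set_system T) {FF : Filter F}
    (f : T -> plane R) p : f @ F --> p -> (fun t => (f t).2) @ F --> p.2.
Proof. by move=> fp; apply: cvg_comp fp _; exact: cvg_snd. Qed.

(* Only the convergence of the coordinates enters, so the filter is kept
   abstract: it will be the neighbourhoods of [x] restricted to the tuples of
   distinct points. *)
Section along_filter.
Variables (x : 'rV[plane R]_l) (F : set_system 'rV[plane R]_l).
Context {FF : ProperFilter F}.
Hypothesis Fx : forall i : 'I_l,
  (fun y : 'rV[plane R]_l => y ord0 i) @ F --> x ord0 i.

Lemma cvg_node k : (node y k : R[i]^o) @[y --> F] --> (node x k : R[i]^o).
Proof.
have [kl|lk] := ltnP k l; last first.
  rewrite /node insubF ?ltnNge ?lk//; exact: cvg_cst.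
under eq_fun do rewrite (nodeE _ (Ordinal kl)).
rewrite (nodeE _ (Ordinal kl)); apply: cvg_conjc; apply/cvg_complexP; split; rewrite /toC/=.
  exact: (cvg_fst_comp (@Fx (Ordinal kl))).
exact: (cvg_snd_comp (@Fx (Ordinal kl))).
Qed.

Lemma cvg_ncoef n i :
  (ncoef y n i : R[i]^o) @[y --> F] --> (ncoef x n i : R[i]^o).
Proof.
rewrite /ncoef; elim: n i => [|n ih] i /=; first exact: cvg_cst.
apply: cvgD; first by apply: cvgM; [exact: cvg_node|exact: ih].
by case: i => [|i]; [exact: cvg_cst|exact: ih].
Qed.

Lemma near_node_bound : exists r,
  [/\ 0 <= r, node_bound x r & \forall y \near F, node_bound y r].
Proof.
have [r xr] := node_boundP x; have r0 := node_bound_ge0 xr.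
exists (r + 1); split; first by rewrite addr_ge0.
  by move=> k; rewrite (le_trans (xr k))// lerDl.
have h : \forall y \near F, forall i : 'I_l, normc (node y i) <= r + 1.
  apply: filter_forall => i.
  have e0 : 0 < (1 : R)%:C%C by rewrite ltcR.
  have /cvgrPdist_lt/(_ _ e0) := @cvg_node i.
  apply: filterS => y; rewrite normrC ltcR => h.
  rewrite -[node y i](subrK (node x i)) (le_trans (le_normcD _ _))// addrC.
  by rewrite lerD// -normcN opprB ltW.
apply: filterS h => y h k; have [kl|lk] := ltnP k l.
  exact: (h (Ordinal kl)).
by rewrite /node insubF ?ltnNge ?lk// normc0 addr_ge0.
Qed.

Lemma cvg_dd i z : (dd_exp y i z : R[i]^o) @[y --> F] --> (dd_exp x i z : R[i]^o).
Proof.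
have [r [r0 xr nr]] := near_node_bound.
have B y : node_bound y r ->
    expo_bound 1 ((1 + r) * normc z) (fun n => ncoef y n i * z ^+ n).
  move=> yr n; rewrite mul1r normcM normcX exprMn ler_wpM2r//.
    by rewrite exprn_ge0// normc_ge0.
  exact: normc_ncoef.
apply: (@cvg_fact_series_dominated _ _ _ _ _ _ 1 ((1 + r) * normc z)).
- by rewrite mulr_ge0 ?normc_ge0// addr_ge0.
- exact: B.
- by apply: filterS nr => y; exact: B.
- by move=> n; apply: cvgM; [exact: cvg_ncoef|exact: cvg_cst].
Qed.

Lemma cvg_gram i j : (gram y i j : R[i]^o) @[y --> F] --> (gram x i j : R[i]^o).
Proof.
have [r [r0 xr nr]] := near_node_bound.
have B y : node_bound y r ->
    expo_bound 1 ((1 + r) * (1 + r)) (fun n => (ncoef y n i)^*%C * ncoef y n j).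
  move=> yr n; rewrite mul1r normcM exprMn normc_conj.
  by rewrite ler_pM ?normc_ge0//; exact: normc_ncoef.
under eq_fun do rewrite mxE; rewrite mxE.
apply: (@cvg_fact_series_dominated _ _ _ _ _ _ 1 ((1 + r) * (1 + r))).
- by rewrite mulr_ge0// addr_ge0.
- exact: B.
- by apply: filterS nr => y; exact: B.
- by move=> n; apply: cvgM; [apply: cvg_conjc|]; exact: cvg_ncoef.
Qed.

Lemma cvg_bordered p q (i j : 'I_(1 + l)) :
  (bordered y p q i j : R[i]^o) @[y --> F] --> (bordered x p q i j : R[i]^o).
Proof.
rewrite /bordered.
case: (split_ordP i) => i' ->; case: (split_ordP j) => j' ->.
- by under eq_fun do rewrite block_mxEul; rewrite block_mxEul; exact: cvg_cst.
- under eq_fun do rewrite block_mxEur mxE; rewrite block_mxEur mxE.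
  exact: cvg_dd.
- under eq_fun do rewrite block_mxEdl !mxE; rewrite block_mxEdl !mxE.
  by apply: cvg_conjc; exact: cvg_dd.
- under eq_fun do rewrite block_mxEdr; rewrite block_mxEdr.
  exact: cvg_gram.
Qed.

End along_filter.

Lemma cvg_coord x (i : 'I_l) :
  (fun y : 'rV[plane R]_l => y ord0 i) @ x --> x ord0 i.
Proof.
move=> A /= xA; exists (fun _ j => if j == i then A else setT).
  by move=> i' j; rewrite !ord1; case: eqP => [->|_]//; exact: filterT.
by move=> y /(_ ord0 i); rewrite eqxx.
Qed.

(** Moving the [i]-th point by [i * t] separates the points for small [t > 0]. *)
Lemma within_injective_proper x :
  ProperFilter (within [set y : 'rV[plane R]_l | injective (y ord0)] (nbhs x)).
Proof.
apply: Build_ProperFilter_ex => A; rewrite /within/= => xA.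
pose y (t : R) : 'rV[plane R]_l :=
  \row_i ((x ord0 i).1 + t * (i : nat)%:R, (x ord0 i).2).
have yx : y t @[t --> 0^'+] --> x.
  move=> B [P xP PB].
  have : \forall t \near (0 : R)^'+, forall i (j : 'I_l), P i j (y t i j).
    apply: filter_forall => i; apply: filter_forall => j.
    have : y t i j @[t --> 0^'+] --> x i j.
      have -> : i = ord0 by rewrite ord1.
      under eq_fun do rewrite mxE.
      have h (a b c : R) : ((a + t * c, b) : plane R) @[t --> (0 : R)] -->
          ((a, b) : plane R).
        suff h1 : a + t * c @[t --> (0 : R)] --> a.
          have h2 : cst b @ (0 : R) --> b by exact: cvg_cst.
          exact: (@cvg_pair _ _ _ _ _ _ _ _ _ _ _ h1 h2).
        rewrite -[X in _ --> X]addr0; apply: cvgD; first exact: cvg_cst.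
        by rewrite -[X in _ --> X](mul0r c); apply: cvgMl; exact: cvg_id.
      by rewrite [x ord0 j]surjective_pairing; apply: cvg_within_filter; exact: h.
    by apply; exact: xP.
  by apply: filterS => t; exact: PB.
have inj : \forall t \near (0 : R)^'+, injective (y t ord0).
  have : \forall t \near (0 : R)^'+, forall i j : 'I_l, i != j ->
      (y t ord0 i).1 != (y t ord0 j).1.
    apply: filter_forall => i; apply: filter_forall => j.
    have [->|ij] := eqVneq i j; first exact: nearW.
    have ij0 : (i : nat)%:R - (j : nat)%:R != 0 :> R by rewrite subr_eq0 eqr_nat.
    pose d := ((x ord0 j).1 - (x ord0 i).1) / ((i : nat)%:R - (j : nat)%:R).
    have [d0|d0] := leP d 0.
      near=> t => _; rewrite !mxE/=; apply/eqP => e.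
      suff : t = d by apply/eqP; rewrite gt_eqF// (le_lt_trans d0).
      by apply: (mulIf ij0); rewrite /d divfK//; lra.
    near=> t => _; rewrite !mxE/=; apply/eqP => e.
    suff : t = d by apply/eqP; rewrite lt_eqF//; near: t; exact: nbhs_right_lt.
    by apply: (mulIf ij0); rewrite /d divfK//; lra.
  apply: filterS => t h i j e; apply/eqP; apply: contraT => ij.
  by have := h _ _ ij; rewrite e eqxx.
have yA : \forall t \near (0 : R)^'+, injective (y t ord0) -> A (y t) by exact: yx xA.
have Ay : \forall t \near (0 : R)^'+, A (y t).
  by apply: filterS2 yA inj => t; exact.
have [t At] := @filter_ex _ _ (at_right_proper_filter (0 : R)) _ Ay.
by exists (y t).
Unshelve. all: by end_near. Qed.

(** The continuous extension in explicit form: both determinants are continuous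
    in [x] and the denominator vanishes nowhere. *)
Lemma palm_kernel_det x p q :
  palm_kernel ginibre_kernel x p q = \det (bordered x p q) / \det (gram x).
Proof.
rewrite /palm_kernel; set F := within _ _.
have FF : ProperFilter F := within_injective_proper x.
apply: (@cvg_lim R[i]^o (@norm_hausdorff R[i] R[i]^o)).
have Fx (i : 'I_l) : (fun y : 'rV[plane R]_l => y ord0 i) @ F --> x ord0 i.
  by apply: cvg_within_filter; exact: cvg_coord.
have : (\det (bordered y p q) / \det (gram y) : R[i]^o) @[y --> F] -->
    (\det (bordered x p q) / \det (gram x) : R[i]^o).
  apply: cvgM; first by apply: cvg_det => i j; exact: cvg_bordered.
  apply: cvgV; first exact: gram_neq0.
  by apply: cvg_det => i j; exact: cvg_gram.
apply: cvg_trans; apply: near_eq_cvg.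
by near=> y; rewrite palm_ratioE//; apply: vander_neq0; near: y; exact: withinT.
Unshelve. all: by end_near. Qed.

End palm_kernel_continuity.

(** * The Palm kernel as the kernel of a projection *)

Section palm_kernel_algebra.
Variable R : realType.
Variable l : nat.
Variable x : 'rV[plane R]_l.
Implicit Types (z w : R[i]) (p q : plane R).

Let G := gram x.
Let B := invmx G.
Local Notation Kx := (palm_kernel ginibre_kernel x).

(** The entire function with Taylor coefficients [a n / n`!]. *)
Definition fock (a : nat -> R[i]) z := fact_series (fun n => a n * z ^+ n).

Lemma has_fock a z : has_expo_bound a -> has_expo_bound (fun n => a n * z ^+ n).
Proof. by move=> ha; apply: has_expo_boundM => //; exact: has_expo_boundX. Qed.

Lemma gram_unit : G \in unitmx.
Proof. by rewrite unitmxE unitfE gram_neq0. Qed.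

(** Coordinates, in the divided differences, of the orthogonal projection of
    [ginibre_kernel^~ q] to their span. *)
Definition palm_weight q : 'cV[R[i]]_l := B *m adj (dd_row x (toC q)).

Lemma palm_kernelE p q : Kx p q =
  ginibre_kernel p q - (dd_row x (toC p) *m palm_weight q) ord0 ord0.
Proof.
rewrite palm_kernel_det /bordered det_schur ?gram_neq0//.
rewrite mulrAC mulfV ?gram_neq0// mul1r /palm_weight mulmxA.
by rewrite mxE [X in X + _]mxE eqxx mulr1n [X in _ + X]mxE.
Qed.

Lemma conjcB z w : (z - w)^*%C = z^*%C - w^*%C. Proof. exact: rmorphB. Qed.

Lemma conjcD z w : (z + w)^*%C = z^*%C + w^*%C. Proof. exact: rmorphD. Qed.

Lemma conjcX z n : (z ^+ n)^*%C = z^*%C ^+ n. Proof. exact: rmorphXn. Qed.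

Lemma conjc_sum (I : Type) (r : seq I) (P : pred I) (f : I -> R[i]) :
  (\sum_(i <- r | P i) f i)^*%C = \sum_(i <- r | P i) (f i)^*%C.
Proof. exact: rmorph_sum. Qed.

Lemma adjE (m n : nat) (A : 'M[R[i]]_(m, n)) i j : adj A i j = (A j i)^*%C.
Proof. by rewrite !mxE. Qed.

Lemma dd_rowE z i k : dd_row x z i k = dd_exp x k z. Proof. by rewrite mxE. Qed.

Lemma adjM (m n k : nat) (A : 'M[R[i]]_(m, n)) (C : 'M[R[i]]_(n, k)) :
  adj (A *m C) = adj C *m adj A.
Proof. by rewrite /adj trmx_mul map_mxM. Qed.

Lemma adjK (m n : nat) (A : 'M[R[i]]_(m, n)) : adj (adj A) = A.
Proof. by apply/matrixP => i j; rewrite !mxE conjcK. Qed.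

Lemma adj_gram : adj G = G.
Proof.
apply/matrixP => i j; rewrite !mxE -fact_series_conj; last exact: has_gram.
by congr fact_series; apply/funext => n; rewrite conjcM conjcK mulrC.
Qed.

Lemma adj_gram_inv : adj B = B.
Proof.
rewrite /adj trmx_inv map_invmx -/(adj G) adj_gram//.
Qed.

Lemma palm_kernel_conj p q : Kx q p = (Kx p q)^*%C.
Proof.
rewrite !palm_kernelE conjcB -ginibre_conj; congr (_ - _).
transitivity (adj (dd_row x (toC p) *m palm_weight q) ord0 ord0); last by rewrite adjE.
by rewrite adjM /palm_weight adjM adjK adj_gram_inv mulmxA.
Qed.

(** The Taylor coefficients, times the factorials, of [Kx^~ q]. *)
Definition palm_coef q n : R[i] :=
  (toC q)^*%C ^+ n - \sum_(k < l) palm_weight q k ord0 * ncoef x n k.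

Lemma has_palm_sum (f : 'I_l -> R[i]) :
  has_expo_bound (fun n => \sum_(k < l) f k * ncoef x n k).
Proof.
apply: has_expo_bound_sum => k _; apply: has_expo_boundM.
  exact: has_expo_bound_cst.
exact: ncoef_expo.
Qed.

Lemma palm_coefE q n : palm_coef q n =
  (toC q)^*%C ^+ n + \sum_(k < l) (- palm_weight q k ord0) * ncoef x n k.
Proof. by rewrite /palm_coef -sumrN; under eq_bigr do rewrite -mulNr. Qed.

Lemma has_palm_coef q : has_expo_bound (palm_coef q).
Proof.
rewrite (funext (palm_coefE q)); apply: has_expo_boundD.
  exact: has_expo_boundX.
exact: has_palm_sum.
Qed.

Lemma ginibre_fock p q : ginibre_kernel p q = fock (fun n => (toC q)^*%C ^+ n) (toC p).
Proof.
rewrite /ginibre_kernel cexpE /fock; congr fact_series; apply/funext => n.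
by rewrite exprMn mulrC.
Qed.

Lemma palm_kernel_fock p q : Kx p q = fock (palm_coef q) (toC p).
Proof.
rewrite palm_kernelE ginibre_fock /fock; apply/esym.
under eq_fun do rewrite palm_coefE mulrDl.
rewrite fact_seriesD; last 2 first.
- by apply: has_fock; exact: has_expo_boundX.
- by apply: has_fock; exact: has_palm_sum.
congr (_ + _); under eq_fun do rewrite mulr_suml.
apply/esym; transitivity (\sum_(k < l) (- palm_weight q k ord0) * dd_exp x k (toC p)).
  rewrite mxE -sumrN; apply: eq_bigr => k _.
  by rewrite dd_rowE mulrC mulNr.
rewrite -fact_series_lin; last by move=> k; exact: has_dd.
by congr fact_series; apply/funext => n; apply: eq_bigr => k _; rewrite mulrA.
Qed.

Lemma palm_coef_orthogonal q (k : 'I_l) :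
  fact_series (fun n => palm_coef q n * (ncoef x n k)^*%C) = 0.
Proof.
have hc : has_expo_bound (fun n => (ncoef x n k)^*%C).
  by apply: has_expo_bound_conj; exact: ncoef_expo.
under eq_fun do rewrite palm_coefE mulrDl.
rewrite fact_seriesD; last 2 first.
- by apply: has_expo_boundM => //; exact: has_expo_boundX.
- by apply: has_expo_boundM => //; exact: has_palm_sum.
have -> : fact_series (fun n => (toC q)^*%C ^+ n * (ncoef x n k)^*%C) =
    adj (dd_row x (toC q)) k ord0.
  rewrite adjE dd_rowE -fact_series_conj; last exact: has_dd.
  by congr fact_series; apply/funext => n; rewrite conjcM conjcX mulrC.
rewrite (_ : fact_series _ = - (G *m palm_weight q) k ord0); last first.
  under eq_fun do rewrite mulr_suml.
  transitivity (\sum_(j < l) (- palm_weight q j ord0) *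
      fact_series (fun n => (ncoef x n k)^*%C * ncoef x n j)).
    rewrite -fact_series_lin; last by move=> j; exact: has_gram.
    by congr fact_series; apply/funext => n; apply: eq_bigr => j _; ring.
  rewrite mxE -sumrN; apply: eq_bigr => j _.
  by rewrite /G [gram _ _ _]mxE mulNr mulrC.
by rewrite /palm_weight mulKVmx ?gram_unit// subrr.
Qed.

(** [Kx^~ q] is orthogonal to the span of the divided differences, whence the
    reproducing property [`|Kx^~ q|^2 = Kx q q]. *)
Lemma palm_coef_norm q :
  fact_series (fun n => palm_coef q n * (palm_coef q n)^*%C) = Kx q q.
Proof.
have hq := has_palm_coef q.
transitivity (fact_series (fun n => palm_coef q n * (toC q) ^+ n +
    \sum_(k < l) (- palm_weight q k ord0)^*%C *
       (palm_coef q n * (ncoef x n k)^*%C))).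
  congr fact_series; apply/funext => n.
  rewrite {2}palm_coefE conjcD conjcX conjcK mulrDr; congr (_ + _).
  rewrite conjc_sum mulr_sumr; apply: eq_bigr => k _.
  by rewrite conjcM mulrCA.
have hk k : has_expo_bound (fun n => palm_coef q n * (ncoef x n k)^*%C).
  apply: has_expo_boundM => //; apply: has_expo_bound_conj; exact: ncoef_expo.
rewrite fact_seriesD; last 2 first.
- exact: has_fock.
- apply: has_expo_bound_sum => k _; apply: has_expo_boundM => //.
  exact: has_expo_bound_cst.
rewrite fact_series_lin; last by move=> k; exact: hk.
rewrite [X in _ + X]big1 ?addr0; first by rewrite palm_kernel_fock.
by move=> k _; rewrite palm_coef_orthogonal mulr0.
Qed.

(** Coefficients of the basis dual to the divided differences. *)
Definition palm_dual (k : 'I_l) n : R[i] := \sum_(j < l) B j k * ncoef x n j.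

(** What conditioning removes from the kernel is the kernel of the orthogonal
    projection to the span of the [l] divided differences. *)
Lemma palm_defectE p q : ginibre_kernel p q - Kx p q =
  \sum_(k < l) fock (palm_dual k) (toC p) *
     (fock (fun n => ncoef x n k) (toC q))^*%C.
Proof.
rewrite palm_kernelE opprB addrC subrK /palm_weight mulmxA mxE.
apply: eq_bigr => k _; rewrite adjE dd_rowE; congr (_ * _).
rewrite mxE /fock; apply/esym; under eq_fun do rewrite /palm_dual mulr_suml.
apply/esym; transitivity (\sum_(j < l) B j k * dd_exp x j (toC p)).
  by apply: eq_bigr => j _; rewrite dd_rowE mulrC.
rewrite -fact_series_lin; last by move=> j; exact: has_dd.
by congr fact_series; apply/funext => n; apply: eq_bigr => j _; rewrite mulrA.
Qed.

(** The trace of that projection is its rank. *)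
Lemma palm_dual_trace :
  \sum_(k < l) fact_series (fun n => palm_dual k n * (ncoef x n k)^*%C) = l%:R.
Proof.
transitivity (\sum_(k < l) (G *m B) k k); last first.
  rewrite /B mulmxV ?gram_unit//; under eq_bigr do rewrite mxE eqxx.
  by rewrite sumr_const card_ord.
apply: eq_bigr => k _; rewrite mxE.
under eq_fun do rewrite mulr_suml.
transitivity (\sum_(j < l) B j k *
    fact_series (fun n => (ncoef x n k)^*%C * ncoef x n j)).
  rewrite -fact_series_lin; last by move=> j; exact: has_gram.
  by congr fact_series; apply/funext => n; apply: eq_bigr => j _; ring.
by apply: eq_bigr => j _; rewrite /G [gram _ _ _]mxE mulrC.
Qed.

Lemma has_palm_dual k : has_expo_bound (palm_dual k).
Proof. exact: has_palm_sum. Qed.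

Lemma normc_fock D b a z : 0 <= b -> expo_bound D b a ->
  normc (fock a z) <= D * expR (b * normc z).
Proof.
move=> b0 ab; apply: normc_fact_series; first by rewrite mulr_ge0 ?normc_ge0.
by move=> n; rewrite normcM normcX exprMn mulrA ler_wpM2r// exprn_ge0 ?normc_ge0.
Qed.

Lemma palm_defect_bound : exists D b, [/\ 0 <= D, 0 <= b & forall p q,
  normc (ginibre_kernel p q - Kx p q) <=
  D * (expR (b * normc (toC p)) * expR (b * normc (toC q)))].
Proof.
have H (k : 'I_l) : {Db : R * R | [/\ 0 <= Db.1, 0 <= Db.2 & forall p q,
    normc (fock (palm_dual k) (toC p) * (fock (fun n => ncoef x n k) (toC q))^*%C) <=
    Db.1 * (expR (Db.2 * normc (toC p)) * expR (Db.2 * normc (toC q)))]}.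
  apply/cid; have [D [b b0 h]] := has_palm_dual k.
  have [D' [b' b'0 h']] := ncoef_expo x k.
  have D0 := expo_bound_D_ge0 h; have D'0 := expo_bound_D_ge0 h'.
  exists (D * D', b + b'); split => [||p q]; [exact: mulr_ge0|exact: addr_ge0|].
  rewrite -[(_, _).1]/(D * D') -[(_, _).2]/(b + b') normcM normc_conj mulrACA ler_pM ?normc_ge0//.
  - rewrite (le_trans (normc_fock _ b0 h))// ler_wpM2l// ler_expR ler_wpM2r ?normc_ge0//.
    by rewrite lerDl.
  - rewrite (le_trans (normc_fock _ b'0 h'))// ler_wpM2l// ler_expR ler_wpM2r ?normc_ge0//.
    by rewrite lerDr.
exists (\sum_k (sval (H k)).1), (\sum_k (sval (H k)).2).
have s1 k : 0 <= (sval (H k)).1 by case: (svalP (H k)).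
have s2 k : 0 <= (sval (H k)).2 by case: (svalP (H k)).
split; [exact: sumr_ge0|exact: sumr_ge0|move=> p q].
rewrite palm_defectE (le_trans (normc_sum _ _ _))// mulr_suml ler_sum// => k _.
have [_ _ /(_ p q) h] := svalP (H k).
have sk : (sval (H k)).2 <= \sum_k0 (sval (H k0)).2.
  by rewrite [leRHS](bigD1 k)// lerDl; apply: sumr_ge0 => j _; exact: s2.
by rewrite (le_trans h)// ler_wpM2l// ler_pM ?expR_ge0// ler_expR ler_wpM2r ?normc_ge0.
Qed.

End palm_kernel_algebra.

(** * Integration against the Gaussian measure *)

Section real_integrals.
Context d (T : measurableType d) (R : realType).
Variable mu : {measure set T -> \bar R}.

Lemma integral_Rintegral (f : T -> R) : mu.-integrable setT (fun t => (f t)%:E) ->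
  (\int[mu]_t (f t)%:E)%E = (\int[mu]_t f t)%:E.
Proof. by move=> i; rewrite /Rintegral fineK//; exact: integrable_fin_num. Qed.

Lemma dominated_integrable_real (f h : T -> R) : measurable_fun setT f ->
  mu.-integrable setT (fun t => (h t)%:E) -> (forall t, `|f t| <= h t) ->
  mu.-integrable setT (fun t => (f t)%:E).
Proof.
move=> mf ih fh; apply: le_integrable ih => //; first exact/measurable_EFinP.
by move=> t _; rewrite !abse_EFin lee_fin (le_trans (fh t))// ler_norm.
Qed.

Lemma dominated_cvg_Rintegral (f_ : nat -> T -> R) (f h : T -> R) :
  (forall n, measurable_fun setT (f_ n)) -> measurable_fun setT f ->
  mu.-integrable setT (fun t => (h t)%:E) ->
  (forall n t, `|f_ n t| <= h t) -> (forall t, f_ n t @[n --> \oo] --> f t) ->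
  \int[mu]_t f_ n t @[n --> \oo] --> \int[mu]_t f t.
Proof.
move=> mf_ mf ih fh ff.
have H1 n : measurable_fun setT (EFin \o f_ n) by exact/measurable_EFinP.
have H2 : measurable_fun setT (EFin \o f) by exact/measurable_EFinP.
have H3 : {ae mu, forall t, setT t -> (EFin \o f_ n) t @[n --> \oo] --> (EFin \o f) t}.
  by apply: aeW => t _; apply: cvg_EFin; [exact: nearW|exact: ff].
have H4 : {ae mu, forall t n, setT t -> (`|(EFin \o f_ n) t| <= (h t)%:E)%E}.
  by apply: aeW => t n _; rewrite abse_EFin lee_fin.
have [i _ c] := dominated_convergence measurableT H1 H2 H3 ih H4.
rewrite /Rintegral; apply: fine_cvg.
by move: c; rewrite fineK//; exact: integrable_fin_num.
Qed.

End real_integrals.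

(** Integration against a measure given by a density. The measurable structure
    that a product of two copies of [R] receives depends on the structure of the
    copies, and the two planes involved below differ in this respect; this is
    why the two measures live on types [T1] and [T2] related by [phi]. *)
Section density.
Context d1 d2 (T1 : measurableType d1) (T2 : measurableType d2) (R : realType).
Variables (mu : {measure set T1 -> \bar R}) (nu : {measure set T2 -> \bar R}).
Variables (phi : T1 -> T2) (rho : T1 -> R).
Hypothesis mphi : measurable_fun setT phi.
Hypothesis rho0 : forall t, 0 <= rho t.
Hypothesis mrho : measurable_fun setT rho.
Hypothesis nuE : forall A, measurable A ->
  nu A = (\int[mu]_(t in phi @^-1` A) (rho t)%:E)%E.

Import HBNNSimple.

Lemma nnsfun_integral_density (h : {nnsfun T2 >-> R}) :
  (\int[nu]_t (h t)%:E = \int[mu]_t (h (phi t) * rho t)%:E)%E.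
Proof.
rewrite integralT_nnsfun sintegralE.
under [RHS]eq_integral => t _ do rewrite (fimfunE h) EFinM -fsumEFin//.
have hr r t : (0 <= (r * \1_(h @^-1` [set r]) t)%:E :> \bar R)%E.
  by rewrite lee_fin; exact: nnfun_muleindic_ge0.
under eq_integral => t _ do rewrite ge0_mule_fsuml//.
rewrite ge0_integral_fsum//; last 2 first.
- move=> r; apply: emeasurable_funM; last exact/measurable_EFinP.
  apply/measurable_EFinP; apply: measurable_funM => //.
  by apply: measurableT_comp => //; exact: measurable_indic.
- by move=> r t _; rewrite mule_ge0// lee_fin.
apply: eq_fsbigr => r; rewrite inE => -[t0 _ hr0].
have r0 : 0 <= r by rewrite -hr0.
have mA : measurable (h @^-1` [set r]) by [].
rewrite nuE// integral_mkcond -ge0_integralZl//; last 2 first.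
- apply/(measurable_restrictT _ _).1; last exact/measurable_EFinP/measurable_funTS.
  by rewrite -[X in measurable X]setTI; exact: mphi.
- by move=> t _; rewrite patchE; case: ifPn => _//; rewrite lee_fin.
apply: eq_integral => t _.
rewrite epatch_indic/= EFinM -muleA; congr (_ * _)%E.
by rewrite muleC.
Qed.

Lemma ge0_integral_density (f : T2 -> \bar R) : measurable_fun setT f ->
  (forall t, 0 <= f t)%E ->
  (\int[nu]_t f t = \int[mu]_t (f (phi t) * (rho t)%:E))%E.
Proof.
move=> mf f0; pose h := nnsfun_approx measurableT mf.
have hf t : (EFin \o h n) t @[n --> \oo] --> f t.
  by apply: cvg_nnsfun_approx => // x _; exact: f0.
have hnd t a b : (a <= b)%N -> h a t <= h b t.
  by move=> ab; exact/lefP/nd_nnsfun_approx.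
have -> : (\int[nu]_t f t = limn (fun n => \int[nu]_t (h n t)%:E))%E.
  under eq_integral => t _ do rewrite -(cvg_lim _ (hf t))//.
  apply: monotone_convergence => //.
  - by move=> n; exact/measurable_EFinP.
  - by move=> n t _; rewrite lee_fin.
  - by move=> t _ a b ab; rewrite lee_fin hnd.
have -> : (\int[mu]_t (f (phi t) * (rho t)%:E) =
    limn (fun n => \int[mu]_t (h n (phi t) * rho t)%:E))%E.
  have hf' t : (h n (phi t) * rho t)%:E @[n --> \oo] --> (f (phi t) * (rho t)%:E)%E.
    by under eq_fun do rewrite EFinM; apply: cvgeZr => //; exact: hf.
  under eq_integral => t _ do rewrite -(cvg_lim _ (hf' t))//.
  apply: monotone_convergence => //.
  - move=> n; apply/measurable_EFinP; apply: measurable_funM => //.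
    exact: measurableT_comp.
  - by move=> n t _; rewrite lee_fin mulr_ge0.
  - by move=> t _ a b ab; rewrite lee_fin ler_wpM2r// hnd.
by under eq_fun do rewrite nnsfun_integral_density.
Qed.

Lemma integral_density (f : T2 -> R) : measurable_fun setT f ->
  (\int[nu]_t (f t)%:E = \int[mu]_t (f (phi t) * rho t)%:E)%E.
Proof.
move=> mf; rewrite integralE [RHS]integralE.
have mf' : measurable_fun setT (EFin \o f) by exact/measurable_EFinP.
rewrite ge0_integral_density; last 2 first.
- exact: measurable_funepos.
- by move=> t; exact: funepos_ge0.
rewrite ge0_integral_density; last 2 first.
- exact: measurable_funeneg.
- by move=> t; exact: funeneg_ge0.
congr (_ - _)%E; apply: eq_integral => t _.
- rewrite !funeposE -!EFin_max -EFinM; congr EFin.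
  by rewrite maxr_pMl// mul0r.
- rewrite !funenegE -!EFinN -!EFin_max -EFinM; congr EFin.
  by rewrite maxr_pMl// mul0r mulNr.
Qed.

Lemma integrable_density (f : T2 -> R) : measurable_fun setT f ->
  mu.-integrable setT (fun t => (f (phi t) * rho t)%:E) ->
  nu.-integrable setT (fun t => (f t)%:E).
Proof.
move=> mf /integrableP[_ i]; apply/integrableP; split.
  exact/measurable_EFinP.
under eq_integral => t _ do rewrite abse_EFin.
rewrite integral_density; last exact: measurableT_comp.
apply: le_lt_trans i; rewrite le_eqVlt; apply/orP; left; apply/eqP.
by apply: eq_integral => t _; rewrite abse_EFin normrM (ger0_norm (rho0 t)).
Qed.

End density.

Section gaussian_plane.
Variable R : realType.
(* The carrier of Lebesgue measure; [toplane] crosses over to the other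
   measurable structure that [R * R] has. *)
Local Notation M := (measurableTypeR R).
Local Notation lambda := (@lebesgue_measure R).
Local Notation g := (@gaussian R).
Local Notation rho := (@gaussian_density R).

Definition toplane (z : M * M) : plane R := z.

Lemma measurable_toplane : measurable_fun setT toplane.
Proof. by move=> mD A mA; rewrite setTI; exact: mA. Qed.

Lemma modulus_ge0 (z : plane R) : 0 <= modulus z.
Proof. exact: sqrtr_ge0. Qed.

Lemma modulus_sqr (z : plane R) : modulus z ^+ 2 = z.1 ^+ 2 + z.2 ^+ 2.
Proof. by rewrite sqr_sqrtr// addr_ge0 ?sqr_ge0. Qed.

Lemma modulusE (z : plane R) : modulus z = normc (toC z).
Proof. by []. Qed.

Lemma measurable_modulus : measurable_fun setT (@modulus R).
Proof.
apply: measurableT_comp.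
  by apply: continuous_measurable_fun; exact: sqrt_continuous.
by apply: measurable_funD; apply: measurable_funX; [exact: measurable_fst|exact: measurable_snd].
Qed.

Lemma gaussian_densityE s t : rho (s, t) =
  (Num.sqrt pi)^-1 * gauss_fun s * ((Num.sqrt pi)^-1 * gauss_fun t).
Proof.
rewrite /gaussian_density modulus_sqr/= opprD expRD /gauss_fun.
by rewrite mulrACA -invfM -expr2 sqr_sqrtr ?pi_ge0.
Qed.

Lemma integral_gauss1 : (\int[lambda]_s ((Num.sqrt pi)^-1 * gauss_fun s)%:E = 1)%E.
Proof.
have p0 : 0 < Num.sqrt pi :> R by rewrite sqrtr_gt0 pi_gt0.
under eq_integral => s _ do rewrite EFinM.
rewrite ge0_integralZl//.
- by rewrite integralT_gauss -EFinM mulVf// gt_eqF.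
- by apply/measurable_EFinP; exact: measurable_gauss_fun.
- by move=> s _; rewrite lee_fin gauss_fun_ge0.
Qed.

Lemma ge0_integral_product (u v : M -> R) :
  measurable_fun setT u -> measurable_fun setT v ->
  (forall s, 0 <= u s) -> (forall s, 0 <= v s) ->
  (\int[lambda \x lambda]_z (u z.1 * v z.2)%:E =
   (\int[lambda]_s (u s)%:E) * \int[lambda]_s (v s)%:E)%E.
Proof.
move=> mu mv u0 v0; rewrite (@fubini_tonelli1 _ _ M M R lambda lambda (fun z : M * M => (u z.1 * v z.2)%:E))//; last 2 first.
- apply/measurable_EFinP; apply: measurable_funM.
    by apply: measurableT_comp => //; exact: measurable_fst.
  by apply: measurableT_comp => //; exact: measurable_snd.
- by move=> z; rewrite lee_fin mulr_ge0.
transitivity (\int[lambda]_s ((u s)%:E * \int[lambda]_t (v t)%:E))%E.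
  apply: eq_integral => s _; rewrite /fubini_F/=.
  under eq_integral => t _ do rewrite EFinM.
  rewrite ge0_integralZl//.
  - exact/measurable_EFinP.
  - by move=> t _; rewrite lee_fin.
  - by rewrite lee_fin.
rewrite ge0_integralZr//.
- exact/measurable_EFinP.
- by move=> t _; rewrite lee_fin.
- by apply: integral_ge0 => t _; rewrite lee_fin.
Qed.

Lemma gaussian_setT : g setT = 1%E.
Proof.
transitivity (\int[lambda \x lambda]_z
  ((Num.sqrt pi)^-1 * gauss_fun z.1 * ((Num.sqrt pi)^-1 * gauss_fun z.2))%:E)%E.
  by apply: eq_integral => -[s t] _; rewrite gaussian_densityE.
have mu : measurable_fun setT (fun s : M => (Num.sqrt pi)^-1 * gauss_fun s).
  by apply: measurable_funM => //; exact: measurable_gauss_fun.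
have u0 (s : R) : 0 <= (Num.sqrt pi)^-1 * gauss_fun s.
  by rewrite mulr_ge0 ?invr_ge0 ?sqrtr_ge0 ?gauss_fun_ge0.
by rewrite (ge0_integral_product mu mu u0 u0) integral_gauss1 mule1.
Qed.

HB.instance Definition _ :=
  @Measure_isProbability.Build _ _ R g gaussian_setT.

Lemma integral_gaussian (f : plane R -> R) : measurable_fun setT f ->
  (\int[g]_z (f z)%:E = \int[lambda \x lambda]_z (f z * rho z)%:E)%E.
Proof.
move=> mf; apply: (integral_density (phi := toplane) (rho := rho)) => //.
- exact: measurable_toplane.
- exact: gaussian_density_ge0.
- exact: measurable_gaussian_density.
Qed.

Lemma integrable_expR_gauss_density b :
  (lambda \x lambda)%E.-integrable setT
    (fun z => (expR (b * modulus z) * rho z)%:E).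
Proof.
have mu : measurable_fun setT (@normal_pdf R 0 1) by exact: measurable_normal_pdf.
(* [b * e <= b ^+ 2 / 2 + e ^+ 2 / 2] leaves half of the Gaussian exponent. *)
pose C : R := expR (b ^+ 2 / 2) * 2.
have iC : (lambda \x lambda)%E.-integrable setT
    (fun z => (C * (normal_pdf 0 1 z.1 * normal_pdf 0 1 z.2))%:E).
  have mC : measurable_fun setT (fun z : plane R =>
      C * (normal_pdf 0 1 z.1 * normal_pdf 0 1 z.2)).
    apply: measurable_funM => //; apply: measurable_funM.
      by apply: measurableT_comp => //; exact: measurable_fst.
    by apply: measurableT_comp => //; exact: measurable_snd.
  have C0 : 0 <= C by rewrite mulr_ge0 ?expR_ge0.
  apply/integrableP; split; first exact/measurable_EFinP.
  under eq_integral => z _ do rewrite gee0_abs ?lee_fin ?mulr_ge0 ?normal_pdf_ge0// EFinM.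
  rewrite ge0_integralZl//.
  - by rewrite ge0_integral_product// ?integral_normal_pdf ?mule1 ?ltry//; exact: normal_pdf_ge0.
  - apply/measurable_EFinP; apply: measurable_funM.
      by apply: measurableT_comp => //; exact: measurable_fst.
    by apply: measurableT_comp => //; exact: measurable_snd.
  - by move=> z _; rewrite lee_fin mulr_ge0 ?normal_pdf_ge0.
apply: le_integrable iC => //.
  apply/measurable_EFinP; apply: measurable_funM.
    by apply: measurableT_comp => //; apply: measurable_funM => //; exact: measurable_modulus.
  exact: measurable_gaussian_density.
move=> [s t] _; rewrite !abse_EFin lee_fin.
rewrite ger0_norm; last by apply: mulr_ge0; [exact: expR_ge0|exact: gaussian_density_ge0].
rewrite ger0_norm; last first.
  apply: mulr_ge0; first by apply: mulr_ge0 => //; exact: expR_ge0.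
  by apply: mulr_ge0; exact: normal_pdf_ge0.
have n1 : (1 : R) != 0 by exact: oner_neq0.
rewrite /= !normal_pdfE// /normal_peak /normal_fun !subr0 !expr1n !mul1r.
set e := modulus (s, t); have e2 : e ^+ 2 = s ^+ 2 + t ^+ 2 by rewrite modulus_sqr.
set P := (Num.sqrt (pi *+ 2))^-1.
have PP : P * P = (pi *+ 2)^-1.
  by rewrite /P -invfM -expr2 sqr_sqrtr// mulrn_wge0// pi_ge0.
have -> : C * (P * expR (- s ^+ 2 / 2) * (P * expR (- t ^+ 2 / 2))) =
    C * (P * P) * (expR (- s ^+ 2 / 2) * expR (- t ^+ 2 / 2)) by ring.
have -> : C * (P * P) = pi^-1 * expR (b ^+ 2 / 2).
  have p0 : (pi : R) != 0 by rewrite gt_eqF// pi_gt0.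
  by rewrite PP /C -[pi *+ 2]mulr_natl invfM -mulrA [2 * _]mulrA divff// mul1r mulrC.
rewrite /gaussian_density -/e mulrCA -mulrA -!expRD.
rewrite ler_wpM2l ?invr_ge0 ?pi_ge0// ler_expR -mulrDl -opprD -e2.
have := sqr_ge0 (b - e); rewrite sqrrB; lra.
Qed.

Lemma measurable_expR_modulus b :
  measurable_fun setT (fun z : plane R => expR (b * modulus z)).
Proof.
apply: measurableT_comp => //; apply: measurable_funM => //.
exact: measurable_modulus.
Qed.

Lemma integrable_expR_modulus D b :
  g.-integrable setT (fun z => (D * expR (b * modulus z))%:E).
Proof.
under eq_fun do rewrite EFinM.
apply: integrableZl => //; apply: (integrable_density (phi := toplane) (rho := rho) (mu := (lambda \x lambda)%E)).
- exact: measurable_toplane.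
- exact: gaussian_density_ge0.
- exact: measurable_gaussian_density.
- by [].
- exact: measurable_expR_modulus.
- exact: integrable_expR_gauss_density.
Qed.

Lemma expo_integrable D b (f : plane R -> R) : measurable_fun setT f ->
  (forall z, `|f z| <= D * expR (b * modulus z)) ->
  g.-integrable setT (fun z => (f z)%:E).
Proof.
move=> mf fD; apply: le_integrable (integrable_expR_modulus D b) => //.
  exact/measurable_EFinP.
move=> z _; rewrite !abse_EFin lee_fin (le_trans (fD z))//.
exact: ler_norm.
Qed.

End gaussian_plane.

(** * Gaussian integration by parts on the line *)

Section gaussian_integration_by_parts.
Variable R : realType.
Local Notation M := (measurableTypeR R).
Local Notation lambda := (@lebesgue_measure R).
Local Notation g := (@gaussian R).
Local Notation rho := (@gaussian_density R).

Lemma normX_le_expR (s : R) k : `|s| ^+ k <= k`!%:R * expR `|s|.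
Proof.
case: k => [|k]; first by rewrite expr0 mul1r -[leLHS]expR0 ler_expR.
have := expR_ge1Dxn k (normr_ge0 s).
have f0 : 0 < k.+1`!%:R :> R by rewrite ltr0n fact_gt0.
move=> h; rewrite mulrC -ler_pdivrMr//; apply: le_trans h.
by rewrite lerDr ler01.
Qed.

Lemma poly_le_expR (q : {poly R}) :
  exists2 D, 0 <= D & forall s, `|q.[s]| <= D * expR `|s|.
Proof.
exists (\sum_(i < size q) `|q`_i| * i`!%:R).
  by apply: sumr_ge0 => i _; rewrite mulr_ge0.
move=> s; rewrite horner_coef (le_trans (ler_norm_sum _ _ _))// mulr_suml.
apply: ler_sum => i _; rewrite normrM normrX -mulrA ler_wpM2l//.
exact: normX_le_expR.
Qed.

Lemma measurable_horner (q : {poly R}) : measurable_fun setT (fun s : M => q.[s]).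
Proof. by apply: continuous_measurable_fun; exact: continuous_horner. Qed.

Lemma measurable_horner_gauss (q : {poly R}) :
  measurable_fun setT (fun s : M => q.[s] * gauss_fun s).
Proof.
by apply: measurable_funM; [exact: measurable_horner|exact: measurable_gauss_fun].
Qed.

Lemma integrable_horner_gauss (q : {poly R}) :
  lambda.-integrable setT (fun s : M => (q.[s] * gauss_fun s)%:E).
Proof.
have [D D0 qD] := poly_le_expR q.
have := integrableZl measurableT (D * expR 2^-1 * (Num.sqrt (pi *+ 2))) (integrable_normal_pdf 0 1).
apply: le_integrable => //.
  by apply/measurable_EFinP; exact: measurable_horner_gauss.
move=> s _; rewrite -EFinM !abse_EFin lee_fin [leRHS]ger0_norm; last first.
  by rewrite !mulr_ge0 ?expR_ge0 ?sqrtr_ge0// normal_pdf_ge0.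
rewrite normrM [`|gauss_fun _|]ger0_norm ?gauss_fun_ge0//.
rewrite normal_pdfE ?oner_neq0// /normal_peak /normal_fun subr0 expr1n mul1r.
rewrite mulrA mulfK; last by rewrite gt_eqF// sqrtr_gt0 mulrn_wgt0// pi_gt0.
rewrite (le_trans (ler_wpM2r (gauss_fun_ge0 s) (qD s)))// -!mulrA ler_wpM2l//.
rewrite /gauss_fun -!expRD ler_expR.
have := sqr_ge0 (`|s| - 1); rewrite sqrrB real_normK ?num_real//; lra.
Qed.

Lemma cvg_expR_tail (D : R) : D * expR (1 - n%:R) @[n --> \oo] --> (0 : R).
Proof.
rewrite -(mulr0 D); apply: cvgMr.
have -> : (fun n : nat => expR (1 - n%:R)) = geometric (expR 1) (expR (- 1) : R).
  by apply/funext => n; rewrite /geometric/= expRD -expRM_natr mulN1r.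
by apply: cvg_geometric; rewrite ger0_norm ?expR_ge0// expR_lt1 ltrN10.
Qed.

(** The integrand is the derivative of [q.[s] * gauss_fun s], which vanishes at
    infinity. *)
Lemma gauss_ibp (q : {poly R}) :
  (\int[lambda]_s ((q^`() - 2%:P * 'X * q).[s] * gauss_fun s)%:E = 0)%E.
Proof.
set p := q^`() - 2%:P * 'X * q.
pose f (s : R) := p.[s] * gauss_fun s; pose F (s : R) := q.[s] * gauss_fun s.
have dF s : is_derive s (1 : R) F (f s).
  have dg : is_derive s (1 : R) (@gauss_fun R) (- (2 * s) * gauss_fun s).
    rewrite /gauss_fun; apply: trigger_derive; rewrite /= !scaler1 /GRing.scale/=.
    by ring.
  apply: trigger_derive; rewrite /GRing.scale/= /f /p hornerD hornerN !hornerM hornerC hornerX. by ring.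
have cf : continuous f.
  by move=> s; apply: cvgM; [exact: continuous_horner|exact: continuous_gauss_fun].
have cF : continuous F.
  by move=> s; apply: cvgM; [exact: continuous_horner|exact: continuous_gauss_fun].
have ftc n : (\int[lambda]_(s in `[(- n.+1%:R)%R, n.+1%:R]) (f s)%:E =
    (F n.+1%:R)%:E - (F (- n.+1%:R))%:E)%E.
  apply: continuous_FTC2.
  - by rewrite -subr_gt0 opprK addr_gt0.
  - exact: continuous_subspaceT.
  - split.
    + by move=> s _; have [] := dF s.
    + by apply: cvg_at_right_filter; exact: cF.
    + by apply: cvg_at_left_filter; exact: cF.
  - by move=> s _; rewrite derive1E; have [_ ->] := dF s.
have [D D0 qD] := poly_le_expR q.
have FD (s : R) n : `|s| = n.+1%:R -> `|F s| <= D * expR (1 - n.+1%:R).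
  move=> sn; rewrite /F normrM [`|gauss_fun _|]ger0_norm ?gauss_fun_ge0//.
  rewrite (le_trans (ler_wpM2r (gauss_fun_ge0 s) (qD s)))// -!mulrA ler_wpM2l//.
  rewrite /gauss_fun -!expRD ler_expR -(real_normK (num_real s)) sn.
  have := sqr_ge0 ((n.+1%:R : R) - 1); rewrite sqrrB; lra.
have tail := cvg_expR_tail D; rewrite -(cvg_shiftS (fun n => D * expR (1 - n%:R))) in tail.
have F0 (e : nat -> R) : (forall n, `|e n| = n.+1%:R) -> F (e n) @[n --> \oo] --> (0 : R).
  move=> en; apply/norm_cvg0P; apply: (squeeze_cvgr _ (cvg_cst 0) tail).
  by near=> n; rewrite normr_ge0/=; exact: FD.
have lim0 : F n.+1%:R - F (- n.+1%:R) @[n --> \oo] --> (0 : R).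
  rewrite -(subr0 (0 : R)); apply: cvgB; apply: F0 => n.
    by rewrite ger0_norm.
  by rewrite normrN ger0_norm.
have intf := integrable_horner_gauss p.
have limf : \int[lambda]_s ((f \_ `[(- n.+1%:R)%R, n.+1%:R]) s)
    @[n --> \oo] --> \int[lambda]_s f s.
  apply: (@dominated_cvg_Rintegral _ M R lambda _ _ (fun s => `|f s|)).
  - move=> n; apply/(measurable_restrictT _ _).1 => //.
    by apply: measurable_funTS; exact: measurable_horner_gauss.
  - exact: measurable_horner_gauss.
  - exact: integrable_abse intf.
  - by move=> n s; rewrite patchE; case: ifPn => // _; rewrite normr0.
  - move=> s; apply: cvg_near_cst; near=> n.
    rewrite patchE mem_set//= in_itv/= -ler_norml.
    near: n; exists (Num.trunc `|s|).+1 => // n /= sn.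
    by rewrite (le_trans (ltW (truncnS_gt _)))// ler_nat ltnW.
rewrite integral_Rintegral//; congr EFin.
apply/esym/(cvg_unique _ _ limf) => //.
apply: cvg_trans lim0; apply: near_eq_cvg; near=> n.
by rewrite -Rintegral_mkcond /Rintegral ftc.
Unshelve. all: by end_near. Qed.

End gaussian_integration_by_parts.

(** * Isometry between entire functions and their coefficients *)

Lemma deriv_affineX_horner (K : comNzRingType) (c a b u v x : K) n m :
  (c%:P * ((a%:P * 'X + u%:P) ^+ n * (b%:P * 'X + v%:P) ^+ m))^`().[x] =
  c * (a * ((a * x + u) ^+ n.-1 * (b * x + v) ^+ m *+ n) +
       b * ((a * x + u) ^+ n * (b * x + v) ^+ m.-1 *+ m)).
Proof.
rewrite derivM derivC mul0r add0r derivM !deriv_exp !derivD !derivM !derivC derivX.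
rewrite !mul0r !add0r !mulr1 !addr0 !hornerM hornerD !hornerM !hornerMn !hornerM.
rewrite !hornerC !horner_exp !hornerD !hornerM !hornerC !hornerX.
congr (c * (_ + _)); first by rewrite mulrnAl mulrnAr mulrA.
by rewrite !mulrnAr mulrCA.
Qed.

Section measurable_complex.
Context d (T : measurableType d) (R : realType).
Implicit Types f h : T -> R[i].

Definition measurable_complex f :=
  measurable_fun setT (fun z => complex.Re (f z)) /\
  measurable_fun setT (fun z => complex.Im (f z)).

Lemma measurable_complexD f h : measurable_complex f -> measurable_complex h ->
  measurable_complex (fun z => f z + h z).
Proof.
move=> [fr fi] [hr hi]; split.
  by under eq_fun do rewrite ReD; exact: measurable_funD.
by under eq_fun do rewrite ImD; exact: measurable_funD.
Qed.

Lemma measurable_complexM f h : measurable_complex f -> measurable_complex h ->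
  measurable_complex (fun z => f z * h z).
Proof.
move=> [fr fi] [hr hi]; split.
  under eq_fun do rewrite ReM.
  by apply: measurable_funB; exact: measurable_funM.
under eq_fun do rewrite ImM.
by apply: measurable_funD; exact: measurable_funM.
Qed.

Lemma measurable_complex_sum (I : Type) (r : seq I) (f : I -> T -> R[i]) :
  (forall i, measurable_complex (f i)) ->
  measurable_complex (fun z => \sum_(i <- r) f i z).
Proof.
move=> mf; elim: r => [|i r ih].
  by under eq_fun do rewrite big_nil; split; exact: measurable_cst.
by under eq_fun do rewrite big_cons; exact: measurable_complexD.
Qed.

Lemma measurable_complex_conj f : measurable_complex f ->
  measurable_complex (fun z => (f z)^*%C).
Proof.
move=> [fr fi]; split; first by under eq_fun do rewrite ReJ.
by under eq_fun do rewrite ImJ; exact: measurableT_comp.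
Qed.

Lemma measurable_complexN f : measurable_complex f ->
  measurable_complex (fun z => - f z).
Proof.
move=> [fr fi]; split.
  by under eq_fun do rewrite ReN; exact: measurableT_comp.
by under eq_fun do rewrite ImN; exact: measurableT_comp.
Qed.

Lemma measurable_cexp f : measurable_complex f ->
  measurable_complex (fun z => cexp (f z)).
Proof.
move=> [fr fi]; split; apply: measurable_funM.
- exact: measurableT_comp.
- apply: measurableT_comp => //.
  by apply: continuous_measurable_fun; exact: continuous_cos.
- exact: measurableT_comp.
- apply: measurableT_comp => //.
  by apply: continuous_measurable_fun; exact: continuous_sin.
Qed.

Lemma measurable_normc_sqr f : measurable_complex f ->
  measurable_fun setT (fun z => normc (f z) ^+ 2).
Proof.
move=> [fr fi]; under eq_fun do rewrite normc_sqr.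
by apply: measurable_funD; apply: measurable_funX.
Qed.

End measurable_complex.

Lemma measurable_complex_comp d1 d2 (T1 : measurableType d1)
    (T2 : measurableType d2) (R : realType) (f : T2 -> R[i]) (h : T1 -> T2) :
  measurable_fun setT h -> measurable_complex f ->
  measurable_complex (fun t => f (h t)).
Proof.
move=> mh [fr fi]; split.
  exact: (measurableT_comp fr mh).
exact: (measurableT_comp fi mh).
Qed.

Section complex_gaussian_integrals.
Variable R : realType.
Local Notation M := (measurableTypeR R).
Local Notation lambda := (@lebesgue_measure R).
Local Notation g := (@gaussian R).
Local Notation rho := (@gaussian_density R).
Implicit Types (f h : plane R -> R[i]) (c : R[i]).

Definition expo_growth f :=
  exists D b, [/\ 0 <= D, 0 <= b & forall z, normc (f z) <= D * expR (b * modulus z)].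

(** An algebra of functions integrable for [g], which contains the entire
    functions of exponential growth and their conjugates. *)
Definition tame f := measurable_complex f /\ expo_growth f.

Lemma tameD f h : tame f -> tame h -> tame (fun z => f z + h z).
Proof.
move=> [mf [D [b [D0 b0 fD]]]] [mh [D' [b' [D'0 b'0 hD]]]].
split; first exact: measurable_complexD.
exists (D + D'), (b + b'); split; [exact: addr_ge0|exact: addr_ge0|move=> z].
rewrite (le_trans (le_normcD _ _))// mulrDl lerD//.
  by rewrite (le_trans (fD z))// ler_wpM2l// ler_expR ler_wpM2r ?modulus_ge0// lerDl.
by rewrite (le_trans (hD z))// ler_wpM2l// ler_expR ler_wpM2r ?modulus_ge0// lerDr.
Qed.

Lemma tameM f h : tame f -> tame h -> tame (fun z => f z * h z).
Proof.
move=> [mf [D [b [D0 b0 fD]]]] [mh [D' [b' [D'0 b'0 hD]]]].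
split; first exact: measurable_complexM.
exists (D * D'), (b + b'); split; [exact: mulr_ge0|exact: addr_ge0|move=> z].
by rewrite normcM mulrDl expRD mulrACA ler_pM ?normc_ge0.
Qed.

Lemma tame_cst c : tame (fun=> c).
Proof.
split; first by split; exact: measurable_cst.
exists (normc c), 0; split; [exact: normc_ge0|by []|move=> z].
by rewrite mul0r expR0 mulr1.
Qed.

Lemma tame_conj f : tame f -> tame (fun z => (f z)^*%C).
Proof.
move=> [mf [D [b [D0 b0 fD]]]]; split; first exact: measurable_complex_conj.
by exists D, b; split=> // z; rewrite normc_conj.
Qed.

Lemma modulus_le_expR (z : plane R) : modulus z <= expR (modulus z).
Proof. by rewrite (le_trans _ (expR_ge1Dx _))// lerDr. Qed.

Lemma tame_toC : tame (@toC R).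
Proof.
split; first by split; [exact: measurable_fst|exact: measurable_snd].
exists 1, 1; split=> // z; rewrite -modulusE !mul1r; exact: modulus_le_expR.
Qed.

Lemma tame_coord : tame (fun z => (z.1)%:C%C) /\ tame (fun z => (z.2)%:C%C).
Proof.
split; split; try by split => /=; [exact: measurable_fst || exact: measurable_snd|exact: measurable_cst].
- exists 1, 1; split=> // z; rewrite normc_real !mul1r.
  rewrite (le_trans (normc_Re (toC z)))// -modulusE; exact: modulus_le_expR.
- exists 1, 1; split=> // z; rewrite normc_real !mul1r.
  rewrite (le_trans (normc_Im (toC z)))// -modulusE; exact: modulus_le_expR.
Qed.

Lemma tameX f n : tame f -> tame (fun z => f z ^+ n).
Proof.
move=> tf; elim: n => [|n ih].
  by under eq_fun do rewrite expr0; exact: tame_cst.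
by under eq_fun do rewrite exprS; exact: tameM.
Qed.

Lemma tame_sum (I : Type) (r : seq I) (P : pred I) (f : I -> plane R -> R[i]) :
  (forall i, tame (f i)) -> tame (fun z => \sum_(i <- r | P i) f i z).
Proof.
move=> tf; elim: r => [|i r ih].
  by under eq_fun do rewrite big_nil; exact: tame_cst.
have [Pi|nPi] := boolP (P i).
  by under eq_fun do rewrite big_cons Pi; exact: tameD.
by under eq_fun do rewrite big_cons (negbTE nPi).
Qed.

Lemma tame_integrable f : tame f ->
  g.-integrable setT (fun z => (complex.Re (f z))%:E).
Proof.
move=> [[fr _] [D [b [_ _ fD]]]]; apply: (expo_integrable fr) => z.
by rewrite (le_trans (normc_Re _))//; exact: fD.
Qed.

Lemma tame_integral_sum (I : Type) (r : seq I) (f : I -> plane R -> R[i]) :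
  (forall i, tame (f i)) ->
  \int[g]_z complex.Re (\sum_(i <- r) f i z) =
  \sum_(i <- r) \int[g]_z complex.Re (f i z).
Proof.
move=> tf; elim: r => [|i r ih].
  rewrite big_nil; under eq_Rintegral do rewrite big_nil.
  by rewrite /Rintegral integral0.
rewrite big_cons -ih -RintegralD//; last 2 first.
- exact: tame_integrable.
- by apply: tame_integrable; exact: tame_sum.
by apply: eq_Rintegral => z _; rewrite big_cons ReD.
Qed.

Lemma ReMn (z : R[i]) n : complex.Re (z *+ n) = complex.Re z *+ n.
Proof. by elim: n => [|n ih]; rewrite ?mulr0n// !mulrS ReD ih. Qed.

Definition Re_poly (q : {poly R[i]}) : {poly R} :=
  \poly_(i < size q) complex.Re q`_i.

Lemma Re_polyE q (s : R) : (Re_poly q).[s] = complex.Re q.[s%:C%C].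
Proof.
rewrite horner_poly horner_coef Re_sum; apply: eq_bigr => i _.
by rewrite -rmorphXn ReM/= mulr0 subr0.
Qed.

Lemma coef_Re_poly q i : (Re_poly q)`_i = complex.Re q`_i.
Proof.
rewrite coef_poly; case: ltnP => // qi.
by rewrite nth_default.
Qed.

Lemma deriv_Re_poly q : (Re_poly q)^`() = Re_poly q^`().
Proof.
apply/polyP => i; rewrite coef_deriv !coef_Re_poly coef_deriv.
by rewrite ReMn.
Qed.

Lemma gauss_ibp_complex (q : {poly R[i]}) :
  (\int[lambda]_s (complex.Re (q^`() - 2%:P * 'X * q).[s%:C%C] * gauss_fun s)%:E = 0)%E.
Proof.
rewrite -(gauss_ibp (Re_poly q)); apply: eq_integral => s _; congr (_ * _)%:E.
rewrite !hornerD !hornerN ReD ReN deriv_Re_poly Re_polyE; congr (_ - _).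
rewrite !hornerM !hornerC !hornerX Re_polyE.
by rewrite ReM natrC -rmorphM/= mul0r subr0.
Qed.

Lemma integrable_gaussian_density f : tame f ->
  (lambda \x lambda)%E.-integrable setT
    (fun z => (complex.Re (f z) * rho z)%:E).
Proof.
move=> [[fr _] [D [b [D0 _ fD]]]].
have := integrableZl measurableT D (integrable_expR_gauss_density b).
apply: le_integrable => //.
  apply/measurable_EFinP; apply: measurable_funM; first exact: fr.
  exact: measurable_gaussian_density.
move=> z _; rewrite -EFinM !abse_EFin lee_fin.
have := fD z; have := normc_Re (f z); have := gaussian_density_ge0 z.
move: (rho z) => r r0 h1 h2.
rewrite [in leLHS]normrM [leRHS]normrM [`|_ * r|]normrM !(ger0_norm r0) (ger0_norm D0).
by rewrite mulrA ler_wpM2r// (le_trans h1)// (le_trans h2)// ler_wpM2l// ler_norm.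
Qed.

Let shuffle (x p a b : R) : x * (p * a * (p * b)) = p * (p * b) * (x * a).
Proof. by ring. Qed.

Let shuffle' (x p a b : R) : x * (p * a * (p * b)) = p * (p * a) * (x * b).
Proof. by ring. Qed.

(** By Fubini, integration by parts holds along each coordinate line. *)
Lemma gaussian_ibp_fst (f : plane R -> R[i]) (q : R -> {poly R[i]}) : tame f ->
  (forall s t, f (s, t) = ((q t)^`() - 2%:P * 'X * q t).[s%:C%C]) ->
  \int[g]_z complex.Re (f z) = 0.
Proof.
move=> tf fq; rewrite /Rintegral integral_gaussian; last by case: tf => -[].
have If := integrable_gaussian_density tf.
rewrite -(integral21_prod_meas1 If) (eq_integral (fun=> 0%E)) ?integral0//.
move=> t _; rewrite /fubini_G/=.
under eq_integral => s _.
  rewrite gaussian_densityE fq.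
  rewrite shuffle EFinM; over.
rewrite integralZl//; first by rewrite gauss_ibp_complex mule0.
under eq_fun do rewrite -Re_polyE.
exact: integrable_horner_gauss.
Qed.

Lemma gaussian_ibp_snd (f : plane R -> R[i]) (q : R -> {poly R[i]}) : tame f ->
  (forall s t, f (s, t) = ((q s)^`() - 2%:P * 'X * q s).[t%:C%C]) ->
  \int[g]_z complex.Re (f z) = 0.
Proof.
move=> tf fq; rewrite /Rintegral integral_gaussian; last by case: tf => -[].
have If := integrable_gaussian_density tf.
rewrite -(integral12_prod_meas1 If) (eq_integral (fun=> 0%E)) ?integral0//.
move=> s _; rewrite /fubini_F/=.
under eq_integral => t _.
  rewrite gaussian_densityE fq.
  rewrite shuffle' EFinM; over.
rewrite integralZl//; first by rewrite gauss_ibp_complex mule0.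
under eq_fun do rewrite -Re_polyE.
exact: integrable_horner_gauss.
Qed.

Definition mono n m (z : plane R) : R[i] := toC z ^+ n * (toC z)^*%C ^+ m.

Lemma tame_mono n m : tame (mono n m).
Proof.
apply: tameM; first by apply: tameX; exact: tame_toC.
by apply: tameX; apply: tame_conj; exact: tame_toC.
Qed.

(** Wirtinger derivatives of the monomials, with the pole at [n = 0] avoided by
   the factor [n]. *)
Definition dmono n m (z : plane R) := mono n.-1 m z *+ n.
Definition dbar_mono n m (z : plane R) := mono n m.-1 z *+ m.

Lemma tame_dmono n m : tame (dmono n m).
Proof.
have -> : dmono n m = (fun z => n%:R * mono n.-1 m z).
  by apply/funext => z; rewrite mulr_natl.
by apply: tameM; [exact: tame_cst|exact: tame_mono].
Qed.

Lemma tame_dbar_mono n m : tame (dbar_mono n m).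
Proof.
have -> : dbar_mono n m = (fun z => m%:R * mono n m.-1 z).
  by apply/funext => z; rewrite mulr_natl.
by apply: tameM; [exact: tame_cst|exact: tame_mono].
Qed.

Lemma mono_ibp_fst c n m :
  \int[g]_z complex.Re (c * (dmono n m z + dbar_mono n m z)
    - 2 * (z.1)%:C%C * (c * mono n m z)) = 0.
Proof.
pose q t : {poly R[i]} := c%:P * ((1%:P * 'X + (0 +i* t)%C%:P) ^+ n *
  (1%:P * 'X + (0 -i* t)%C%:P) ^+ m).
apply: (@gaussian_ibp_fst _ q).
  have [t1 _] := tame_coord.
  apply: tameD; first apply: tameM.
  - exact: tame_cst.
  - by apply: tameD; [exact: tame_dmono|exact: tame_dbar_mono].
  - under eq_fun do rewrite -mulNr -mulNr.
    apply: tameM; last by apply: tameM; [exact: tame_cst|exact: tame_mono].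
    by apply: tameM; [exact: tame_cst|].
move=> s t.
have e1 : 1 * s%:C%C + (0 +i* t)%C = toC (s, t).
  by apply: complex_ext; rewrite /= ?mul1r ?mul0r ?subr0 ?addr0 ?add0r.
have e2 : 1 * s%:C%C + (0 -i* t)%C = (toC (s, t))^*%C.
  by apply: complex_ext; rewrite /= ?mul1r ?mul0r ?subr0 ?addr0 ?add0r.
rewrite hornerD hornerN deriv_affineX_horner !hornerM !horner_exp !hornerD !hornerM.
by rewrite !hornerC !hornerX e1 e2 !mul1r.
Qed.

Lemma mono_ibp_snd c n m :
  \int[g]_z complex.Re (c * ('i%C * dmono n m z + (- 'i)%C * dbar_mono n m z)
    - 2 * (z.2)%:C%C * (c * mono n m z)) = 0.
Proof.
pose q s : {poly R[i]} := c%:P * (('i%C%:P * 'X + (s%:C)%C%:P) ^+ n *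
  ((- 'i)%C%:P * 'X + (s%:C)%C%:P) ^+ m).
apply: (@gaussian_ibp_snd _ q).
  have [_ t1] := tame_coord.
  apply: tameD; first apply: tameM.
  - exact: tame_cst.
  - apply: tameD; (apply: tameM; first exact: tame_cst).
      exact: tame_dmono.
    exact: tame_dbar_mono.
  - under eq_fun do rewrite -mulNr -mulNr.
    apply: tameM; last by apply: tameM; [exact: tame_cst|exact: tame_mono].
    by apply: tameM; [exact: tame_cst|].
move=> s t.
have e1 : 'i%C * t%:C%C + s%:C%C = toC (s, t).
  by apply: complex_ext; rewrite /= ?mul1r ?mul0r ?subr0 ?addr0 ?add0r ?mulr0 ?addr0 ?subr0 ?add0r.
have e2 : (- 'i)%C * t%:C%C + s%:C%C = (toC (s, t))^*%C.
  by apply: complex_ext; rewrite ?ReD ?ImD ?ReM ?ImM ?ReN ?ImN/=; ring.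
rewrite hornerD hornerN deriv_affineX_horner !hornerM !horner_exp !hornerD !hornerM.
by rewrite !hornerC !hornerX e1 e2.
Qed.

(** Integration by parts in the first coordinate plus [i] times integration by
    parts in the second gives [\int z F = \int dF/d(conj z)]. *)
Lemma mono_recursion c n m :
  \int[g]_z complex.Re (c * mono n.+1 m z) =
  \int[g]_z complex.Re (c * dbar_mono n m z).
Proof.
have tc k p : tame (fun z => c * mono k p z).
  by apply: tameM; [exact: tame_cst|exact: tame_mono].
have td : tame (fun z => c * dbar_mono n m z).
  by apply: tameM; [exact: tame_cst|exact: tame_dbar_mono].
have [t1 t2] := tame_coord.
have h1 := mono_ibp_fst c n m; have h2 := mono_ibp_snd (c * 'i%C) n m.
have tA : tame (fun z => c * (dmono n m z + dbar_mono n m z)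
    - 2 * (z.1)%:C%C * (c * mono n m z)).
  apply: tameD; first apply: tameM.
  - exact: tame_cst.
  - by apply: tameD; [exact: tame_dmono|exact: tame_dbar_mono].
  - under eq_fun do rewrite -mulNr -mulNr.
    by apply: tameM => //; apply: tameM => //; exact: tame_cst.
have tB : tame (fun z => c * 'i%C * ('i%C * dmono n m z + (- 'i)%C * dbar_mono n m z)
    - 2 * (z.2)%:C%C * (c * 'i%C * mono n m z)).
  apply: tameD; first apply: tameM.
  - exact: tame_cst.
  - apply: tameD; (apply: tameM; first exact: tame_cst).
      exact: tame_dmono.
    exact: tame_dbar_mono.
  - under eq_fun do rewrite -mulNr -mulNr.
    apply: tameM; last by apply: tameM; [exact: tame_cst|exact: tame_mono].
    by apply: tameM; [exact: tame_cst|].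
have AB z : complex.Re (c * (dmono n m z + dbar_mono n m z) - 2 * (z.1)%:C%C * (c * mono n m z)) +
    complex.Re (c * 'i%C * ('i%C * dmono n m z + (- 'i)%C * dbar_mono n m z)
    - 2 * (z.2)%:C%C * (c * 'i%C * mono n m z)) =
    2 * (complex.Re (c * dbar_mono n m z) - complex.Re (c * mono n.+1 m z)).
  have -> : mono n.+1 m z = ((z.1)%:C%C + 'i%C * (z.2)%:C%C) * mono n m z.
    rewrite /mono exprS -mulrA; congr (_ * _).
    by apply: complex_ext; rewrite /= ?mul1r ?mul0r ?subr0 ?addr0 ?add0r.
  move: (dmono n m z) (dbar_mono n m z) (mono n m z) => [a1 a2] [b1 b2] [c1 c2].
  by case: (c) => d1 d2 /=; ring.
have := RintegralD measurableT (tame_integrable tA) (tame_integrable tB).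
rewrite h1 h2 addr0; under eq_Rintegral do rewrite AB.
rewrite RintegralZl//; last first.
  have := integrableB measurableT (tame_integrable td) (tame_integrable (tc n.+1 m)).
  exact.
rewrite RintegralB//; [|exact: tame_integrable|exact: tame_integrable].
by move=> /eqP; rewrite mulf_eq0 pnatr_eq0/= subr_eq0 => /eqP ->.
Qed.

Lemma mono_conj n m z : (mono n m z)^*%C = mono m n z.
Proof. by rewrite /mono conjcM !conjcX conjcK mulrC. Qed.

Lemma integral_mono_swap c n m :
  \int[g]_z complex.Re (c * mono n m z) = \int[g]_z complex.Re (c^*%C * mono m n z).
Proof. by apply: eq_Rintegral => z _; rewrite -[LHS]ReJ conjcM mono_conj. Qed.

(** Iterating the recursion lowers both exponents until one of them is zero. *)
Lemma integral_mono c n m :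
  \int[g]_z complex.Re (c * mono n m z) = (n == m)%:R * n`!%:R * complex.Re c.
Proof.
have z0 : \int[g]_z (0 : R) = 0 by rewrite /Rintegral integral0.
have m0 k : \int[g]_z complex.Re (c * mono k.+1 0 z) = 0.
  rewrite mono_recursion -[RHS]z0; apply: eq_Rintegral => z _.
  by rewrite /dbar_mono mulr0n mulr0.
elim: n m c m0 => [|n ih] [|m] c m0.
- rewrite mul1r fact0 mul1r (_ : (fun z => _) = cst (complex.Re c)).
    rewrite Rintegral_cst// -[RHS]mulr1; congr (_ * _).
    exact: (congr1 fine (gaussian_setT R)).
  by apply/funext => z; rewrite /mono !expr0 !mulr1.
- rewrite integral_mono_swap mono_recursion -[LHS]addr0 !mul0r addr0 -[RHS]z0.
  by apply: eq_Rintegral => z _; rewrite /dbar_mono mulr0n mulr0.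
- by rewrite m0 !mul0r.
- rewrite mono_recursion eqSS.
  transitivity (\int[g]_z complex.Re ((c *+ m.+1) * mono n m z)).
    by apply: eq_Rintegral => z _; rewrite /dbar_mono/= mulrnAr mulrnAl.
  rewrite ih ?ReMn; last first.
    move=> k; rewrite mono_recursion -[RHS]z0; apply: eq_Rintegral => z _.
    by rewrite /dbar_mono mulr0n mulr0.
  have [->|_] := eqVneq n m; last by rewrite !mul0r.
  by rewrite !mul1r factS natrM -mulr_natl; ring.
Qed.

Definition fock_psum (a : nat -> R[i]) N z := fact_psum (fun n => a n * z ^+ n) N.

Lemma tame_fock_psum a N : tame (fun z => fock_psum a N (toC z)).
Proof.
apply: tame_sum => i; apply: tameM; last exact: tame_cst.
by apply: tameM; [exact: tame_cst|apply: tameX; exact: tame_toC].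
Qed.

Lemma measurable_complex_lim (f_ : nat -> plane R -> R[i]) f :
  (forall n, measurable_complex (f_ n)) ->
  (forall z, (fun n => f_ n z : R[i]^o) @ \oo --> (f z : R[i]^o)) ->
  measurable_complex f.
Proof.
move=> mf ff; split.
- apply: (measurable_fun_cvg (h := fun n z => complex.Re (f_ n z))).
    by move=> n; case: (mf n).
  by move=> z _; have /cvg_complexP[] := ff z.
- apply: (measurable_fun_cvg (h := fun n z => complex.Im (f_ n z))).
    by move=> n; case: (mf n).
  by move=> z _; have /cvg_complexP[] := ff z.
Qed.

Lemma tame_fock a : has_expo_bound a -> tame (fun z => fock a (toC z)).
Proof.
move=> ha; split.
  apply: (@measurable_complex_lim (fun N z => fock_psum a N (toC z))).
    by move=> N; case: (tame_fock_psum a N).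
  by move=> z; apply: has_cvg_fact_series; exact: has_fock.
have [D [b b0 aB]] := ha; exists D, b; split=> //; first exact: expo_bound_D_ge0 aB.
by move=> z; exact: normc_fock.
Qed.

Lemma integral_fock_psum a b N :
  \int[g]_z complex.Re (fock_psum a N (toC z) * (fock_psum b N (toC z))^*%C) =
  complex.Re (fact_psum (fun n => a n * (b n)^*%C) N).
Proof.
pose w (i j : nat) : R[i] := a i * (b j)^*%C * (i`!%:R^-1 * j`!%:R^-1).
have E z : fock_psum a N (toC z) * (fock_psum b N (toC z))^*%C =
    \sum_(i < N) \sum_(j < N) w i j * mono i j z.
  rewrite /fock_psum /fact_psum conjc_sum mulr_suml; apply: eq_bigr => i _.
  rewrite mulr_sumr; apply: eq_bigr => j _; rewrite !conjcM !conjcX.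
  have -> : (j`!%:R^-1 : R[i])^*%C = j`!%:R^-1 by rewrite natrC_inv conjc_real.
  by rewrite /w /mono; ring.
under eq_Rintegral do rewrite E.
have tw i j : tame (fun z => w i j * mono i j z).
  by apply: tameM; [exact: tame_cst|exact: tame_mono].
rewrite tame_integral_sum; last by move=> i; apply: tame_sum => j; exact: tw.
rewrite /fact_psum Re_sum; apply: eq_bigr => i _.
rewrite tame_integral_sum; last by move=> j; exact: tw.
under eq_bigr do rewrite integral_mono.
rewrite (bigD1 i)//= big1 ?addr0; last first.
  by move=> j ij; rewrite (_ : (i : nat) == j = false) ?mul0r//; apply/negbTE; rewrite eq_sym.
rewrite eqxx mul1r -[LHS]/(i`!%:R * complex.Re _) /w.
have f0 : i`!%:R != 0 :> R[i] by rewrite pnatr_eq0 -lt0n fact_gt0.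
rewrite -[X in X * _](_ : complex.Re i`!%:R = _); last by rewrite natrC.
transitivity (complex.Re (i`!%:R * (a i * (b i)^*%C * (i`!%:R^-1 * i`!%:R^-1)))).
  by rewrite ReM natrC/= mul0r subr0.
by congr complex.Re; field.
Qed.

(** Term by term by orthogonality of the monomials; all partial sums are
    dominated by one exponential of the modulus. *)
Lemma fock_isometry a b : has_expo_bound a -> has_expo_bound b ->
  \int[g]_z complex.Re (fock a (toC z) * (fock b (toC z))^*%C) =
  complex.Re (fact_series (fun n => a n * (b n)^*%C)).
Proof.
move=> ha hb.
have [Da [Ba Ba0 aB]] := ha; have [Db [Bb Bb0 bB]] := hb.
have hab : has_expo_bound (fun n => a n * (b n)^*%C).
  by apply: has_expo_boundM => //; exact: has_expo_bound_conj.
have psB (D B : R) (u : nat -> R[i]) N z : 0 <= B -> expo_bound D B u ->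
    normc (fock_psum u N (toC z)) <= D * expR (B * modulus z).
  move=> B0 uB; rewrite modulusE; apply: normc_fact_psum; first by rewrite mulr_ge0 ?normc_ge0.
  by move=> n; rewrite normcM normcX exprMn mulrA ler_wpM2r// exprn_ge0 ?normc_ge0.
have := has_cvg_fact_series hab; move=> /cvg_complexP[lim1 _].
suff h : \int[g]_z complex.Re (fock_psum a N (toC z) * (fock_psum b N (toC z))^*%C)
    @[N --> \oo] --> \int[g]_z complex.Re (fock a (toC z) * (fock b (toC z))^*%C).
  apply: (cvg_unique _ _ lim1) => //.
  by move: h; under eq_fun do rewrite integral_fock_psum.
apply: (@dominated_cvg_Rintegral _ _ R g _ _ (fun z => Da * Db * expR ((Ba + Bb) * modulus z))).
- move=> N; have [] := tameM (tame_fock_psum a N) (tame_conj (tame_fock_psum b N)).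
  by case.
- have [] := tameM (tame_fock ha) (tame_conj (tame_fock hb)).
  by case.
- exact: integrable_expR_modulus.
- move=> N z; rewrite (le_trans (normc_Re _))// normcM normc_conj mulrDl expRD mulrACA.
  by rewrite ler_pM ?normc_ge0//; exact: psB.
- move=> z; have /cvg_complexP[] // : (fun N => fock_psum a N (toC z) * (fock_psum b N (toC z))^*%C : R[i]^o)
     @ \oo --> (fock a (toC z) * (fock b (toC z))^*%C : R[i]^o).
  apply: cvgM; first by apply: has_cvg_fact_series; exact: has_fock.
  by apply: cvg_conjc; apply: has_cvg_fact_series; exact: has_fock.
Qed.

End complex_gaussian_integrals.

(** * Mean number of points in a disk *)

Section disk_area.
Variable R : realType.
Local Notation M := (measurableTypeR R).
Local Notation lambda := (@lebesgue_measure R).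
Local Notation g := (@gaussian R).
Local Notation rho := (@gaussian_density R).

(** By the substitution [s = sqrt r * sin t]. *)
Lemma semicircle_integral (r : R) : 0 < r ->
  (\int[lambda]_(s in `[(- Num.sqrt r)%R, Num.sqrt r]) (2 * Num.sqrt (r - s ^+ 2))%:E =
   (pi * r)%:E)%E.
Proof.
move=> r0; have sr0 : 0 < Num.sqrt r by rewrite sqrtr_gt0.
pose F (t : R) := Num.sqrt r * sin t.
have pi20 : - (pi / 2) < pi / 2 :> R by rewrite gtrN// divr_gt0// pi_gt0.
have dF t : is_derive t (1 : R) F (Num.sqrt r * cos t).
  by apply: trigger_derive; rewrite /GRing.scale/=; ring.
have F'E : F^`()%classic = (fun t => Num.sqrt r * cos t).
  by apply/funext => t; rewrite derive1E; have [_ ->] := dF t.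
have cF' : continuous (fun t : R => Num.sqrt r * cos t).
  by move=> t; apply: cvgM; [exact: cvg_cst|exact: continuous_cos].
have cF : continuous F.
  by move=> t; apply: cvgM; [exact: cvg_cst|exact: continuous_sin].
have FN : F (- (pi / 2)) = - Num.sqrt r by rewrite /F sinN sin_pihalf mulrN1.
have FP : F (pi / 2) = Num.sqrt r by rewrite /F sin_pihalf mulr1.
have incF : {in `[- (pi / 2), pi / 2] &, {homo F : x y / x < y}}.
  move=> x y xI yI xy; rewrite /F ltr_pM2l//.
  move: xI yI; rewrite !in_itv/= => /andP[x1 x2] /andP[y1 y2].
  by rewrite ltr_sin// in_itv/= ?x1 ?x2 ?y1 ?y2.
rewrite -{1}FN -{1}FP (integration_by_substitution_increasing (ltW pi20))//; last 5 first.
- by rewrite F'E => t _; exact: cF'.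
- by rewrite F'E; apply/cvg_ex; exists (Num.sqrt r * cos (- (pi / 2))); apply: cvg_at_right_filter; exact: cF'.
- by rewrite F'E; apply/cvg_ex; exists (Num.sqrt r * cos (pi / 2)); apply: cvg_at_left_filter; exact: cF'.
- split.
  + by move=> t _; have [] := dF t.
  + by apply: cvg_at_right_filter; exact: cF.
  + by apply: cvg_at_left_filter; exact: cF.
- apply: continuous_subspaceT => s; apply: cvgM; first exact: cvg_cst.
  apply: (cvg_comp (fun s => r - s ^+ 2) Num.sqrt); last exact: sqrt_continuous.
  by apply: cvgB; [exact: cvg_cst|exact: sqr_continuous].
pose H (t : R) := r * (t + sin t * cos t).
have dH t : is_derive t (1 : R) H (2 * r * cos t ^+ 2).
  apply: trigger_derive; rewrite /GRing.scale/=.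
  have := cos2Dsin2 t => h.
  have -> : sin t * - sin t = cos t ^+ 2 - 1 by rewrite -h; ring.
  ring.
transitivity (\int[lambda]_(t in `[(- (pi / 2))%R, (pi / 2)%R]) (2 * r * cos t ^+ 2)%:E)%E.
  apply: eq_integral => t; rewrite inE/= in_itv/= => tI.
  congr EFin; rewrite !fctE F'E /F exprMn sqr_sqrtr ?ltW//.
  have -> : r - r * sin t ^+ 2 = r * cos t ^+ 2 by rewrite cos2sin2; ring.
  rewrite sqrtrM ?ltW// sqrtr_sqr ger0_norm; last exact: cos_ge0_pihalf.
  have -> : 2 * (Num.sqrt r * cos t) * (Num.sqrt r * cos t) = 2 * (Num.sqrt r ^+ 2) * cos t ^+ 2 by ring.
  by rewrite sqr_sqrtr ?ltW.
rewrite (@continuous_FTC2 _ _ H)//.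
- by congr EFin; rewrite /H sinN cosN cos_pihalf !mulr0 !addr0; field.
- apply: continuous_subspaceT => t; apply: cvgM; first exact: cvg_cst.
  rewrite expr2; apply: cvgM; exact: continuous_cos.
- have cH : continuous H.
    by move=> t; apply/differentiable_continuous/derivable1_diffP; have [] := dH t.
  split.
  + by move=> t _; have [] := dH t.
  + by apply: cvg_at_right_filter; exact: cH.
  + by apply: cvg_at_left_filter; exact: cH.
- by move=> t _; rewrite derive1E; have [_ ->] := dH t.
Qed.

Lemma disk_area (r : R) : 0 < r ->
  (\int[lambda \x lambda]_z (\1_(disk (Num.sqrt r)) z)%:E = (pi * r)%:E)%E.
Proof.
move=> r0.
have mD : measurable_fun setT (\1_(disk (Num.sqrt r)) : M * M -> R).
  apply: measurable_indic.
  have -> : disk (Num.sqrt r) = (@modulus R) @^-1` `]-oo, Num.sqrt r].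
    by apply/seteqP; split => z; rewrite /disk/= in_itv.
  have := @measurable_modulus R measurableT `]-oo, Num.sqrt r]%classic.
  by rewrite setTI; apply.
rewrite (@fubini_tonelli1 _ _ M M R lambda lambda (fun z : M * M => (\1_(disk (Num.sqrt r)) z)%:E))//; last first.
  by apply/measurable_EFinP; exact: mD.
have diskP (s t : R) : disk (Num.sqrt r) (s, t) <-> t ^+ 2 <= r - s ^+ 2.
  rewrite /disk/= /modulus/= ler_sqrt//; last exact: ltW.
  by rewrite lerBrDl.
have sec (s : M) : (\int[lambda]_t (\1_(disk (Num.sqrt r)) (s, t))%:E =
    (2 * Num.sqrt (r - s ^+ 2))%:E)%E.
  have [sr|sr] := leP (s ^+ 2) r; last first.
    rewrite [X in 2 * X]ler0_sqrtr ?mulr0; last by rewrite subr_le0 ltW.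
    rewrite (eq_integral (fun=> 0%E)) ?integral0// => t _.
    rewrite indicE memNset// => /diskP h; have := sqr_ge0 t; lra.
  set a := Num.sqrt (r - s ^+ 2).
  have a2 : a ^+ 2 = r - s ^+ 2 by rewrite sqr_sqrtr// subr_ge0.
  have a0 : 0 <= a by exact: sqrtr_ge0.
  transitivity (\int[lambda]_t (\1_(`[(- a)%R, a] : set M) t)%:E)%E.
    apply: eq_integral => t _; congr (_%:R)%:E; congr nat_of_bool.
    apply/idP/idP; rewrite !inE/= in_itv/= -ler_norml.
    - move=> /diskP; rewrite -a2 -real_normK ?num_real// => h.
      by rewrite -(ler_pXn2r (n := 2)) ?nnegrE.
    - move=> h; apply/diskP; rewrite -a2 -[t ^+ 2]real_normK ?num_real//.
      by rewrite lerXn2r ?nnegrE.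
  have Hm := lebesgue_measure_itv `[(- a)%R, a]; rewrite /= lte_fin in Hm.
  rewrite integral_indic// setIT; apply: etrans Hm _.
  case: ifPn => h; first by rewrite -EFinD opprK; congr EFin; ring.
  have -> : a = 0 by lra.
  by rewrite mulr0.
rewrite -(semicircle_integral r0) [RHS]integral_mkcond.
apply: eq_integral => s _; rewrite /fubini_F sec patchE; case: ifPn => //.
rewrite notin_setE/= in_itv/= -ler_norml => /negP; rewrite -ltNge => h.
rewrite [X in 2 * X]ler0_sqrtr ?mulr0// subr_le0 ltW// -(sqr_sqrtr (ltW r0)) -[ltRHS]real_normK ?num_real//.
by rewrite ltrXn2r ?nnegrE ?sqrtr_ge0.
Qed.

Lemma measurable_disk (r : R) : measurable (disk r).
Proof.
have -> : disk r = (@modulus R) @^-1` `]-oo, r].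
  by apply/seteqP; split => z; rewrite /disk/= in_itv.
have := @measurable_modulus R measurableT `]-oo, r]%classic.
by rewrite setTI; apply.
Qed.

(** The exponential, which is the density of the Ginibre process with respect to
    [g], cancels the Gaussian and leaves the area of the disk over [pi]. *)
Lemma gaussian_disk (r : R) : 0 < r ->
  \int[g]_z (\1_(disk (Num.sqrt r)) z * expR (modulus z ^+ 2)) = r.
Proof.
move=> r0; rewrite /Rintegral integral_gaussian; last first.
  apply: measurable_funM; first by apply: measurable_indic; exact: measurable_disk.
  by apply: measurableT_comp => //; apply: measurable_funX; exact: measurable_modulus.
transitivity (fine (pi^-1%:E * \int[lambda \x lambda]_z (\1_(disk (Num.sqrt r)) z)%:E)%E); last first.
  by rewrite disk_area//= mulrA mulVf ?mul1r// gt_eqF// pi_gt0.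
congr fine; rewrite -ge0_integralZl//.
- apply: eq_integral => z _; rewrite -EFinM; congr EFin.
  rewrite /gaussian_density mulrACA -[RHS]mulrC -mulrA; congr (_ * _).
  by rewrite -expRD subrr expR0 mulr1.
- by apply/measurable_EFinP; apply: measurable_indic; exact: (@measurable_disk (Num.sqrt r)).
- by rewrite lee_fin invr_ge0 pi_ge0.
Qed.

End disk_area.

(** * Radial moments of the Ginibre kernel *)

Section multiplication_by_z.
Variable R : realType.
Implicit Types (a : nat -> R[i]) (z : R[i]).

(** Coefficients of the product of the entire function by [z], see [fock_shift]. *)
Definition shift_coef a n : R[i] := n%:R * a n.-1.

Lemma has_expo_bound_natr : has_expo_bound (fun n => n%:R : R[i]).
Proof.
exists 1, 2 => [//|n]; rewrite natrC normc_real ger0_norm// mul1r.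
by rewrite -natrX ler_nat ltnW// ltn_expl.
Qed.

Lemma has_expo_bound_pred a : has_expo_bound a -> has_expo_bound (fun n => a n.-1).
Proof.
move=> [D [B B0 aB]]; exists D, (B + 1) => [|n]; first by rewrite addr_ge0.
rewrite (le_trans (aB _))// ler_wpM2l ?(expo_bound_D_ge0 aB)//.
case: n => [|n]; first by rewrite !expr0.
rewrite (le_trans (_ : _ <= (B + 1) ^+ n))//.
  by rewrite lerXn2r ?nnegrE ?addr_ge0// lerDl.
by rewrite exprS ler_peMl ?exprn_ge0 ?addr_ge0// lerDr.
Qed.

Lemma has_shift_coef a : has_expo_bound a -> has_expo_bound (shift_coef a).
Proof.
move=> ha; apply: has_expo_boundM; first exact: has_expo_bound_natr.
exact: has_expo_bound_pred.
Qed.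

Lemma fact_psum_shift a N : fact_psum (shift_coef a) N.+1 = fact_psum a N.
Proof.
rewrite /fact_psum big_ord_recl /shift_coef/= !mul0r add0r.
apply: eq_bigr => i _; rewrite /= /bump leq0n add1n/= factS natrM invfM.
have i1 : i.+1%:R != 0 :> R[i] by rewrite pnatr_eq0.
have -> : (0 + i)%N = i by [].
move: (i`!%:R^-1) => f; rewrite mulrACA mulfV// mul1r //.
Qed.

Lemma fact_series_shift a : has_expo_bound a ->
  fact_series (shift_coef a) = fact_series a.
Proof.
move=> ha; apply: fact_series_unique.
have h := has_cvg_fact_series ha.
rewrite -(cvg_shiftS (fact_psum (shift_coef a) : nat -> R[i]^o)).
by under eq_fun do rewrite fact_psum_shift.
Qed.

Lemma fock_shift a z : has_expo_bound a -> fock (shift_coef a) z = z * fock a z.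
Proof.
move=> ha; rewrite /fock -fact_seriesZ; last exact: has_fock.
rewrite -[RHS]fact_series_shift; last first.
  by apply: has_expo_boundM; [exact: has_expo_bound_cst|exact: has_fock].
congr fact_series; apply/funext => -[|n]; rewrite /shift_coef ?mul0r//=.
by rewrite exprS; ring.
Qed.

Lemma exp_moment1 z : fact_series (fun n => n%:R * z ^+ n) = z * cexp z.
Proof.
rewrite cexpE -fact_seriesZ; last exact: has_expo_boundX.
rewrite -[RHS]fact_series_shift; last first.
  by apply: has_expo_boundM; [exact: has_expo_bound_cst|exact: has_expo_boundX].
congr fact_series; apply/funext => -[|n]; rewrite /shift_coef ?mul0r//=.
by rewrite exprS.
Qed.

Lemma exp_moment2 z : fact_series (fun n => n%:R * (n%:R * z ^+ n)) =
  (z ^+ 2 + z) * cexp z.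
Proof.
have h1 : has_expo_bound (fun n => n%:R * z ^+ n).
  by apply: has_expo_boundM; [exact: has_expo_bound_natr|exact: has_expo_boundX].
have hX := has_expo_boundX z.
have -> : (fun n => n%:R * (n%:R * z ^+ n)) =
    shift_coef (fun n => z * (n%:R * z ^+ n) + z * z ^+ n).
  apply/funext => -[|n]; rewrite /shift_coef ?mul0r//=.
  by rewrite exprS -natr1; ring.
have hz1 : has_expo_bound (fun n => z * (n%:R * z ^+ n)).
  by apply: has_expo_boundM => //; exact: has_expo_bound_cst.
have hz2 : has_expo_bound (fun n => z * z ^+ n).
  by apply: has_expo_boundM => //; exact: has_expo_bound_cst.
rewrite fact_series_shift; last exact: has_expo_boundD.
by rewrite fact_seriesD// !fact_seriesZ// exp_moment1 -cexpE; ring.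
Qed.

End multiplication_by_z.

Section ginibre_moments.
Variable R : realType.
Local Notation g := (@gaussian R).
Implicit Types (p q : plane R).

Definition conj_pow q n : R[i] := (toC q)^*%C ^+ n.

Lemma has_conj_pow q : has_expo_bound (conj_pow q).
Proof. exact: has_expo_boundX. Qed.

Lemma modulus_sqrC q : toC q * (toC q)^*%C = (modulus q ^+ 2)%:C%C.
Proof. by rewrite mulc_conj modulusE. Qed.

Lemma cexp_real (t : R) : cexp t%:C%C = (expR t)%:C%C.
Proof. by rewrite cexpE exp_series_real. Qed.

Lemma conj_powM q n : conj_pow q n * (conj_pow q n)^*%C = ((modulus q ^+ 2)%:C%C) ^+ n.
Proof. by rewrite /conj_pow conjcX conjcK -exprMn mulrC modulus_sqrC. Qed.

Lemma ginibre_diag p : ginibre_kernel p p = (expR (modulus p ^+ 2))%:C%C.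
Proof. by rewrite /ginibre_kernel modulus_sqrC cexp_real. Qed.

Lemma normc_fock_sqr (a : nat -> R[i]) (z : R[i]) :
  complex.Re (fock a z * (fock a z)^*%C) = normc (fock a z) ^+ 2.
Proof. by rewrite mulc_conj. Qed.

Lemma fock_norm (a : nat -> R[i]) : has_expo_bound a ->
  \int[g]_p normc (fock a (toC p)) ^+ 2 =
  complex.Re (fact_series (fun n => a n * (a n)^*%C)).
Proof.
move=> ha; rewrite -fock_isometry//.
by apply: eq_Rintegral => p _; rewrite normc_fock_sqr.
Qed.

Lemma tame_normc_sqr (f : plane R -> R[i]) : tame f ->
  g.-integrable setT (fun z => (normc (f z) ^+ 2)%:E).
Proof.
move=> tf; have := tame_integrable (tameM tf (tame_conj tf)).
by apply: eq_integrable => // z _; rewrite mulc_conj.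
Qed.

Lemma integral_ginibre0 q :
  \int[g]_p normc (ginibre_kernel p q) ^+ 2 = expR (modulus q ^+ 2).
Proof.
under eq_Rintegral do rewrite ginibre_fock.
rewrite (fock_norm (has_conj_pow q)).
under eq_fun do rewrite conj_powM.
by rewrite -cexpE cexp_real.
Qed.

Lemma integral_ginibre1 q :
  \int[g]_p (modulus p ^+ 2 * normc (ginibre_kernel p q) ^+ 2) =
  (modulus q ^+ 2 + 1) * expR (modulus q ^+ 2).
Proof.
set x := modulus q ^+ 2.
transitivity (\int[g]_p normc (fock (shift_coef (conj_pow q)) (toC p)) ^+ 2).
  apply: eq_Rintegral => p _.
  rewrite fock_shift; last exact: has_conj_pow.
  by rewrite -ginibre_fock normcM exprMn -modulusE.
rewrite fock_norm; last by apply: has_shift_coef; exact: has_conj_pow.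
have -> : (fun n => shift_coef (conj_pow q) n * (shift_coef (conj_pow q) n)^*%C) =
    shift_coef (fun n => n%:R * x%:C%C ^+ n + x%:C%C ^+ n).
  apply/funext => -[|n]; rewrite /shift_coef ?mul0r//=.
  rewrite conjcM conjc_nat -[in RHS]conj_powM -natr1; ring.
have h1 : has_expo_bound (fun n => n%:R * (x%:C%C : R[i]) ^+ n).
  by apply: has_expo_boundM; [exact: has_expo_bound_natr|exact: has_expo_boundX].
have h2 : has_expo_bound (fun n => (x%:C%C : R[i]) ^+ n) by exact: has_expo_boundX.
rewrite fact_series_shift; last exact: has_expo_boundD.
rewrite fact_seriesD// exp_moment1 -cexpE cexp_real -rmorphM -rmorphD/=.
ring.
Qed.

Lemma integral_ginibre2 q :
  \int[g]_p (modulus p ^+ 4 * normc (ginibre_kernel p q) ^+ 2) =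
  (modulus q ^+ 4 + 4 * modulus q ^+ 2 + 2) * expR (modulus q ^+ 2).
Proof.
have -> : modulus q ^+ 4 = (modulus q ^+ 2) ^+ 2 by rewrite -exprM.
set x := modulus q ^+ 2.
have hs := has_shift_coef (has_conj_pow q).
transitivity (\int[g]_p normc (fock (shift_coef (shift_coef (conj_pow q))) (toC p)) ^+ 2).
  apply: eq_Rintegral => p _.
  rewrite fock_shift// fock_shift; last exact: has_conj_pow.
  by rewrite -ginibre_fock !normcM -modulusE; ring.
rewrite fock_norm; last exact: has_shift_coef.
pose u n : R[i] := n%:R * (n%:R * x%:C%C ^+ n) + 3 * (n%:R * x%:C%C ^+ n) + 2 * x%:C%C ^+ n.
have h0 : has_expo_bound (fun n => (x%:C%C : R[i]) ^+ n) by exact: has_expo_boundX.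
have h1 : has_expo_bound (fun n => n%:R * (x%:C%C : R[i]) ^+ n).
  by apply: has_expo_boundM; [exact: has_expo_bound_natr|exact: h0].
have h2 : has_expo_bound (fun n => n%:R * (n%:R * (x%:C%C : R[i]) ^+ n)).
  by apply: has_expo_boundM; [exact: has_expo_bound_natr|exact: h1].
have h1' : has_expo_bound (fun n => 3 * (n%:R * (x%:C%C : R[i]) ^+ n)).
  by apply: has_expo_boundM; [exact: has_expo_bound_cst|exact: h1].
have h0' : has_expo_bound (fun n => 2 * (x%:C%C : R[i]) ^+ n).
  by apply: has_expo_boundM; [exact: has_expo_bound_cst|exact: h0].
have h21 := has_expo_boundD h2 h1'.
have hu : has_expo_bound u by exact: has_expo_boundD.
have -> : (fun n => shift_coef (shift_coef (conj_pow q)) n *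
     (shift_coef (shift_coef (conj_pow q)) n)^*%C) = shift_coef (shift_coef u).
  apply/funext => -[|[|n]]; rewrite /shift_coef ?mul0r ?mulr0 ?mul0r//=.
  by rewrite !conjcM !conjc_nat /u -!conj_powM -!natr1; ring.
rewrite fact_series_shift; last exact: has_shift_coef.
rewrite fact_series_shift// /u fact_seriesD// fact_seriesD// !fact_seriesZ//.
rewrite exp_moment1 exp_moment2 -cexpE cexp_real.
have -> : 2 = (2 : R)%:C%C :> R[i] by rewrite natrC.
have -> : 3 = (3 : R)%:C%C :> R[i] by rewrite natrC.
by rewrite -!(rmorphM, rmorphD, rmorphXn)/=; ring.
Qed.

Lemma tame_ginibre q : tame (fun p => ginibre_kernel p q).
Proof.
under eq_fun do rewrite ginibre_fock.
by apply: tame_fock; exact: has_expo_boundX.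
Qed.

Lemma integrable_modulus_ginibre k q :
  g.-integrable setT (fun p => (modulus p ^+ (k + k) * normc (ginibre_kernel p q) ^+ 2)%:E).
Proof.
have := tame_normc_sqr (tameM (tameX k (@tame_toC R)) (tame_ginibre q)).
apply: eq_integrable => // p _.
by rewrite normcM exprMn normcX -modulusE -exprM muln2 addnn.
Qed.

(** Under [`|K(p, q)|^2] the points [p] stay at distance of order [1] from [q],
    so that [`|p|^2 - `|q|^2] is only of order [`|q|]. This is the source of the
    bounded variance of the smoothed counts. *)
Lemma integral_ginibre_dist q :
  \int[g]_p ((modulus p ^+ 2 - modulus q ^+ 2) ^+ 2 * normc (ginibre_kernel p q) ^+ 2) =
  (2 * modulus q ^+ 2 + 2) * expR (modulus q ^+ 2).
Proof.
have i0 := integrable_modulus_ginibre 0 q.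
have i1 := integrable_modulus_ginibre 1 q.
have i2 := integrable_modulus_ginibre 2 q.
set x := modulus q ^+ 2.
transitivity (\int[g]_p (modulus p ^+ 4 * normc (ginibre_kernel p q) ^+ 2 +
   ((- 2 * x) * (modulus p ^+ 2 * normc (ginibre_kernel p q) ^+ 2) +
    x ^+ 2 * (modulus p ^+ 0 * normc (ginibre_kernel p q) ^+ 2)))).
  by apply: eq_Rintegral => p _; ring.
have j1 := integrableZl measurableT (- 2 * x) i1.
have j0 := integrableZl measurableT (x ^+ 2) i0.
have j10 := integrableD measurableT j1 j0.
rewrite RintegralD// RintegralD// RintegralZl// RintegralZl//.
rewrite integral_ginibre2 integral_ginibre1.
under [X in _ + (_ + _ * X)]eq_Rintegral do rewrite expr0 mul1r.
rewrite integral_ginibre0 -/x (_ : modulus q ^+ 4 = x ^+ 2); last by rewrite -exprM.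
ring.
Qed.

End ginibre_moments.

(** * The Palm density and its defect *)

Section palm_density.
Variables (R : realType) (l : nat) (x : 'rV[plane R]_l).
Local Notation g := (@gaussian R).
Local Notation Kx := (palm_kernel ginibre_kernel x).
Local Notation K := (@ginibre_kernel R).
Implicit Types p q : plane R.

Definition palm_density p : R := complex.Re (Kx p p).
Definition palm_corr p q : R := normc (Kx p q) ^+ 2.

Lemma palm_corrC p q : palm_corr p q = palm_corr q p.
Proof. by rewrite /palm_corr [Kx q p]palm_kernel_conj normc_conj. Qed.

Lemma palm_corr_ge0 p q : 0 <= palm_corr p q.
Proof. exact: sqr_ge0. Qed.

Lemma palm_kernel_diag p : Kx p p = (palm_density p)%:C%C.
Proof.
apply: complex_ext => //=; have := congr1 (@complex.Im R) (palm_kernel_conj x p p).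
by rewrite ImJ => /eqP; rewrite -subr_eq0 opprK -mulr2n mulrn_eq0/= => /eqP.
Qed.

Lemma measurable_ginibre : measurable_complex (fun pq : plane R * plane R => K pq.1 pq.2).
Proof.
apply: measurable_cexp; apply: measurable_complexM.
  apply: (@measurable_complex_comp _ _ _ _ _ (@toC R)); first exact: measurable_fst.
  by have [] := @tame_toC R.
apply: measurable_complex_conj.
apply: (@measurable_complex_comp _ _ _ _ _ (@toC R)); first exact: measurable_snd.
by have [] := @tame_toC R.
Qed.

Lemma measurable_palm_defect :
  measurable_complex (fun pq : plane R * plane R => K pq.1 pq.2 - Kx pq.1 pq.2).
Proof.
under eq_fun do rewrite palm_defectE.
apply: measurable_complex_sum => k; apply: measurable_complexM.
  apply: (@measurable_complex_comp _ _ _ _ _ (fun p => fock (palm_dual x k) (toC p))).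
    exact: measurable_fst.
  by have [] := tame_fock (has_palm_dual x k).
apply: measurable_complex_conj.
apply: (@measurable_complex_comp _ _ _ _ _ (fun p => fock (fun n => ncoef x n k) (toC p))).
  exact: measurable_snd.
have hn : has_expo_bound (fun n => ncoef x n k) by exact: ncoef_expo.
by have [] := tame_fock hn.
Qed.

Lemma measurable_palm_kernel :
  measurable_complex (fun pq : plane R * plane R => Kx pq.1 pq.2).
Proof.
have -> : (fun pq : plane R * plane R => Kx pq.1 pq.2) =
    (fun pq => K pq.1 pq.2 + - (K pq.1 pq.2 - Kx pq.1 pq.2)).
  by apply/funext => pq; rewrite subKr.
apply: measurable_complexD; first exact: measurable_ginibre.
by apply: measurable_complexN; exact: measurable_palm_defect.
Qed.

Lemma measurable_palm_corr :
  measurable_fun setT (fun pq : plane R * plane R => palm_corr pq.1 pq.2).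
Proof. exact/measurable_normc_sqr/measurable_palm_kernel. Qed.

Lemma measurable_palm_density : measurable_fun setT palm_density.
Proof.
have md : measurable_fun setT (fun p : plane R => (p, p)) by exact: measurable_fun_pair.
by have [] := measurable_complex_comp md measurable_palm_kernel.
Qed.

Definition palm_defect p : R := complex.Re (K p p - Kx p p).

Lemma palm_densityE p : palm_density p = expR (modulus p ^+ 2) - palm_defect p.
Proof. by rewrite /palm_defect ReD ReN ginibre_diag/= subKr. Qed.

Lemma tame_palm_defect : tame (fun p => K p p - Kx p p).
Proof.
under eq_fun do rewrite palm_defectE.
apply: tame_sum => k; apply: tameM; first exact/tame_fock/has_palm_dual.
by apply/tame_conj/tame_fock; exact: ncoef_expo.
Qed.

Lemma integrable_palm_defect : g.-integrable setT (fun p => (palm_defect p)%:E).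
Proof. exact: tame_integrable tame_palm_defect. Qed.

(** The trace of the projection removed by the conditioning: on average, [l]
    points are missing. *)
Lemma integral_palm_defect : \int[g]_p palm_defect p = l%:R.
Proof.
rewrite /palm_defect; under eq_Rintegral do rewrite palm_defectE.
have hn k : has_expo_bound (fun n => ncoef x n k) by exact: ncoef_expo.
rewrite tame_integral_sum; last first.
  move=> k; apply: tameM; first exact/tame_fock/has_palm_dual.
  by apply/tame_conj/tame_fock; exact: hn.
under eq_bigr do rewrite (fock_isometry (has_palm_dual x _) (hn _)).
by rewrite -Re_sum palm_dual_trace natrC.
Qed.

Lemma tame_palm_kernel q : tame (fun p => Kx p q).
Proof.
under eq_fun do rewrite palm_kernel_fock.
by apply: tame_fock; exact: has_palm_coef.
Qed.

Lemma integrable_palm_corr q : g.-integrable setT (fun p => (palm_corr p q)%:E).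
Proof. exact: tame_normc_sqr (tame_palm_kernel q). Qed.

(** The reproducing property, [Kx] being the kernel of a projection. *)
Lemma integral_palm_corr q : \int[g]_p palm_corr p q = palm_density q.
Proof.
rewrite /palm_corr; under eq_Rintegral do rewrite palm_kernel_fock.
by rewrite fock_norm ?palm_coef_norm//; exact: has_palm_coef.
Qed.

Lemma eintegral_palm_corr q : (\int[g]_p (palm_corr p q)%:E = (palm_density q)%:E)%E.
Proof. by rewrite integral_Rintegral ?integral_palm_corr//; exact: integrable_palm_corr. Qed.

Lemma palm_density_ge0 q : 0 <= palm_density q.
Proof.
by rewrite -lee_fin -eintegral_palm_corr integral_ge0// => p _; rewrite lee_fin palm_corr_ge0.
Qed.

Lemma palm_corr_split p q : palm_corr p q <=
  2 * normc (K p q) ^+ 2 + 2 * normc (K p q - Kx p q) ^+ 2.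
Proof.
have h : normc (Kx p q) <= normc (K p q) + normc (K p q - Kx p q).
  rewrite -[X in normc (X) <= _](subKr (K p q)).
  by rewrite (le_trans (le_normcD _ _))// normcN.
have h0 := normc_ge0 (Kx p q).
move: h h0; rewrite /palm_corr.
move: (normc (Kx p q)) (normc (K p q)) (normc (K p q - _)) => a b c h h0.
have := sqr_ge0 (b - c); nra.
Qed.

Lemma measurable_ginibre_sqr :
  measurable_fun setT (fun pq : plane R * plane R => normc (K pq.1 pq.2) ^+ 2).
Proof. exact/measurable_normc_sqr/measurable_ginibre. Qed.

Lemma measurable_palm_defect_sqr :
  measurable_fun setT (fun pq : plane R * plane R => normc (K pq.1 pq.2 - Kx pq.1 pq.2) ^+ 2).
Proof. exact/measurable_normc_sqr/measurable_palm_defect. Qed.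

Lemma palm_defect_square_integrable : exists C : R,
  (\int[g \x g]_pq (normc (K pq.1 pq.2 - Kx pq.1 pq.2) ^+ 2)%:E <= C%:E)%E.
Proof.
have [D [b [D0 b0 Kb]]] := palm_defect_bound x.
have Ib := integrable_expR_modulus 1 (2 * b).
have I : g.-integrable setT (fun z => (expR (2 * b * modulus z))%:E).
  by apply: eq_integrable Ib => // z _; rewrite mul1r.
exists (D ^+ 2 * ((\int[g]_z expR (2 * b * modulus z)) * (\int[g]_z expR (2 * b * modulus z)))).
have mE : measurable_fun setT (fun z : plane R => (expR (2 * b * modulus z))%:E).
  by case/integrableP : I.
have mE2 : measurable_fun setT (fun z : plane R => expR (2 * b * modulus z)).
  exact/measurable_EFinP.
apply: (@le_trans _ _ (\int[g \x g]_pq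
    (D ^+ 2 * (expR (2 * b * modulus pq.1) * expR (2 * b * modulus pq.2)))%:E)%E).
  apply: ge0_le_integral => //.
  - by move=> pq _; rewrite lee_fin sqr_ge0.
  - by apply/measurable_EFinP; exact: measurable_palm_defect_sqr.
  - apply/measurable_EFinP; apply: measurable_funM => //; apply: measurable_funM.
      by apply: (measurableT_comp mE2); exact: measurable_fst.
    by apply: (measurableT_comp mE2); exact: measurable_snd.
  - move=> pq _; rewrite lee_fin.
    have := Kb pq.1 pq.2; have := normc_ge0 (K pq.1 pq.2 - Kx pq.1 pq.2).
    rewrite -!modulusE => h0 h; rewrite (le_trans (lerXn2r 2 _ _ h)) ?nnegrE ?mulr_ge0 ?expR_ge0//.
    by rewrite !exprMn -!expRM_natl !mulrA.
rewrite fubini_tonelli1//; last 2 first.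
- apply/measurable_EFinP; apply: measurable_funM => //; apply: measurable_funM.
    by apply: (measurableT_comp mE2); exact: measurable_fst.
  by apply: (measurableT_comp mE2); exact: measurable_snd.
- by move=> pq; rewrite lee_fin !mulr_ge0// ?sqr_ge0 ?expR_ge0.
rewrite /fubini_F/=.
set E := \int[g]_z expR (2 * b * modulus z).
under eq_integral => z _.
  under eq_integral => w _ do rewrite mulrA EFinM.
  rewrite integralZl// integral_Rintegral// -EFinM -/E.
  rewrite (_ : D ^+ 2 * _ * E = D ^+ 2 * E * expR (2 * b * modulus z)); last by ring.
  rewrite EFinM; over.
rewrite integralZl// integral_Rintegral// -EFinM lee_fin -/E.
by rewrite mulrA.
Qed.

End palm_density.

(** * Riemann sums of monotone functions *)

Section riemann_sums.
Variable R : realType.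
Local Notation lambda := (@lebesgue_measure R).

Definition riemann_avg (h : R -> R) (t : R) n : R :=
  n.+1%:R^-1 * \sum_(i < n.+1) h (i.+1%:R * (t / n.+1%:R)).

Section monotone.
Variables (h : R -> R) (t : R).
Hypothesis t0 : 0 < t.
Hypothesis hm : {homo h : a b / a <= b}.

Lemma integrable_monotone (a b : R) : lambda.-integrable `[a, b]%classic (EFin \o h).
Proof.
have mh : measurable_fun setT h.
  by apply: nondecreasing_measurable => //; move=> u v _ _; exact: hm.
apply: measurable_bounded_integrable => //.
- have [ab|ba] := leP a b.
    by rewrite /= lebesgue_measure_itv/=; case: ifPn => // _; rewrite -EFinD ltry.
  by rewrite set_itv_ge ?measure0 ?bnd_simp -?ltNge//.
- exact: measurable_funTS.
- exists (`|h a| + `|h b|); split; first exact: num_real.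
  move=> M hM z /=; rewrite in_itv/= => /andP[az zb].
  apply: le_trans (ltW hM).
  have h1 := hm az; have h2 := hm zb.
  rewrite ler_norml; have := ler_norm (h b); have := ler_norm (- h a).
  have := normr_ge0 (h a); have := normr_ge0 (h b).
  by rewrite normrN => *; apply/andP; split; lra.
Qed.

Let H b := \int[lambda]_(r in `[0, b]) h r.

Lemma primitive_bounds a b : 0 <= a -> a <= b ->
  (b - a) * h a <= H b - H a <= (b - a) * h b.
Proof.
move=> a0 ab; rewrite /H (@Rintegral_itvB R h (BLeft 0) (BRight b) a); last 3 first.
- exact: integrable_monotone.
- by rewrite bnd_simp.
- by rewrite bnd_simp.
have ih : lambda.-integrable `]a, b]%classic (EFin \o h).
  apply: (integrableS _ _ _ (integrable_monotone a b)) => //.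
  exact: subset_itv_oc_cc.
have ic c : lambda.-integrable `]a, b]%classic (EFin \o cst c).
  apply: measurable_bounded_integrable => //.
    by rewrite /= lebesgue_measure_itv/=; case: ifPn => // _; rewrite -EFinD ltry.
  exists `|c|; split; first exact: num_real.
  by move=> M hM z /= _; exact: ltW.
have lab : fine (lambda `]a, b]%classic) = b - a.
  rewrite lebesgue_measure_itv/= lte_fin; case: ltP => //= ba.
  by apply/eqP; rewrite eq_sym subr_eq0 eq_le ab ba.
rewrite -lab ![fine _ * _]mulrC -!(Rintegral_cst lambda (measurable_itv `]a, b])).
apply/andP; split.
- apply: (le_Rintegral _ (ic (h a)) ih) => // z /=.
  by rewrite in_itv/= => /andP[az _]; exact/hm/ltW.
- apply: (le_Rintegral _ ih (ic (h b))) => // z /=.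
  by rewrite in_itv/= => /andP[_ zb]; exact: hm.
Qed.

Lemma primitive0 : H 0 = 0.
Proof. by rewrite /H set_itv1 Rintegral_set1. Qed.

Lemma riemann_avg_error n :
  0 <= riemann_avg h t n - t^-1 * H t <= n.+1%:R^-1 * (h t - h 0).
Proof.
set N : R := n.+1%:R; have N0 : 0 < N by rewrite ltr0n.
pose a (i : nat) : R := i%:R * (t / N).
have d0 : 0 < t / N by exact: divr_gt0.
have a0 i : 0 <= a i by rewrite mulr_ge0// ltW.
have aS i : a i.+1 - a i = t / N by rewrite /a -natr1; ring.
have aaS i : a i <= a i.+1 by rewrite -subr_ge0 aS ltW.
have aN : a n.+1 = t by rewrite /a -/N; field; rewrite gt_eqF.
have tel (u : nat -> R) : \sum_(i < n.+1) (u i.+1 - u i) = u n.+1 - u 0%N.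
  by rewrite -(big_mkord xpredT (fun i => u i.+1 - u i)) telescope_sumr.
have HE : H t = \sum_(i < n.+1) (H (a i.+1) - H (a i)).
  by rewrite (tel (fun i => H (a i))) aN /a mul0r primitive0 subr0.
have E : riemann_avg h t n - t^-1 * H t =
    t^-1 * \sum_(i < n.+1) (t / N * h (a i.+1) - (H (a i.+1) - H (a i))).
  rewrite sumrB -HE mulrBr -mulr_sumr mulrA mulrA mulVf ?gt_eqF// mul1r.
  by [].
rewrite E; apply/andP; split.
  apply: mulr_ge0; first by rewrite invr_ge0 ltW.
  apply: sumr_ge0 => i _; rewrite subr_ge0.
  by have /andP[_] := primitive_bounds (a0 i) (aaS i); rewrite aS.
apply: (@le_trans _ _ (t^-1 * \sum_(i < n.+1) (t / N * (h (a i.+1) - h (a i))))).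
  apply: ler_wpM2l; first by rewrite invr_ge0 ltW.
  apply: ler_sum => i _; rewrite mulrBr lerD2l lerN2.
  by have /andP[+ _] := primitive_bounds (a0 i) (aaS i); rewrite aS.
rewrite -mulr_sumr (tel (fun i => h (a i))) aN /a mul0r !mulrA mulVf ?gt_eqF// mul1r.
by [].
Qed.

(** On each step the error is at most its length times the increment of [h], and
    the increments telescope. In use, [h] counts points and jumps. *)
Lemma cvg_riemann_avg :
  riemann_avg h t n @[n --> \oo] --> t^-1 * \int[lambda]_(r in `[0, t]) h r.
Proof.
rewrite -/(H t) -[X in _ --> X]addr0.
have -> : riemann_avg h t = (fun n => t^-1 * H t + (riemann_avg h t n - t^-1 * H t)).
  by apply/funext => n; rewrite addrC subrK.
apply: cvgD; first exact: cvg_cst.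
apply: (@squeeze_cvgr _ _ _ _ (fun=> 0) (fun n => n.+1%:R^-1 * (h t - h 0))).
- by apply: nearW => n; exact: riemann_avg_error.
- exact: cvg_cst.
- rewrite -[X in _ --> X](mul0r (h t - h 0)); apply: cvgM; last exact: cvg_cst.
  exact: cvg_harmonic.
Qed.

Lemma cvg_riemann_avg_id : riemann_avg id t n @[n --> \oo] --> t / 2.
Proof.
have S n : \sum_(i < n) (i.+1%:R : R) = n%:R * n.+1%:R / 2.
  elim: n => [|n ih]; first by rewrite big_ord0 !mul0r.
  by rewrite big_ord_recr/= ih -!natr1; field.
have -> : riemann_avg id t = (fun n => t / 2 + n.+1%:R^-1 * (t / 2)).
  apply/funext => n; rewrite /riemann_avg -mulr_suml S -natr1.
  by have N0 : n.+1%:R != 0 :> R; [rewrite pnatr_eq0|field].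
rewrite -[X in _ --> X]addr0; apply: cvgD; first exact: cvg_cst.
rewrite -[X in _ --> X](mul0r (t / 2)); apply: cvgM; last exact: cvg_cst.
exact: cvg_harmonic.
Qed.

End monotone.

End riemann_sums.

(** * Counting points in disks *)

Section configuration_statistics.
Variable R : realType.
Local Notation conf := (configuration R).
Implicit Types (s : conf) (z : plane R) (r : R).

(** The Borel sets of configurations are those of the vague topology, which makes
    these functions continuous. Disk counts are limits of them. *)
Lemma measurable_linear_statistic (f : Cc R) :
  measurable_fun setT (fun s : conf => \int[s]_z f z).
Proof.
have cf : continuous (fun s : conf => \int[s]_z f z).
  have cv : continuous (@vague_map R) by exact: initial_continuous.
  have cp : continuous (fun u : {ptws Cc R -> R} => u f).
    move=> u A nA; have /cvg_sup/(_ f) h : u --> u by exact: cvg_id.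
    exact/h/(@initial_continuous _ _ (fun u : Cc R -> R => u f) u).
  move=> s; exact: (continuous_comp (cv s) (cp _)).
apply: (measurability (@RGenOInfty.G R)); first exact: RGenOInfty.measurableE.
move=> _ [_ [a ->] <-]; rewrite setTI; apply: sub_sigma_algebra.
by apply: open_comp => [s _|]; [exact: cf|exact: interval_open].
Qed.

Lemma continuous_modulus : continuous (@modulus R).
Proof.
move=> z; apply: (cvg_comp (fun z : plane R => z.1 ^+ 2 + z.2 ^+ 2) Num.sqrt).
  apply: cvgD; apply: (cvg_comp _ (fun a : R => a ^+ 2)).
  - exact: cvg_fst.
  - exact: sqr_continuous.
  - exact: cvg_snd.
  - exact: sqr_continuous.
exact: sqrt_continuous.
Qed.

Lemma compact_disk r : compact (disk r : set (plane R)).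
Proof.
apply: (@subclosed_compact _ _ (`[(- r)%R, r]%classic `*` `[(- r)%R, r]%classic)).
- have -> : disk r = (@modulus R) @^-1` [set a | a <= r] by [].
  by apply: closed_comp => [z _|]; [exact: continuous_modulus|exact: closed_le].
- by apply: compact_setX; exact: segment_compact.
- move=> z; rewrite /disk/= => zr.
  have z1 : `|z.1| <= modulus z by rewrite modulusE; exact: (normc_Re (toC z)).
  have z2 : `|z.2| <= modulus z by rewrite modulusE; exact: (normc_Im (toC z)).
  by rewrite !in_itv/= -!ler_norml; split; exact: le_trans zr.
Qed.

Lemma bounded_disk r : bounded_set (disk r : set (plane R)).
Proof. exact/compact_bounded/compact_disk. Qed.

Lemma configuration_disk_fin s r : (s (disk r) < +oo)%E.
Proof. by have [+ _] := configurationP s; apply; exact: compact_disk. Qed.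

(** Continuous functions decreasing to the indicator of a closed disk. *)
Definition bump r n z : R := Num.max 0 (Num.min 1 (1 - n.+1%:R * (modulus z - r))).

Lemma bump_bounds r n z : 0 <= bump r n z <= 1.
Proof. by rewrite /bump le_max lexx/= ge_max ler01/= ge_min lexx. Qed.

Lemma bump_in r n z : disk r z -> bump r n z = 1.
Proof.
rewrite /disk/= => zr; rewrite /bump min_l ?max_r//.
by rewrite lerBrDl gerDr// pmulr_rle0 ?ltr0n// subr_le0.
Qed.

Lemma bump_out r n z : n.+1%:R^-1 <= modulus z - r -> bump r n z = 0.
Proof.
move=> h; rewrite /bump max_l// ge_min; apply/orP; right.
by rewrite subr_le0 -(ler_pdivrMl _ _ (ltr0Sn R n)) mulr1.
Qed.

Lemma continuous_bump r n : continuous (bump r n).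
Proof.
have c1 : continuous (fun z : plane R => 1 - n.+1%:R * (modulus z - r)).
  move=> z; apply: cvgB; first exact: cvg_cst.
  apply: cvgM; first exact: cvg_cst.
  by apply: cvgB; [exact: continuous_modulus|exact: cvg_cst].
have c2 : continuous ((fun=> 1) \min (fun z : plane R => 1 - n.+1%:R * (modulus z - r))).
  by move=> z; apply: continuous_min; [exact: cvg_cst|exact: c1].
have c3 : continuous ((fun=> 0) \max ((fun=> 1) \min (fun z : plane R => 1 - n.+1%:R * (modulus z - r)))).
  by move=> z; apply: continuous_max; [exact: cvg_cst|exact: c2].
exact: c3.
Qed.

Lemma bump_support r n z : ~ disk (r + 1) z -> bump r n z = 0.
Proof.
move=> /negP; rewrite /disk/= -ltNge => h; apply: bump_out.
have h1 : n.+1%:R^-1 <= 1 :> R by rewrite invf_le1 ?ltr0n// ler1n.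
by move: (n.+1%:R^-1) h1 => e h1; lra.
Qed.

Definition bump_Cc r n : Cc R := mkCc (@continuous_bump r n)
  (ex_intro2 _ _ (disk (r + 1)) (@compact_disk (r + 1)) (@bump_support r n)).

Lemma cvg_bump r z : bump r n z @[n --> \oo] --> (\1_(disk r) z : R).
Proof.
rewrite indicE; case: (boolP (z \in disk r)) => zr.
  have -> : (fun n => bump r n z) = (fun=> 1).
    by apply/funext => n; rewrite bump_in//; rewrite inE in zr.
  exact: cvg_cst.
have {}zr : 0 < modulus z - r.
  by rewrite subr_gt0 ltNge; apply/negP => h; move: zr; rewrite notin_setE; apply.
apply: (@cvg_near_cst _ _ _ _ \oo).
have := @cvg_harmonic R => /cvgr_lt/(_ _ zr).
apply: filterS => n h; apply: bump_out; exact: ltW.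
Qed.

Lemma measurable_bump r n : measurable_fun setT (bump r n).
Proof.
apply: measurable_maxr; first exact: measurable_cst.
apply: measurable_minr; first exact: measurable_cst.
apply: measurable_funB; first exact: measurable_cst.
apply: measurable_funM; first exact: measurable_cst.
by apply: measurable_funB; [exact: measurable_modulus|exact: measurable_cst].
Qed.

Definition disk_count r s : R := fine (s (disk (Num.sqrt r))).

Lemma configuration_disk_integrable s r :
  (s : {measure set (plane R) -> \bar R}).-integrable setT (fun z => (\1_(disk r) z)%:E).
Proof.
apply/integrableP; split.
  by apply/measurable_EFinP/measurable_indic; exact: measurable_disk.
under eq_integral do rewrite abse_EFin ger0_norm//.
rewrite integral_indic ?setIT//; last exact: measurable_disk.
exact: configuration_disk_fin.
Qed.

Lemma cvg_bump_statistic r s :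
  \int[s]_z bump_Cc (Num.sqrt r) n z @[n --> \oo] --> disk_count r s.
Proof.
set a := Num.sqrt r.
have -> : disk_count r s = \int[s]_z (\1_(disk a) z : R).
  rewrite /disk_count /Rintegral integral_indic ?setIT//.
  exact: measurable_disk.
apply: (@dominated_cvg_Rintegral _ _ R s _ _ (fun z => \1_(disk (a + 1)) z)).
- by move=> n; exact: measurable_bump.
- by apply: measurable_indic; exact: measurable_disk.
- exact: configuration_disk_integrable.
- move=> n z; have /andP[b0 b1] := bump_bounds a n z.
  rewrite /= ger0_norm//; have [zr|zr] := pselect (disk (a + 1) z).
    by rewrite indicE mem_set.
  by rewrite bump_support.
- by move=> z; exact: cvg_bump.
Qed.

Lemma measurable_disk_count r : measurable_fun setT (disk_count r).
Proof.
apply: (measurable_fun_cvg (h := fun n s => \int[s]_z bump_Cc (Num.sqrt r) n z)).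
  by move=> n; exact: measurable_linear_statistic.
by move=> s _; exact: cvg_bump_statistic.
Qed.

Lemma disk_count_ge0 r s : 0 <= disk_count r s.
Proof. exact: fine_ge0. Qed.

Lemma configuration_disk_fin_num s r : s (disk r) \is a fin_num.
Proof. by rewrite ge0_fin_numE ?configuration_disk_fin. Qed.

Lemma disk_sub (a b : R) : a <= b -> disk a `<=` (disk b : set (plane R)).
Proof. by move=> ab z; rewrite /disk/= => /le_trans; apply. Qed.

Lemma disk_count_mono s : {homo disk_count ^~ s : a b / a <= b}.
Proof.
move=> a b ab; rewrite /disk_count fine_le ?configuration_disk_fin_num//.
apply: le_measure; rewrite ?inE; [exact: measurable_disk|exact: measurable_disk|].
exact/disk_sub/ler_wsqrtr.
Qed.

Lemma averaged_discrepancyE t s : 0 < t ->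
  averaged_discrepancy t s =
  t^-1 * \int[lebesgue_measure]_(r in `[0, t]) disk_count r s - t / 2.
Proof.
move=> t0; rewrite /averaged_discrepancy.
have hN := @disk_count_mono s.
rewrite RintegralB//; last 2 first.
- exact: (integrable_monotone hN).
- by apply: (integrable_monotone (h := id)).
rewrite mulrBr; congr (_ - _).
have h1 := cvg_riemann_avg t0 (fun a b (ab : a <= b) => ab : id a <= id b).
have h2 := @cvg_riemann_avg_id R t.
by rewrite -(cvg_lim (@Rhausdorff R) h1); exact: (cvg_lim (@Rhausdorff R) h2).
Qed.

End configuration_statistics.

(** * Averages over the radius *)

Section finite_integral.
Context d (T : measurableType d) (R : realType).
Variable mu : {measure set T -> \bar R}.

(** In [\bar R] a difference of infinities is infinite, so a finite integral
    forces both parts to be integrable. The correlation functions then provide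
    the integrability of the falling factorials along with their mean. *)
Lemma integrable_of_fin_num (f : T -> R) : measurable_fun setT f ->
  (\int[mu]_t (f t)%:E)%E \is a fin_num ->
  mu.-integrable setT (fun t => (f t)%:E).
Proof.
move=> mf; rewrite integralE fin_numB => /andP[fp fn].
have mf' : measurable_fun setT (fun t => (f t)%:E) by exact/measurable_EFinP.
apply/integrableP; split=> //.
rewrite (eq_integral (fun t => (fun t => (f t)%:E)^\+ t + (fun t => (f t)%:E)^\- t)%E); last first.
  by move=> t _; rewrite -[LHS]/((abse \o (fun t => (f t)%:E)) t) fune_abse.
rewrite ge0_integralD//; last 2 first.
- exact: measurable_funepos.
- exact: measurable_funeneg.
by rewrite lte_add_pinfty// ltey_eq ?fp ?fn.
Qed.

Lemma eq_integral_Rintegral (f : T -> R) (c : R) : measurable_fun setT f ->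
  (\int[mu]_t (f t)%:E = c%:E)%E ->
  mu.-integrable setT (fun t => (f t)%:E) /\ \int[mu]_t f t = c.
Proof.
move=> mf E; split; last by rewrite /Rintegral E.
by apply: integrable_of_fin_num => //; rewrite E.
Qed.

Lemma integrable_avg (N : R -> T -> R) (t : R) n :
  (forall r, mu.-integrable setT (fun w => (N r w)%:E)) ->
  mu.-integrable setT (fun w => (riemann_avg (N ^~ w) t n)%:E) /\
  \int[mu]_w riemann_avg (N ^~ w) t n = riemann_avg (fun r => \int[mu]_w N r w) t n.
Proof.
move=> iN; rewrite /riemann_avg.
have H (k m : nat) :
    mu.-integrable setT (fun w => (\sum_(i < m) N (i.+1%:R * (t / k%:R)) w)%:E) /\
    \int[mu]_w (\sum_(i < m) N (i.+1%:R * (t / k%:R)) w) =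
    \sum_(i < m) \int[mu]_w N (i.+1%:R * (t / k%:R)) w.
  elim: m => [|m [ih1 ih2]].
    split; first by under eq_fun do rewrite big_ord0; exact: integrable0.
    by rewrite big_ord0; under eq_Rintegral do rewrite big_ord0; rewrite /Rintegral integral0.
  have E w : \sum_(i < m.+1) N (i.+1%:R * (t / k%:R)) w =
     \sum_(i < m) N (i.+1%:R * (t / k%:R)) w + N (m.+1%:R * (t / k%:R)) w.
    by rewrite big_ord_recr.
  split; first by under eq_fun do rewrite E EFinD; exact: integrableD.
  rewrite (funext E).
  by rewrite (RintegralD measurableT ih1 (iN _)) ih2 big_ord_recr.
have [iS ES] := H n.+1 n.+1.
split; first exact: (integrableZl measurableT (n.+1%:R^-1) iS).
by rewrite RintegralZl// ES.
Qed.

(** Exchanges the mean with the average over radii. Riemann sums take the place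
    of Fubini, so that [N r w] is handled for one [r] at a time. *)
Lemma cvg_integral_riemann (N : R -> T -> R) (Z h : T -> R) (t : R) : 0 < t ->
  (forall w, {homo N ^~ w : a b / a <= b}) -> (forall r w, 0 <= N r w) ->
  measurable_fun setT Z -> (forall r, measurable_fun setT (N r)) ->
  measurable_fun setT h -> (forall w, `|Z w| <= h w) ->
  (forall r, mu.-integrable setT (fun w => (h w * N r w)%:E)) ->
  riemann_avg (fun r => \int[mu]_w (Z w * N r w)) t n @[n --> \oo] -->
  \int[mu]_w (Z w * (t^-1 * \int[lebesgue_measure]_(r in `[0, t]) N r w)).
Proof.
move=> t0 Nm N0 mZ mN mh Zh ihN.
have mav n : measurable_fun setT (fun w => riemann_avg (N ^~ w) t n).
  apply: measurable_funM; first exact: measurable_cst.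
  by apply: measurable_sum => i; exact: mN.
have lim w : riemann_avg (N ^~ w) t n @[n --> \oo] -->
    t^-1 * \int[lebesgue_measure]_(r in `[0, t]) N r w.
  exact: cvg_riemann_avg.
have iZN r : mu.-integrable setT (fun w => (Z w * N r w)%:E).
  apply: (dominated_integrable_real _ (ihN r)); first exact: measurable_funM.
  by move=> w; rewrite normrM (ger0_norm (N0 _ _)) ler_wpM2r.
have E n : riemann_avg (fun r => \int[mu]_w (Z w * N r w)) t n =
    \int[mu]_w (Z w * riemann_avg (N ^~ w) t n).
  rewrite -(integrable_avg t n iZN).2; apply: eq_Rintegral => w _.
  by rewrite /riemann_avg -mulr_sumr mulrCA.
under eq_fun do rewrite E.
apply: (@dominated_cvg_Rintegral _ _ _ mu _ _ (fun w => h w * N t w)).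
- by move=> n; exact: measurable_funM.
- apply: measurable_funM => //.
  by apply: (measurable_fun_cvg (h := fun n w => riemann_avg (N ^~ w) t n)).
- exact: ihN.
- move=> n w; rewrite normrM ler_pM// ger0_norm; last first.
    by rewrite mulr_ge0 ?invr_ge0// sumr_ge0.
  rewrite /riemann_avg -[leRHS](mulKf (_ : n.+1%:R != 0 :> R)) ?pnatr_eq0//.
  rewrite ler_wpM2l ?invr_ge0// (le_trans (_ : _ <= \sum_(i < n.+1) N t w))//.
    apply: ler_sum => i _; apply: Nm.
    rewrite mulrCA ger_pMr// ler_pdivrMr ?ltr0n// mul1r ler_nat.
    exact: ltn_ord.
  by rewrite sumr_const card_ord mulr_natl.
- by move=> w; apply: cvgM; [exact: cvg_cst|exact: lim].
Qed.

End finite_integral.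

Section tensor_products.
Context d (T : measurableType d) (R : realType).
Variable mu : {sigma_finite_measure set T -> \bar R}.

Lemma integrable_tensor (u v : T -> R) :
  mu.-integrable setT (fun z => (u z)%:E) -> mu.-integrable setT (fun z => (v z)%:E) ->
  (mu \x mu)%E.-integrable setT (fun zw => (u zw.1 * v zw.2)%:E).
Proof.
move=> iu iv.
have mu_ : measurable_fun setT u by apply/measurable_EFinP; case/integrableP : iu.
have mv_ : measurable_fun setT v by apply/measurable_EFinP; case/integrableP : iv.
apply/integrable12ltyP.
  apply/measurable_EFinP; apply: measurable_funM.
    by apply: (measurableT_comp mu_); exact: measurable_fst.
  by apply: (measurableT_comp mv_); exact: measurable_snd.
have iv' := integrable_norm iv; have iu' := integrable_norm iu.
under eq_integral => z _.
  under eq_integral => w _ do rewrite /= normrM EFinM.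
  rewrite integralZl// integral_Rintegral// -EFinM mulrC EFinM; over.
rewrite integralZl//= ltey_eq fin_numM//.
exact: integrable_fin_num.
Qed.

Lemma Rintegral_tensor (u v : T -> R) :
  mu.-integrable setT (fun z => (u z)%:E) -> mu.-integrable setT (fun z => (v z)%:E) ->
  \int[(mu \x mu)%E]_zw (u zw.1 * v zw.2) = (\int[mu]_z u z) * (\int[mu]_z v z).
Proof.
move=> iu iv; rewrite {1}/Rintegral -(integral12_prod_meas1 (integrable_tensor iu iv)).
rewrite /fubini_F/=.
under eq_integral => z _.
  under eq_integral => w _ do rewrite EFinM.
  rewrite integralZl// integral_Rintegral// -EFinM mulrC EFinM; over.
by rewrite integralZl// integral_Rintegral//= mulrC.
Qed.

End tensor_products.

Section tent.
Variable R : realType.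
Local Notation lambda := (@lebesgue_measure R).
Implicit Types (z : plane R) (r t : R).

Definition disk_indic r z : R := \1_(disk (Num.sqrt r)) z.

Lemma disk_indicE r z : 0 <= r -> disk_indic r z = \1_(`[modulus z ^+ 2, +oo[) r.
Proof.
move=> r0; rewrite /disk_indic !indicE; congr (nat_of_bool _)%:R.
apply/idP/idP; rewrite !inE/= in_itv/= andbT /disk/=.
  by move=> h; rewrite -(sqr_sqrtr r0) lerXn2r ?nnegrE ?sqrtr_ge0 ?modulus_ge0.
by rewrite -{1}(sqr_sqrtr r0) ler_pXn2r ?nnegrE ?sqrtr_ge0 ?modulus_ge0.
Qed.

Lemma disk_indic_ge0 r z : 0 <= disk_indic r z. Proof. by rewrite /disk_indic indicE. Qed.

Lemma disk_indic_le1 r z : disk_indic r z <= 1.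
Proof. by rewrite /disk_indic indicE lern1 leq_b1. Qed.

Lemma disk_indic_mono z : {homo disk_indic ^~ z : a b / a <= b}.
Proof.
move=> a b ab; rewrite /disk_indic !indicE ler_nat.
case: (boolP (z \in disk (Num.sqrt a))) => // /set_mem za.
rewrite mem_set//; exact: (disk_sub (ler_wsqrtr ab)).
Qed.

Lemma measurable_disk_indic r : measurable_fun setT (disk_indic r).
Proof. by apply: measurable_indic; exact: measurable_disk. Qed.

(** The average over the radii of the counts in disks is the linear statistic of
    this cone, see [tentE]. *)
Definition tent t z : R := t^-1 * \int[lambda]_(r in `[0, t]) disk_indic r z.

Lemma tentE t z : 0 < t -> tent t z = t^-1 * Num.max 0 (t - modulus z ^+ 2).
Proof.
move=> t0; congr (_ * _).
transitivity (\int[lambda]_(r in `[0, t]) (\1_(`[modulus z ^+ 2, +oo[) r : R)).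
  apply: eq_Rintegral => r; rewrite inE/= in_itv/= => /andP[r0 _].
  exact: disk_indicE.
rewrite /Rintegral integral_indic//.
have -> : `[modulus z ^+ 2, +oo[ `&` `[0, t] = `[modulus z ^+ 2, t]%classic.
  apply/seteqP; split=> r /=; rewrite !in_itv/= andbT.
    by move=> [-> /andP[_ ->]].
  move=> /andP[zr ->]; rewrite zr andbT; split=> //.
  by rewrite (le_trans _ zr)// sqr_ge0.
have := lebesgue_measure_itv `[modulus z ^+ 2, t]; rewrite /= lte_fin => H.
apply: etrans (congr1 fine H) _; case: ltP => h /=.
  by rewrite max_r// subr_ge0 ltW.
by rewrite max_l// subr_le0.
Qed.

Lemma measurable_tent t : 0 < t -> measurable_fun setT (tent t).
Proof.
move=> t0; rewrite (_ : tent t = fun z => t^-1 * Num.max 0 (t - modulus z ^+ 2)); last first.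
  by apply/funext => z; exact: tentE.
apply: measurable_funM; first exact: measurable_cst.
apply: measurable_maxr; first exact: measurable_cst.
apply: measurable_funB; first exact: measurable_cst.
by apply: measurable_funX; exact: measurable_modulus.
Qed.

Lemma tent_bounds t z : 0 < t -> 0 <= tent t z <= disk_indic t z.
Proof.
move=> t0; rewrite tentE// mulr_ge0 ?invr_ge0 ?(ltW t0) ?le_max ?lexx//=.
rewrite disk_indicE ?(ltW t0)// indicE mem_setE in_itv/= andbT ler_pdivrMl// ge_max.
have [h|h] := leP (modulus z ^+ 2) t; rewrite ?mulr1 ?mulr0 ?(ltW t0)/=.
  by rewrite gerBl sqr_ge0.
by rewrite lexx/= subr_le0 ltW.
Qed.

Lemma tent_le1 t z : 0 < t -> tent t z <= 1.
Proof. by move=> t0; have /andP[_ /le_trans->//] := tent_bounds z t0; exact: disk_indic_le1. Qed.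

Lemma cvg_tent (a : nat -> R) z : a n @[n --> \oo] --> +oo ->
  tent (a n) z @[n --> \oo] --> (1 : R).
Proof.
move=> a_oo; have ainv : (fun n => (a n)^-1) @ \oo --> (0 : R).
  by apply/gtr0_cvgV0 => //; exact: cvgry_gt.
have lim : 1 - (a n)^-1 * modulus z ^+ 2 @[n --> \oo] --> (1 : R).
  rewrite -[X in _ --> X]subr0 -[X in _ - X](mul0r (modulus z ^+ 2)).
  by apply: cvgB; [exact: cvg_cst|apply: cvgM => //; exact: cvg_cst].
apply: cvg_trans lim; apply: near_eq_cvg.
near=> n.
have h0 : 0 < a n by near: n; exact: cvgry_gt.
have hz : modulus z ^+ 2 <= a n by near: n; exact: cvgry_ge.
by rewrite tentE// max_r ?subr_ge0// mulrBr mulVf ?gt_eqF.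
Unshelve. all: by end_near. Qed.

Lemma tent_lipschitz t z w : 0 < t -> (tent t z - tent t w) ^+ 2 <=
  t^-1 ^+ 2 * ((disk_indic t z + disk_indic t w) * (modulus z ^+ 2 - modulus w ^+ 2) ^+ 2).
Proof.
move=> t0; rewrite !tentE// -mulrBr exprMn ler_wpM2l ?sqr_ge0//.
rewrite !disk_indicE ?(ltW t0)// !indicE !mem_setE !in_itv/= !andbT.
move: (modulus z ^+ 2) (modulus w ^+ 2) => a b.
have [h|h] := leP a t; have [k|k] := leP b t.
- by rewrite !max_r ?subr_ge0// (_ : t - a - (t - b) = - (a - b)); [|ring];
   rewrite sqrrN ler_peMl ?sqr_ge0//= -[leLHS]addr0 lerD.
- by rewrite max_r ?subr_ge0// max_l ?subr_le0 ?(ltW k)//= addr0 mul1r subr0; nra.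
- by rewrite max_l ?subr_le0 ?(ltW h)// max_r ?subr_ge0//= !add0r mul1r; nra.
- by rewrite !max_l ?subr_le0 ?(ltW h) ?(ltW k)//= subrr expr0n/= addr0 mul0r.
Qed.

End tent.

(** * One-point and two-point correlations *)

Section palm_moments.
Variables (R : realType) (l : nat) (x : 'rV[plane R]_l).
Local Notation g := (@gaussian R).
Local Notation gg := (@gaussian R \x @gaussian R)%E.
Local Notation pd := (palm_density x).
Local Notation pc := (palm_corr x).
Implicit Types (z w : plane R) (r : R).

Let pair_shuffle (a b c d e : R) : a * b * (c * d - e) = a * c * (b * d) - a * b * e.
Proof. by ring. Qed.

(** The two-point correlation function, a determinant of size two. *)
Definition palm_pair z w : R := pd z * pd w - pc z w.

Let pair_swap (a b c d : R) : c = d -> a * b - c = b * a - d.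
Proof. by move=> ->; rewrite mulrC. Qed.

Lemma palm_pairC z w : palm_pair z w = palm_pair w z.
Proof. exact: pair_swap (palm_corrC x z w). Qed.

Section cutoffs.
Variables (u : plane R -> R) (r : R).
Hypothesis mu : measurable_fun setT u.
Hypothesis ur : forall z, `|u z| <= disk_indic r z.

Lemma disk_indic_bound z (f : R) : 0 <= f ->
  (modulus z <= Num.sqrt r -> f <= expR (Num.sqrt r ^+ 2)) ->
  disk_indic r z * f <= expR (Num.sqrt r ^+ 2).
Proof.
move=> f0 h; rewrite /disk_indic indicE; case: (boolP (z \in disk _)) => [|_].
  by rewrite inE mul1r.
by rewrite mul0r expR_ge0.
Qed.

Lemma integrable_cutoff_density : g.-integrable setT (fun z => (u z * pd z)%:E).
Proof.
have ic : g.-integrable setT (fun z => (expR (Num.sqrt r ^+ 2))%:E).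
  exact: finite_measure_integrable_cst.
have id := integrable_norm (integrable_palm_defect x).
apply: (dominated_integrable_real _ (integrableD measurableT ic id)).
  by apply: measurable_funM => //; exact: measurable_palm_density.
move=> z; rewrite normrM palm_densityE.
have h0 := disk_indic_ge0 r z; have h1 := disk_indic_le1 r z.
have e0 : 0 <= expR (modulus z ^+ 2) by exact: expR_ge0.
have de : disk_indic r z * expR (modulus z ^+ 2) <= expR (Num.sqrt r ^+ 2).
  by apply: disk_indic_bound => // h; rewrite ler_expR lerXn2r ?nnegrE ?modulus_ge0 ?sqrtr_ge0.
have h2 := ler_normB (expR (modulus z ^+ 2)) (palm_defect x z).
rewrite (ger0_norm e0) in h2.
rewrite (le_trans (ler_pM _ _ (ur z) h2))// mulrDr lerD//.
by rewrite ler_piMl.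
Qed.

(** Cutting off one variable is enough, as the other one integrates out by the
    reproducing property. *)
Lemma integrable_cutoff_corr1 :
  gg.-integrable setT (fun zw => (u zw.1 * pc zw.1 zw.2)%:E).
Proof.
apply/integrable12ltyP.
  apply/measurable_EFinP; apply: measurable_funM; last exact: measurable_palm_corr.
  by apply: (measurableT_comp mu); exact: measurable_fst.
under eq_integral => z _.
  under eq_integral => w _ do
    rewrite /= normrM (ger0_norm (palm_corr_ge0 _ _ _)) EFinM palm_corrC.
  rewrite integralZl//; last exact: integrable_palm_corr.
  rewrite eintegral_palm_corr; over.
have := integrableP _ _ _ integrable_cutoff_density => -[_].
apply: le_lt_trans; rewrite le_eqVlt; apply/orP; left; apply/eqP.
by apply: eq_integral => z _; rewrite -EFinM /= normrM (ger0_norm (palm_density_ge0 _ _)).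
Qed.

Lemma integral_cutoff_corr1 :
  \int[gg]_zw (u zw.1 * pc zw.1 zw.2) = \int[g]_z (u z * pd z).
Proof.
rewrite {1}/Rintegral -(integral12_prod_meas1 integrable_cutoff_corr1) /fubini_F/=.
congr fine; apply: eq_integral => z _.
under eq_integral => w _ do rewrite EFinM palm_corrC.
rewrite integralZl//; last exact: integrable_palm_corr.
by rewrite eintegral_palm_corr.
Qed.

Lemma integrable_cutoff_corr2 :
  gg.-integrable setT (fun zw => (u zw.2 * pc zw.1 zw.2)%:E).
Proof.
apply/integrable21ltyP.
  apply/measurable_EFinP; apply: measurable_funM; last exact: measurable_palm_corr.
  by apply: (measurableT_comp mu); exact: measurable_snd.
under eq_integral => z _.
  under eq_integral => w _ do
    rewrite /= normrM (ger0_norm (palm_corr_ge0 _ _ _)) EFinM.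
  rewrite integralZl//; last exact: integrable_palm_corr.
  rewrite eintegral_palm_corr; over.
have := integrableP _ _ _ integrable_cutoff_density => -[_].
apply: le_lt_trans; rewrite le_eqVlt; apply/orP; left; apply/eqP.
by apply: eq_integral => z _; rewrite -EFinM /= normrM (ger0_norm (palm_density_ge0 _ _)).
Qed.

Lemma integral_cutoff_corr2 :
  \int[gg]_zw (u zw.2 * pc zw.1 zw.2) = \int[g]_z (u z * pd z).
Proof.
rewrite {1}/Rintegral -(integral21_prod_meas1 integrable_cutoff_corr2) /fubini_G/=.
congr fine; apply: eq_integral => z _.
under eq_integral => w _ do rewrite EFinM.
rewrite integralZl//; last exact: integrable_palm_corr.
by rewrite eintegral_palm_corr.
Qed.

End cutoffs.

Lemma integrable_cutoff_corr (u v : plane R -> R) r :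
  measurable_fun setT u -> (forall z, `|u z| <= 1) ->
  measurable_fun setT v -> (forall z, `|v z| <= disk_indic r z) ->
  gg.-integrable setT (fun zw => (u zw.1 * v zw.2 * pc zw.1 zw.2)%:E).
Proof.
move=> mu u1 mv vr.
have vr' z : `| `|v z| | <= disk_indic r z by rewrite normr_id.
have mv' : measurable_fun setT (fun z => `|v z|) by exact: measurableT_comp.
apply: (dominated_integrable_real _ (integrable_cutoff_corr2 mv' vr')).
  apply: measurable_funM; last exact: measurable_palm_corr.
  apply: measurable_funM.
    by apply: (measurableT_comp mu); exact: measurable_fst.
  by apply: (measurableT_comp mv); exact: measurable_snd.
move=> zw; rewrite normrM [`|_ * v _|]normrM (ger0_norm (palm_corr_ge0 _ _ _)).
by rewrite ler_wpM2r ?palm_corr_ge0// ler_piMl.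
Qed.

Lemma integrable_cutoff_pair (u v : plane R -> R) r q :
  measurable_fun setT u -> (forall z, `|u z| <= disk_indic r z) ->
  measurable_fun setT v -> (forall z, `|v z| <= disk_indic q z) ->
  gg.-integrable setT (fun zw => (u zw.1 * v zw.2 * palm_pair zw.1 zw.2)%:E).
Proof.
move=> mu ur mv vq.
have i1 := integrable_tensor (integrable_cutoff_density mu ur) (integrable_cutoff_density mv vq).
have u1 z : `|u z| <= 1 by rewrite (le_trans (ur z))// disk_indic_le1.
have i2 := integrable_cutoff_corr mu u1 mv vq.
have := integrableB measurableT i1 i2; apply: eq_integrable => // zw _.
by rewrite -EFinB /palm_pair pair_shuffle.
Qed.

Lemma integral_cutoff_pair (u v : plane R -> R) r q :
  measurable_fun setT u -> (forall z, `|u z| <= disk_indic r z) ->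
  measurable_fun setT v -> (forall z, `|v z| <= disk_indic q z) ->
  \int[gg]_zw (u zw.1 * v zw.2 * palm_pair zw.1 zw.2) =
  (\int[g]_z (u z * pd z)) * (\int[g]_z (v z * pd z)) -
  \int[gg]_zw (u zw.1 * v zw.2 * pc zw.1 zw.2).
Proof.
move=> mu ur mv vq.
have iu := integrable_cutoff_density mu ur; have iv := integrable_cutoff_density mv vq.
have u1 z : `|u z| <= 1 by rewrite (le_trans (ur z))// disk_indic_le1.
have i2 := integrable_cutoff_corr mu u1 mv vq.
rewrite -(Rintegral_tensor iu iv) -RintegralB//; last exact: (integrable_tensor iu iv).
by apply: eq_Rintegral => zw _; rewrite /palm_pair pair_shuffle.
Qed.
End palm_moments.

Section correlations.
Variables (R : realType) (l : nat) (x : 'rV[plane R]_l).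
Variables (Gx : probability (configuration R) R).
Hypothesis hGx : is_ginibre_palm x Gx.
Local Notation g := (@gaussian R).
Local Notation pd := (palm_density x).
Local Notation pc := (palm_corr x).

Lemma correlation1 (A : set (plane R)) : measurable A -> bounded_set A ->
  (\int[Gx]_s (fine (s A))%:E = \int[g]_z (\1_A z * pd z)%:E)%E.
Proof.
move=> mA bA.
have H := @hGx 1%N 1%N (fun=> A) (fun=> ord0) (fun=> mA) (fun=> bA) _.
rewrite /= in H; have {}H := H (fun i j _ _ _ => etrans (ord1 i) (esym (ord1 j))).
transitivity (\int[Gx]_s (\prod_(i < 1) falling_factorial (fine (s A)) #|[pred j : 'I_1 | ord0 == i]|)%:E)%E.
  apply: eq_integral => s _; congr EFin; rewrite big_ord1.
  rewrite (_ : #|_| = 1%N); last by rewrite (eq_card (B := predT)) ?card_ord.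
  by rewrite /falling_factorial big_ord1 subr0.
rewrite H; apply: eq_integral => z _; congr EFin.
by rewrite big_ord1 det_mx11 mxE.
Qed.

Lemma det_mx22 (K : comNzRingType) (M : 'M[K]_2) :
  \det M = M ord0 ord0 * M ord_max ord_max - M ord0 ord_max * M ord_max ord0.
Proof.
rewrite (expand_det_row _ ord0) !big_ord_recl big_ord0 addr0 /cofactor !det_mx11 !mxE/=.
have -> : lift (ord0 : 'I_2) ord0 = ord_max by exact: val_inj.
have -> : lift (ord_max : 'I_2) ord0 = ord0 by exact: val_inj.
by rewrite expr0 mul1r addn1 expr1 mulN1r mulrN.
Qed.

Lemma palm_det2 z w (zs : 2.-tuple (plane R)) : tnth zs ord0 = z -> tnth zs ord_max = w ->
  complex.Re (\det (\matrix_(i < 2, j < 2)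
    palm_kernel ginibre_kernel x (tnth zs i) (tnth zs j))) = palm_pair x z w.
Proof.
move=> zE wE; rewrite det_mx22 !mxE zE wE !palm_kernel_diag [palm_kernel _ x w z]palm_kernel_conj.
by rewrite mulc_conj -rmorphM -rmorphB.
Qed.

Lemma correlation2_diag (A : set (plane R)) : measurable A -> bounded_set A ->
  (\int[Gx]_s (fine (s A) * (fine (s A) - 1))%:E =
   \int[g]_z \int[g]_w (\1_A z * \1_A w * palm_pair x z w)%:E)%E.
Proof.
move=> mA bA.
have H := @hGx 2%N 1%N (fun=> A) (fun=> ord0) (fun=> mA) (fun=> bA) _.
rewrite /= in H; have {}H := H (fun i j _ _ _ => etrans (ord1 i) (esym (ord1 j))).
transitivity (\int[Gx]_s (\prod_(i < 1) falling_factorial (fine (s A)) #|[pred j : 'I_2 | ord0 == i]|)%:E)%E.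
  apply: eq_integral => s _; congr EFin; rewrite big_ord1.
  rewrite (_ : #|_| = 2%N); last by rewrite (eq_card (B := predT)) ?card_ord.
  by rewrite /falling_factorial big_ord_recl big_ord1 subr0.
rewrite H; apply: eq_integral => z _; apply: eq_integral => w _; congr EFin.
rewrite (@palm_det2 z w)//; congr (_ * _).
by rewrite big_ord_recl big_ord1.
Qed.

Lemma correlation2_disjoint (A B : set (plane R)) :
  measurable A -> measurable B -> bounded_set A -> bounded_set B ->
  A `&` B = set0 ->
  (\int[Gx]_s (fine (s A) * fine (s B))%:E =
   \int[g]_z \int[g]_w (\1_A z * \1_B w * palm_pair x z w)%:E)%E.
Proof.
move=> mA mB bA bB AB.
pose C (i : 'I_2) := if i == ord0 then A else B.
have mC i : measurable (C i) by rewrite /C; case: ifP.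
have bC i : bounded_set (C i) by rewrite /C; case: ifP.
have tC : trivIset [set: 'I_2] C.
  apply/trivIsetP => i j _ _; rewrite /C.
  have E (k : 'I_2) : k != ord0 -> k = ord_max by case: k => -[|[|k]] // h _; exact: val_inj.
  case: (boolP (i == ord0)) => [/eqP i0|/E i1]; case: (boolP (j == ord0)) => [/eqP j0|/E j1] //.
  - by rewrite i0 j0 eqxx.
  - by rewrite setIC.
  - by rewrite i1 j1 eqxx.
have H := @hGx 2%N 2%N C id mC bC tC; rewrite /= in H.
have c1 (i : 'I_2) : #|[pred j : 'I_2 | j == i]| = 1%N by apply: etrans (card1 i); exact: eq_card.
transitivity (\int[Gx]_s (\prod_(i < 2) falling_factorial (fine (s (C i))) #|[pred j : 'I_2 | j == i]|)%:E)%E.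
  apply: eq_integral => s _; congr EFin; rewrite big_ord_recl big_ord1 !c1.
  by rewrite /falling_factorial !big_ord1 !subr0.
rewrite H; apply: eq_integral => z _; apply: eq_integral => w _; congr EFin.
rewrite (@palm_det2 z w)//; congr (_ * _).
by rewrite big_ord_recl big_ord1.
Qed.

End correlations.

(** * Second moments of disk counts *)

Section count_moments.
Variables (R : realType) (l : nat) (x : 'rV[plane R]_l).
Variables (Gx : probability (configuration R) R).
Hypothesis hGx : is_ginibre_palm x Gx.
Local Notation g := (@gaussian R).
Local Notation gg := (@gaussian R \x @gaussian R)%E.
Local Notation pd := (palm_density x).
Local Notation pair := (palm_pair x).
Local Notation D r := (disk (Num.sqrt r) : set (plane R)).

Lemma norm_disk_indic (r : R) z : `|disk_indic r z| <= disk_indic r z.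
Proof. by rewrite ger0_norm ?disk_indic_ge0. Qed.

Lemma integral_fubini_pair (u v : plane R -> R) (r q : R) :
  measurable_fun setT u -> (forall z, `|u z| <= disk_indic r z) ->
  measurable_fun setT v -> (forall z, `|v z| <= disk_indic q z) ->
  (\int[g]_z \int[g]_w (u z * v w * pair z w)%:E =
   (\int[gg]_zw (u zw.1 * v zw.2 * pair zw.1 zw.2))%:E)%E.
Proof.
move=> mu ur mv vq; have i := integrable_cutoff_pair x mu ur mv vq.
by rewrite -(integral_Rintegral i) -(integral12_prod_meas1 i).
Qed.

Lemma disk_count_mean (r : R) : Gx.-integrable setT (fun s => (disk_count r s)%:E) /\
  \int[Gx]_s disk_count r s = \int[g]_z (disk_indic r z * pd z).
Proof.
apply: eq_integral_Rintegral; first exact: measurable_disk_count.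
rewrite (correlation1 hGx); [|exact: measurable_disk|exact: bounded_disk].
apply: integral_Rintegral.
apply: (@integrable_cutoff_density _ _ x _ r); first exact: measurable_disk_indic.
exact: norm_disk_indic.
Qed.

Lemma disk_count_factorial (r : R) :
  Gx.-integrable setT (fun s => (disk_count r s * (disk_count r s - 1))%:E) /\
  \int[Gx]_s (disk_count r s * (disk_count r s - 1)) =
  \int[gg]_zw (disk_indic r zw.1 * disk_indic r zw.2 * pair zw.1 zw.2).
Proof.
have mr := measurable_disk_indic r; have nr := @norm_disk_indic r.
have mN := @measurable_disk_count R r.
apply: eq_integral_Rintegral.
  by apply: measurable_funM => //; apply: measurable_funB => //; exact: measurable_cst.
rewrite (correlation2_diag hGx); [|exact: measurable_disk|exact: bounded_disk].
exact: (integral_fubini_pair mr nr mr nr).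
Qed.

Lemma disk_count_sqr (r : R) :
  Gx.-integrable setT (fun s => (disk_count r s * disk_count r s)%:E) /\
  \int[Gx]_s (disk_count r s * disk_count r s) =
  \int[g]_z (disk_indic r z * pd z) +
  \int[gg]_zw (disk_indic r zw.1 * disk_indic r zw.2 * pair zw.1 zw.2).
Proof.
have [i1 E1] := disk_count_mean r; have [i2 E2] := disk_count_factorial r.
have E s : disk_count r s * disk_count r s =
  disk_count r s + disk_count r s * (disk_count r s - 1) by ring.
rewrite (funext E) -E1 -E2 (RintegralD measurableT i1 i2); split=> //.
by under eq_fun do rewrite E EFinD; exact: integrableD.
Qed.

Section annulus.
Variables r q : R.
Hypothesis rq : r <= q.
Let A := D q `\` D r.
Let mA : measurable A. Proof. by apply: measurableD; exact: measurable_disk. Qed.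
Let bA : bounded_set A.
Proof.
have := @bounded_disk R (Num.sqrt q); rewrite /bounded_set.
by apply: filterS => M h z [zq _]; exact: h.
Qed.

Lemma annulus_count (s : configuration R) : fine (s A) = disk_count q s - disk_count r s.
Proof.
have DE : D q = D r `|` A.
  by rewrite /A setUC setDKU//; exact/disk_sub/ler_wsqrtr.
rewrite /disk_count {1}DE measureU//; last 2 first.
- exact: measurable_disk.
- by rewrite /A setDIK.
rewrite fineD ?configuration_disk_fin_num//; last first.
  rewrite ge0_fin_numE//; apply: le_lt_trans (configuration_disk_fin s (Num.sqrt q)).
  apply: le_measure; rewrite ?inE; [exact: mA|exact: measurable_disk|].
  by move=> z [].
by rewrite addrC addKr.
Qed.

Lemma annulus_indic z : \1_A z = disk_indic q z - disk_indic r z.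
Proof.
rewrite /disk_indic !indicE /A in_setD.
have := @disk_sub R _ _ (ler_wsqrtr rq) z.
case: (boolP (z \in D r)) => [/set_mem zr /(_ zr) zq|_ _]; last by rewrite andbT subr0.
by rewrite (mem_set zq) subrr.
Qed.

Lemma annulus_cutoff z : `|disk_indic q z - disk_indic r z| <= disk_indic q z.
Proof.
rewrite ger0_norm ?subr_ge0; last exact: disk_indic_mono.
by rewrite gerBl disk_indic_ge0.
Qed.

Let mI : measurable_fun setT (fun z => disk_indic q z - disk_indic r z).
Proof. by apply: measurable_funB; exact: measurable_disk_indic. Qed.

Let mN : measurable_fun setT (fun s : configuration R => disk_count q s - disk_count r s).
Proof. by apply: measurable_funB; exact: measurable_disk_count. Qed.

Lemma annulus_product1 :
  Gx.-integrable setT (fun s => (disk_count r s * (disk_count q s - disk_count r s))%:E) /\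
  \int[Gx]_s (disk_count r s * (disk_count q s - disk_count r s)) =
  \int[gg]_zw (disk_indic r zw.1 * (disk_indic q zw.2 - disk_indic r zw.2) * pair zw.1 zw.2).
Proof.
apply: eq_integral_Rintegral.
  by apply: measurable_funM mN; exact: measurable_disk_count.
rewrite -(integral_fubini_pair (measurable_disk_indic r) (@norm_disk_indic r) mI annulus_cutoff).
under eq_integral do rewrite -annulus_count.
rewrite (correlation2_disjoint hGx (measurable_disk (Num.sqrt r)) mA (bounded_disk _) bA).
  by apply: eq_integral => z _; apply: eq_integral => w _; rewrite annulus_indic.
by rewrite /A setDIK.
Qed.

Lemma annulus_product2 :
  Gx.-integrable setT (fun s => ((disk_count q s - disk_count r s) * disk_count r s)%:E) /\
  \int[Gx]_s ((disk_count q s - disk_count r s) * disk_count r s) =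
  \int[gg]_zw ((disk_indic q zw.1 - disk_indic r zw.1) * disk_indic r zw.2 * pair zw.1 zw.2).
Proof.
apply: eq_integral_Rintegral.
  by apply: measurable_funM mN _; exact: measurable_disk_count.
rewrite -(integral_fubini_pair mI annulus_cutoff (measurable_disk_indic r) (@norm_disk_indic r)).
under eq_integral do rewrite -annulus_count.
rewrite (correlation2_disjoint hGx mA (measurable_disk (Num.sqrt r)) bA (bounded_disk _)).
  by apply: eq_integral => z _; apply: eq_integral => w _; rewrite annulus_indic.
by rewrite /A setDKI.
Qed.

Lemma disk_indicM z : disk_indic r z * disk_indic q z = disk_indic r z.
Proof.
have := disk_indic_mono z rq; have := disk_indic_le1 q z; rewrite /disk_indic !indicE.
by case: (z \in D r); case: (z \in D q) => //=; rewrite ?mulr1 ?mul0r// ler10.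
Qed.

End annulus.

Let split1 (a b c e : R) : a * b * e + a * (c - b) * e = a * c * e. Proof. by ring. Qed.
Let split2 (a b c e : R) : a * b * e + (c - a) * b * e = c * b * e. Proof. by ring. Qed.

(** The correlation functions give the joint moments of equal or disjoint sets,
    so the larger disk is cut into the smaller one and an annulus. The two
    cases differ in the variable that carries the annulus. *)
Lemma disk_count_product (r q : R) :
  Gx.-integrable setT (fun s => (disk_count r s * disk_count q s)%:E) /\
  \int[Gx]_s (disk_count r s * disk_count q s) =
  \int[g]_z (disk_indic r z * disk_indic q z * pd z) +
  \int[gg]_zw (disk_indic r zw.1 * disk_indic q zw.2 * pair zw.1 zw.2).
Proof.
have [rq|/ltW qr] := leP r q.
- have [i1 E1] := disk_count_sqr r; have [i2 E2] := annulus_product1 rq.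
  have E s : disk_count r s * disk_count q s =
    disk_count r s * disk_count r s + disk_count r s * (disk_count q s - disk_count r s) by ring.
  have mr := measurable_disk_indic r; have nr := @norm_disk_indic r.
  have mq : measurable_fun setT (fun z => disk_indic q z - disk_indic r z).
    by apply: measurable_funB; exact: measurable_disk_indic.
  have j1 := integrable_cutoff_pair x mr nr mr nr.
  have j2 := integrable_cutoff_pair x mr nr mq (annulus_cutoff rq).
  rewrite (funext E) (RintegralD measurableT i1 i2) E1 E2 -addrA -(RintegralD measurableT j1 j2).
  split; first by under eq_fun do rewrite E EFinD; exact: integrableD.
  congr (_ + _); first by apply: eq_Rintegral => z _; rewrite disk_indicM.
  by apply: eq_Rintegral => zw _; rewrite split1.
- have [i1 E1] := disk_count_sqr q; have [i2 E2] := annulus_product2 qr.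
  have E s : disk_count r s * disk_count q s =
    disk_count q s * disk_count q s + (disk_count r s - disk_count q s) * disk_count q s by ring.
  have mr := measurable_disk_indic q; have nr := @norm_disk_indic q.
  have mq : measurable_fun setT (fun z => disk_indic r z - disk_indic q z).
    by apply: measurable_funB; exact: measurable_disk_indic.
  have j1 := integrable_cutoff_pair x mr nr mr nr.
  have j2 := integrable_cutoff_pair x mq (annulus_cutoff qr) mr nr.
  rewrite (funext E) (RintegralD measurableT i1 i2) E1 E2 -addrA -(RintegralD measurableT j1 j2).
  split; first by under eq_fun do rewrite E EFinD; exact: integrableD.
  congr (_ + _); first by apply: eq_Rintegral => z _; rewrite [_ r z * _]mulrC disk_indicM.
  by apply: eq_Rintegral => zw _; rewrite split2.
Qed.

End count_moments.

(** * Second moments of smoothed counts *)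

Section averages.
Variable R : realType.
Local Notation lambda := (@lebesgue_measure R).

Lemma average_bounds (h : R -> R) (t : R) : 0 < t -> {homo h : a b / a <= b} ->
  h 0 <= t^-1 * \int[lambda]_(r in `[0, t]) h r <= h t.
Proof.
move=> t0 hm; have := primitive_bounds hm (lexx 0) (ltW t0).
by rewrite primitive0 !subr0 ler_pdivlMl// ler_pdivrMl.
Qed.

Lemma eq_riemann_avg (h k : R -> R) (t : R) : 0 < t ->
  (forall r, 0 < r -> h r = k r) -> riemann_avg h t = riemann_avg k t.
Proof.
move=> t0 hk; apply/funext => n; congr (_ * _); apply: eq_bigr => i _.
by apply: hk; rewrite mulr_gt0 ?divr_gt0 ?ltr0n.
Qed.

Lemma riemann_avgD (h k : R -> R) (t : R) n :
  riemann_avg (fun r => h r + k r) t n = riemann_avg h t n + riemann_avg k t n.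
Proof. by rewrite /riemann_avg big_split/= mulrDr. Qed.

(** How an identity for each radius passes to the averages over the radius. *)
Lemma riemann_avg_unique (h k : R -> R) (t a b : R) : 0 < t ->
  (forall r, 0 < r -> h r = k r) ->
  riemann_avg h t n @[n --> \oo] --> a -> riemann_avg k t n @[n --> \oo] --> b -> a = b.
Proof.
move=> t0 hk ha; rewrite -(eq_riemann_avg t0 hk) => hb.
by rewrite -(cvg_lim (@Rhausdorff R) ha); exact: (cvg_lim (@Rhausdorff R) hb).
Qed.

End averages.

Section tent_moments.
Variables (R : realType) (l : nat) (x : 'rV[plane R]_l).
Variables (Gx : probability (configuration R) R).
Hypothesis hGx : is_ginibre_palm x Gx.
Local Notation g := (@gaussian R).
Local Notation gg := (@gaussian R \x @gaussian R)%E.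
Local Notation pd := (palm_density x).
Local Notation pair := (palm_pair x).
Local Notation lambda := (@lebesgue_measure R).

(* Comparing two values of these functions must not unfold the determinants. *)
Local Opaque palm_density palm_corr palm_pair.

Definition tent_stat (t : R) (s : configuration R) : R :=
  t^-1 * \int[lambda]_(r in `[0, t]) disk_count r s.

Lemma tent_stat_bounds t s : 0 < t -> 0 <= tent_stat t s <= disk_count t s.
Proof.
move=> t0; have /andP[h1 ->] := average_bounds t0 (@disk_count_mono R s).
by rewrite (le_trans _ h1) ?disk_count_ge0.
Qed.

Lemma measurable_tent_stat t : 0 < t -> measurable_fun setT (tent_stat t).
Proof.
move=> t0.
have mh n : measurable_fun setT (fun s : configuration R => riemann_avg (fun r => disk_count r s) t n).
  apply: measurable_funM; first exact: measurable_cst.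
  by apply: measurable_sum => i; exact: measurable_disk_count.
apply: (measurable_fun_cvg mh) => s _.
by apply: cvg_riemann_avg => //; exact: disk_count_mono.
Qed.

Lemma measurable_palm_pair :
  measurable_fun setT (fun zw : plane R * plane R => pair zw.1 zw.2).
Proof.
have md := measurable_palm_density x.
apply: measurable_funB; last exact: measurable_palm_corr.
apply: measurable_funM.
  by apply: (measurableT_comp md); exact: measurable_fst.
by apply: (measurableT_comp md); exact: measurable_snd.
Qed.

Lemma norm_tent (t : R) z : 0 < t -> `|tent t z| <= disk_indic t z.
Proof. by move=> t0; have /andP[h0 h1] := tent_bounds z t0; rewrite ger0_norm. Qed.

Lemma tent_stat_mean t : 0 < t ->
  \int[Gx]_s tent_stat t s = \int[g]_z (tent t z * pd z).
Proof.
move=> t0.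
have H1 := @cvg_integral_riemann _ _ R Gx (@disk_count R) (fun=> 1) (fun=> 1) t t0
  (@disk_count_mono R) (fun r => @disk_count_ge0 R r) (measurable_cst _)
  (@measurable_disk_count R) (measurable_cst _) _ _.
have H2 := @cvg_integral_riemann _ _ R g (@disk_indic R) pd pd t t0
  (@disk_indic_mono R) (@disk_indic_ge0 R) (measurable_palm_density x)
  (@measurable_disk_indic R) (measurable_palm_density x) _ _.
have {}H1 : riemann_avg (fun r => \int[Gx]_s (1 * disk_count r s)) t n @[n --> \oo] -->
    \int[Gx]_s (1 * tent_stat t s).
  apply: H1 => [s|r]; first by rewrite normr1.
  by under eq_fun do rewrite mul1r; exact: (disk_count_mean hGx r).1.
have {}H2 : riemann_avg (fun r => \int[g]_z (pd z * disk_indic r z)) t n @[n --> \oo] -->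
    \int[g]_z (pd z * tent t z).
  apply: H2 => [z|r]; first by rewrite ger0_norm ?palm_density_ge0.
  under eq_fun do rewrite mulrC.
  by apply: (@integrable_cutoff_density _ _ x _ r); [exact: measurable_disk_indic|exact: norm_disk_indic].
rewrite (_ : \int[Gx]_s tent_stat t s = \int[Gx]_s (1 * tent_stat t s)); last first.
  by apply: eq_Rintegral => s _; rewrite mul1r.
rewrite (_ : \int[g]_z _ = \int[g]_z (pd z * tent t z)); last first.
  by apply: eq_Rintegral => s _; rewrite mulrC.
apply: (riemann_avg_unique t0 _ H1 H2) => r _.
under eq_Rintegral do rewrite mul1r.
by rewrite (disk_count_mean hGx r).2; apply: eq_Rintegral => z _; rewrite mulrC.
Qed.

Let rot (a b c : R) : a * b * c = a * c * b. Proof. by ring. Qed.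

Let norm_rot (a b c : R) : 0 <= b -> `|a * b * c| = `|a * c| * b.
Proof. by move=> b0; rewrite rot normrM (ger0_norm b0). Qed.

Let swap_factors (a b c d : R) : c = d -> a * b * c = b * a * d.
Proof. by move=> ->; rewrite [a * b]mulrC. Qed.

Section one_average.
Variables (Z : configuration R -> R) (u : plane R -> R) (q : R).
Hypothesis mZ : measurable_fun setT Z.
Hypothesis ZN : forall s, 0 <= Z s <= disk_count q s.
Hypothesis mu : measurable_fun setT u.
Hypothesis uq : forall z, 0 <= u z <= disk_indic q z.
(* [Z] has the mixed moments of the linear statistic of [u] *)
Hypothesis Zu : forall r, \int[Gx]_s (Z s * disk_count r s) =
  \int[g]_z (u z * disk_indic r z * pd z) +
  \int[gg]_zw (u zw.1 * disk_indic r zw.2 * pair zw.1 zw.2).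

Let uq' z : `|u z| <= disk_indic q z.
Proof. by have /andP[u0 u1] := uq z; rewrite ger0_norm. Qed.

Lemma average_second t : 0 < t ->
  \int[Gx]_s (Z s * tent_stat t s) =
  \int[g]_z (u z * tent t z * pd z) +
  \int[gg]_zw (u zw.1 * tent t zw.2 * pair zw.1 zw.2).
Proof.
move=> t0.
have H1 : riemann_avg (fun r => \int[Gx]_s (Z s * disk_count r s)) t n @[n --> \oo] -->
    \int[Gx]_s (Z s * tent_stat t s).
  apply: (@cvg_integral_riemann _ _ R Gx (@disk_count R) Z (disk_count q)) => //.
  - exact: disk_count_mono.
  - exact: disk_count_ge0.
  - exact: measurable_disk_count.
  - exact: measurable_disk_count.
  - by move=> s; have /andP[z0 z1] := ZN s; rewrite ger0_norm.
  - by move=> r; exact: (disk_count_product hGx q r).1.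
have mup : measurable_fun setT (fun z => u z * pd z).
  by apply: measurable_funM => //; exact: measurable_palm_density.
have H2 : riemann_avg (fun r => \int[g]_z (u z * pd z * disk_indic r z)) t n @[n --> \oo] -->
    \int[g]_z (u z * pd z * tent t z).
  apply: (@cvg_integral_riemann _ _ R g (@disk_indic R) _ (fun z => u z * pd z)) => //.
  - exact: disk_indic_mono.
  - exact: measurable_disk_indic.
  - by move=> z; have /andP[u0 _] := uq z; rewrite ger0_norm// mulr_ge0// palm_density_ge0.
  - move=> r; apply: (dominated_integrable_real _ (integrable_cutoff_density x mu uq')).
      by apply: measurable_funM => //; exact: measurable_disk_indic.
    move=> z; have /andP[u0 _] := uq z; have p0 := palm_density_ge0 x z.
    rewrite normrM !ger0_norm ?disk_indic_ge0 ?mulr_ge0//.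
    by rewrite ler_piMr ?mulr_ge0// disk_indic_le1.
have mupp : measurable_fun setT (fun zw : plane R * plane R => u zw.1 * pair zw.1 zw.2).
  apply: measurable_funM; last exact: measurable_palm_pair.
  by apply: (measurableT_comp mu); exact: measurable_fst.
have H3 : riemann_avg (fun r => \int[gg]_zw (u zw.1 * pair zw.1 zw.2 * disk_indic r zw.2)) t n
    @[n --> \oo] --> \int[gg]_zw (u zw.1 * pair zw.1 zw.2 * tent t zw.2).
  apply: (@cvg_integral_riemann _ _ R gg (fun r zw => disk_indic r zw.2) _
    (fun zw => `|u zw.1 * pair zw.1 zw.2|)) => //.
  - by move=> zw; exact: disk_indic_mono.
  - move=> r; apply: (measurableT_comp (measurable_disk_indic r)); exact: measurable_snd.
  - exact: measurableT_comp.
  - move=> r.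
    have := integrable_norm (integrable_cutoff_pair x mu uq' (measurable_disk_indic r) (@norm_disk_indic R r)).
    by apply: eq_integrable => // zw _; congr EFin; apply: norm_rot; exact: disk_indic_ge0.
have H := cvgD H2 H3.
rewrite (_ : \int[g]_z _ = \int[g]_z (u z * pd z * tent t z)); last first.
  by apply: eq_Rintegral => z _; rewrite rot.
rewrite (_ : \int[gg]_zw _ = \int[gg]_zw (u zw.1 * pair zw.1 zw.2 * tent t zw.2)); last first.
  by apply: eq_Rintegral => z _; rewrite rot.
have {}H : riemann_avg (fun r => \int[g]_z (u z * pd z * disk_indic r z) +
    \int[gg]_zw (u zw.1 * pair zw.1 zw.2 * disk_indic r zw.2)) t n @[n --> \oo] -->
    \int[g]_z (u z * pd z * tent t z) + \int[gg]_zw (u zw.1 * pair zw.1 zw.2 * tent t zw.2).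
  by under eq_fun do rewrite riemann_avgD; exact: H.
apply: (riemann_avg_unique t0 _ H1 H) => r _; rewrite Zu; congr (_ + _).
  by apply: eq_Rintegral => z _; rewrite rot.
by apply: eq_Rintegral => z _; rewrite rot.
Qed.

End one_average.

Lemma integral_pair_swap (u v : plane R -> R) (r q : R) :
  measurable_fun setT u -> (forall z, `|u z| <= disk_indic r z) ->
  measurable_fun setT v -> (forall z, `|v z| <= disk_indic q z) ->
  \int[gg]_zw (u zw.1 * v zw.2 * pair zw.1 zw.2) =
  \int[gg]_zw (v zw.1 * u zw.2 * pair zw.1 zw.2).
Proof.
move=> mu ur mv vq.
have i1 := integrable_cutoff_pair x mu ur mv vq.
have i2 := integrable_cutoff_pair x mv vq mu ur.
rewrite {1}/Rintegral -(integral12_prod_meas1 i1).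
transitivity (fine (\int[g]_z \int[g]_w (v w * u z * pair w z)%:E)).
  apply: (congr1 fine); apply: eq_integral => z _.
  apply: eq_integral => w _; apply: (congr1 EFin).
  exact: swap_factors (palm_pairC x z w).
by rewrite /Rintegral -(integral21_prod_meas1 i2).
Qed.

(** The two averages are taken one at a time, first against a disk count. *)
Lemma tent_stat_product t q : 0 < t -> 0 < q ->
  \int[Gx]_s (tent_stat t s * tent_stat q s) =
  \int[g]_z (tent t z * tent q z * pd z) +
  \int[gg]_zw (tent t zw.1 * tent q zw.2 * pair zw.1 zw.2).
Proof.
move=> t0 q0.
apply: (@average_second _ (tent t) t) => //.
- exact: measurable_tent_stat.
- by move=> s; exact: tent_stat_bounds.
- exact: measurable_tent.
- by move=> z; exact: tent_bounds.
move=> r.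
rewrite (integral_pair_swap (measurable_tent t0) (fun z => norm_tent z t0)
  (measurable_disk_indic r) (@norm_disk_indic R r)).
rewrite (_ : \int[g]_z _ = \int[g]_z (disk_indic r z * tent t z * pd z)); last first.
  by apply: eq_Rintegral => z _; rewrite [tent t z * _]mulrC.
rewrite (_ : \int[Gx]_s _ = \int[Gx]_s (disk_count r s * tent_stat t s)); last first.
  by apply: eq_Rintegral => s _; rewrite mulrC.
apply: (@average_second _ (disk_indic r) r) => //.
- exact: measurable_disk_count.
- by move=> s; rewrite disk_count_ge0 lexx.
- exact: measurable_disk_indic.
- by move=> z; rewrite disk_indic_ge0 lexx.
- by move=> a; exact: (disk_count_product hGx r a).2.
Qed.

End tent_moments.

(** * Energy of the smoothed indicator *)

Section ginibre_spread.
Variable R : realType.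
Local Notation g := (@gaussian R).
Local Notation gg := (@gaussian R \x @gaussian R)%E.
Local Notation K := (@ginibre_kernel R).
Local Notation e z := (expR (modulus z ^+ 2)).
Implicit Types (z w : plane R) (t : R).

(** [fine] sends the infinities to [0]: a positive value excludes them. *)
Lemma fine_pos_eq (y : \bar R) (c : R) : 0 < c -> fine y = c -> (y = c%:E)%E.
Proof. by case: y => [a _ <-//| |] c0 /= c1; move: c0; rewrite -c1 ltxx. Qed.

Lemma measurable_expR_modulus_sqr : measurable_fun setT (fun z : plane R => e z).
Proof. by apply: measurableT_comp => //; apply: measurable_funX; exact: measurable_modulus. Qed.

Lemma eintegral_gaussian_disk t : 0 < t ->
  (\int[g]_z (disk_indic t z * e z)%:E = t%:E)%E.
Proof. by move=> t0; apply: fine_pos_eq => //; exact: gaussian_disk. Qed.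

(** The intensity of the Ginibre process with respect to area is constant, so
    the mean of the smoothed count is linear. *)
Lemma integral_tent t : 0 < t ->
  g.-integrable setT (fun z => (tent t z * e z)%:E) /\
  \int[g]_z (tent t z * e z) = t / 2.
Proof.
move=> t0.
have ie (r : R) : g.-integrable setT (fun z => (e z * disk_indic r z)%:E).
  have ic : g.-integrable setT (fun z => (expR (Num.sqrt r ^+ 2))%:E).
    exact: finite_measure_integrable_cst.
  apply: (dominated_integrable_real _ ic).
    by apply: measurable_funM; [exact: measurable_expR_modulus_sqr|exact: measurable_disk_indic].
  move=> z; rewrite mulrC ger0_norm ?mulr_ge0 ?disk_indic_ge0 ?expR_ge0//.
  apply: disk_indic_bound; first exact: expR_ge0.
  by move=> h; rewrite ler_expR lerXn2r ?nnegrE ?modulus_ge0 ?sqrtr_ge0.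
split.
  apply: (dominated_integrable_real _ (ie t)).
    by apply: measurable_funM; [exact: measurable_tent|exact: measurable_expR_modulus_sqr].
  move=> z; rewrite normrM (ger0_norm (expR_ge0 _)) mulrC ler_wpM2l ?expR_ge0//.
  exact: norm_tent.
have H1 : riemann_avg (fun r => \int[g]_z (e z * disk_indic r z)) t n @[n --> \oo] -->
    \int[g]_z (e z * tent t z).
  apply: (@cvg_integral_riemann _ _ R g (@disk_indic R) _ (fun z => e z)) => //.
  - exact: disk_indic_mono.
  - exact: measurable_expR_modulus_sqr.
  - exact: measurable_disk_indic.
  - exact: measurable_expR_modulus_sqr.
  - by move=> z; rewrite ger0_norm ?expR_ge0.
rewrite (_ : \int[g]_z _ = \int[g]_z (e z * tent t z)); last first.
  by apply: eq_Rintegral => z _; rewrite mulrC.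
apply: (riemann_avg_unique t0 _ H1 (@cvg_riemann_avg_id R t)) => r r0.
rewrite -[RHS](gaussian_disk r0); apply: eq_Rintegral => z _; exact: mulrC.
Qed.

(** The integrand of [integral_ginibre_dist], symmetric in its variables. *)
Definition spread z w : R :=
  (modulus z ^+ 2 - modulus w ^+ 2) ^+ 2 * normc (K z w) ^+ 2.

Lemma spread_ge0 z w : 0 <= spread z w.
Proof. by rewrite mulr_ge0 ?sqr_ge0. Qed.

Lemma spreadC z w : spread z w = spread w z.
Proof. by rewrite /spread [K z w]ginibre_conj normc_conj -sqrrN opprB. Qed.

Lemma measurable_spread :
  measurable_fun setT (fun zw : plane R * plane R => spread zw.1 zw.2).
Proof.
have mm : measurable_fun setT (fun z : plane R => modulus z ^+ 2).
  by apply: measurable_funX; exact: measurable_modulus.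
apply: measurable_funM; last exact: measurable_ginibre_sqr.
apply: measurable_funX; apply: measurable_funB.
  by apply: (measurableT_comp mm); exact: measurable_fst.
by apply: (measurableT_comp mm); exact: measurable_snd.
Qed.

Lemma integral_spread w : (\int[g]_z (spread z w)%:E =
  ((2 * modulus w ^+ 2 + 2) * e w)%:E)%E.
Proof.
apply: fine_pos_eq; last exact: integral_ginibre_dist.
by rewrite mulr_gt0 ?expR_gt0// ltr_wpDl// mulr_ge0// sqr_ge0.
Qed.

Let spread_disk t : 0 < t ->
  (\int[g]_w (disk_indic t w * ((2 * modulus w ^+ 2 + 2) * e w))%:E <=
   ((2 * t + 2) * t)%:E)%E.
Proof.
move=> t0; apply: (@le_trans _ _ (\int[g]_w ((2 * t + 2)%:E * (disk_indic t w * e w)%:E))%E).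
  apply: ge0_le_integral => //.
  - move=> w _; rewrite lee_fin mulr_ge0 ?disk_indic_ge0// mulr_ge0 ?expR_ge0//.
    by rewrite addr_ge0// mulr_ge0// sqr_ge0.
  - apply/measurable_EFinP; apply: measurable_funM; first exact: measurable_disk_indic.
    apply: measurable_funM; last exact: measurable_expR_modulus_sqr.
    apply: measurable_funD; last exact: measurable_cst.
    apply: measurable_funM; first exact: measurable_cst.
    by apply: measurable_funX; exact: measurable_modulus.
  - apply: measurable_funeM; apply/measurable_EFinP; apply: measurable_funM.
      exact: measurable_disk_indic.
    exact: measurable_expR_modulus_sqr.
  - move=> w _; rewrite -EFinM lee_fin disk_indicE ?(ltW t0)// indicE mem_setE in_itv/= andbT.
    have [h|h] := leP (modulus w ^+ 2) t; last by rewrite mulr0n !mul0r mulr0.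
    by rewrite mulr1n !mul1r ler_wpM2r ?expR_ge0// lerD2r ler_wpM2l.
rewrite ge0_integralZl//.
- by rewrite eintegral_gaussian_disk// -EFinM.
- apply/measurable_EFinP; apply: measurable_funM; first exact: measurable_disk_indic.
  exact: measurable_expR_modulus_sqr.
- by move=> w _; rewrite lee_fin mulr_ge0 ?disk_indic_ge0 ?expR_ge0.
- by rewrite lee_fin addr_ge0// mulr_ge0// ltW.
Qed.

Lemma spread_disk2 t : 0 < t ->
  (\int[gg]_zw (disk_indic t zw.2 * spread zw.1 zw.2)%:E <= ((2 * t + 2) * t)%:E)%E.
Proof.
move=> t0; rewrite fubini_tonelli2//; last 2 first.
- apply/measurable_EFinP; apply: measurable_funM; last exact: measurable_spread.
  by apply: (measurableT_comp (measurable_disk_indic t)); exact: measurable_snd.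
- by move=> zw; rewrite lee_fin mulr_ge0 ?disk_indic_ge0 ?spread_ge0.
apply: le_trans (spread_disk t0); rewrite le_eqVlt; apply/orP; left; apply/eqP.
apply: eq_integral => w _; rewrite /fubini_G.
under eq_integral => z _ do rewrite /= EFinM.
rewrite ge0_integralZl//.
- by rewrite integral_spread -EFinM.
- apply/measurable_EFinP.
  exact: (measurableT_comp measurable_spread (measurable_pair2 w)).
- by move=> z _; rewrite lee_fin spread_ge0.
- by rewrite lee_fin disk_indic_ge0.
Qed.

Lemma spread_disk1 t : 0 < t ->
  (\int[gg]_zw (disk_indic t zw.1 * spread zw.1 zw.2)%:E <= ((2 * t + 2) * t)%:E)%E.
Proof.
move=> t0; rewrite fubini_tonelli1//; last 2 first.
- apply/measurable_EFinP; apply: measurable_funM; last exact: measurable_spread.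
  by apply: (measurableT_comp (measurable_disk_indic t)); exact: measurable_fst.
- by move=> zw; rewrite lee_fin mulr_ge0 ?disk_indic_ge0 ?spread_ge0.
apply: le_trans (spread_disk t0); rewrite le_eqVlt; apply/orP; left; apply/eqP.
apply: eq_integral => z _; rewrite /fubini_F.
under eq_integral => w _ do rewrite /= spreadC EFinM.
rewrite ge0_integralZl//.
- by rewrite integral_spread -EFinM.
- apply/measurable_EFinP.
  exact: (measurableT_comp measurable_spread (measurable_pair2 z)).
- by move=> w _; rewrite lee_fin spread_ge0.
- by rewrite lee_fin disk_indic_ge0.
Qed.

(** By [tent_lipschitz] the energy is at most [t ^- 2] times the integral of
    [spread] with one of the points in the disk of area [pi * t]. The inner
    integral is at most [2 * t + 2] times the density of points there, and the
    disk carries [t] points on average. *)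
Lemma tent_energy t : 1 <= t ->
  (\int[gg]_zw ((tent t zw.1 - tent t zw.2) ^+ 2 * normc (K zw.1 zw.2) ^+ 2)%:E <= 8%:E)%E.
Proof.
move=> t1; have t0 : 0 < t by exact: lt_le_trans t1.
have m1 : measurable_fun setT (fun zw : plane R * plane R => (disk_indic t zw.1 * spread zw.1 zw.2)%:E).
  apply/measurable_EFinP; apply: measurable_funM; last exact: measurable_spread.
  by apply: (measurableT_comp (measurable_disk_indic t)); exact: measurable_fst.
have m2 : measurable_fun setT (fun zw : plane R * plane R => (disk_indic t zw.2 * spread zw.1 zw.2)%:E).
  apply/measurable_EFinP; apply: measurable_funM; last exact: measurable_spread.
  by apply: (measurableT_comp (measurable_disk_indic t)); exact: measurable_snd.
apply: (@le_trans _ _ (\int[gg]_zw ((t^-1 ^+ 2)%:E *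
    ((disk_indic t zw.1 * spread zw.1 zw.2)%:E + (disk_indic t zw.2 * spread zw.1 zw.2)%:E)))%E).
  apply: ge0_le_integral => //.
  - by move=> zw _; rewrite lee_fin mulr_ge0 ?sqr_ge0.
  - apply/measurable_EFinP; apply: measurable_funM; last exact: measurable_ginibre_sqr.
    apply: measurable_funX; apply: measurable_funB.
      by apply: (measurableT_comp (measurable_tent t0)); exact: measurable_fst.
    by apply: (measurableT_comp (measurable_tent t0)); exact: measurable_snd.
  - by apply: measurable_funeM; exact: emeasurable_funD.
  - move=> zw _; rewrite -EFinD -EFinM lee_fin -mulrDl /spread [leRHS]mulrA [leRHS]mulrA.
    rewrite ler_wpM2r ?sqr_ge0// -mulrA.
    exact: tent_lipschitz.
rewrite ge0_integralZl//; last 3 first.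
- exact: emeasurable_funD.
- move=> zw _; rewrite -EFinD lee_fin.
  by rewrite addr_ge0// mulr_ge0 ?disk_indic_ge0 ?spread_ge0.
- by rewrite lee_fin sqr_ge0.
rewrite ge0_integralD//; last 2 first.
- by move=> zw _; rewrite lee_fin mulr_ge0 ?disk_indic_ge0 ?spread_ge0.
- by move=> zw _; rewrite lee_fin mulr_ge0 ?disk_indic_ge0 ?spread_ge0.
apply: (@le_trans _ _ ((t^-1 ^+ 2)%:E * (((2 * t + 2) * t)%:E + ((2 * t + 2) * t)%:E))%E).
  apply: lee_wpmul2l; first by rewrite lee_fin sqr_ge0.
  by apply: leeD; [exact: spread_disk1|exact: spread_disk2].
rewrite -EFinD -EFinM lee_fin.
rewrite (_ : _ * _ = 4 + 4 * t^-1); last by field; rewrite gt_eqF.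
by rewrite (_ : 8 = 4 + 4 * 1)%R ?lerD2l ?ler_wpM2l// ?invf_le1//; ring.
Qed.

End ginibre_spread.

(** * Asymptotic mean and covariance *)

Section asymptotics.
Variables (R : realType) (l : nat) (x : 'rV[plane R]_l).
Local Notation g := (@gaussian R).
Local Notation gg := (@gaussian R \x @gaussian R)%E.
Local Notation pd := (palm_density x).
Local Notation pc := (palm_corr x).
Local Notation pair := (palm_pair x).
Local Notation e z := (expR (modulus z ^+ 2)).
Local Notation K := (@ginibre_kernel R).

(* Comparing two values of these functions must not unfold the determinants. *)
Local Opaque palm_density palm_corr palm_pair palm_defect.

(** The mean and the covariances of the smoothed counts, by [tent_stat_mean] and
    [tent_stat_product]. *)
Definition tent_mean t : R := \int[g]_z (tent t z * pd z).

Definition tent_cov t q : R :=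
  \int[g]_z (tent t z * tent q z * pd z) +
  \int[gg]_zw (tent t zw.1 * tent q zw.2 * pair zw.1 zw.2) -
  tent_mean t * tent_mean q.

Let mt (t : R) (t0 : 0 < t) := measurable_tent t0.
Let nt (t : R) (t0 : 0 < t) := fun z => norm_tent z t0.

Let norm_tent1 (t : R) z : 0 < t -> `|tent t z| <= 1.
Proof. by move=> t0; rewrite (le_trans (nt t0 z))// disk_indic_le1. Qed.

Let regroup (a b c : R) : a + (b - c) - b = a - c. Proof. by ring. Qed.

Lemma tent_covE t q : 0 < t -> 0 < q -> tent_cov t q =
  \int[g]_z (tent t z * tent q z * pd z) -
  \int[gg]_zw (tent t zw.1 * tent q zw.2 * pc zw.1 zw.2).
Proof.
move=> t0 q0; rewrite /tent_cov (integral_cutoff_pair x (mt t0) (nt t0) (mt q0) (nt q0)).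
exact: regroup.
Qed.

Lemma integrable_tent_defect t : 0 < t ->
  g.-integrable setT (fun z => (tent t z * palm_defect x z)%:E).
Proof.
move=> t0; have id := integrable_norm (integrable_palm_defect x).
apply: (dominated_integrable_real _ id).
  apply: measurable_funM; first exact: mt.
  by have /integrableP[/measurable_EFinP] := integrable_palm_defect x.
by move=> z; rewrite normrM ler_piMl ?norm_tent1.
Qed.

Let cvg_tentM (a : nat -> R) z (c : R) : a n @[n --> \oo] --> +oo ->
  tent (a n) z * c @[n --> \oo] --> c.
Proof.
move=> aoo; rewrite -[X in _ --> X]mul1r; apply: cvgM; last exact: cvg_cst.
exact: cvg_tent.
Qed.

(** For the Ginibre process the mean is [t / 2] exactly; the Palm measure lacks
    the integral of [tent t] against the defect, which tends to the trace. *)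
Lemma cvg_tent_mean (a : nat -> R) : (forall n, 0 < a n) -> a n @[n --> \oo] --> +oo ->
  tent_mean (a n) - a n / 2 @[n --> \oo] --> (- l%:R : R).
Proof.
move=> a0 aoo.
have E n : tent_mean (a n) - a n / 2 = - \int[g]_z (tent (a n) z * palm_defect x z).
  have [i1 <-] := integral_tent (a0 n); have i2 := integrable_tent_defect (a0 n).
  apply/eqP; rewrite subr_eq addrC -RintegralB//; apply/eqP.
  by apply: eq_Rintegral => z _; rewrite palm_densityE mulrBr.
under eq_fun do rewrite E.
apply: cvgN; rewrite -(integral_palm_defect x).
have md : measurable_fun setT (palm_defect x).
  by have /integrableP[/measurable_EFinP] := integrable_palm_defect x.
apply: (@dominated_cvg_Rintegral _ _ R g _ _ (fun z => `|palm_defect x z|)).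
- by move=> n; apply: measurable_funM => //; exact: mt.
- exact: md.
- exact: integrable_norm (integrable_palm_defect x).
- by move=> n z; rewrite normrM ler_piMl ?norm_tent1.
- by move=> z; exact: cvg_tentM.
Qed.

(** As [tent (a n)] tends to [1], the reproducing property makes the two terms
    of [tent_covE] cancel in the limit. *)
Lemma cvg_tent_cov (a : nat -> R) q : 0 < q -> (forall n, 0 < a n) ->
  a n @[n --> \oo] --> +oo -> tent_cov (a n) q @[n --> \oo] --> (0 : R).
Proof.
move=> q0 a0 aoo.
under eq_fun do rewrite (tent_covE (a0 _) q0).
rewrite -(subrr (\int[g]_z (tent q z * pd z))).
rewrite -{2}(integral_cutoff_corr2 x (mt q0) (nt q0)).
have i1 := integrable_cutoff_density x (mt q0) (nt q0).
have i2 := integrable_cutoff_corr2 x (mt q0) (nt q0).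
have mtq : measurable_fun setT (fun z => tent q z * pd z).
  by apply: measurable_funM; [exact: mt|exact: measurable_palm_density].
have mc : measurable_fun setT (fun zw : plane R * plane R => tent q zw.2 * pc zw.1 zw.2).
  apply: measurable_funM; last exact: measurable_palm_corr.
  by apply: (measurableT_comp (mt q0)); exact: measurable_snd.
apply: cvgB.
- apply: (@dominated_cvg_Rintegral _ _ R g _ _ (fun z => `|tent q z * pd z|)).
  + move=> n; under eq_fun do rewrite -mulrA.
    by apply: measurable_funM => //; exact: mt.
  + exact: mtq.
  + exact: integrable_norm i1.
  + by move=> n z; rewrite -mulrA normrM ler_piMl ?norm_tent1.
  + by move=> z; under eq_fun do rewrite -mulrA; exact: cvg_tentM.
- apply: (@dominated_cvg_Rintegral _ _ R gg _ _ (fun zw => `|tent q zw.2 * pc zw.1 zw.2|)).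
  + move=> n; under eq_fun do rewrite -mulrA.
    by apply: measurable_funM => //; apply: (measurableT_comp (mt (a0 n))); exact: measurable_fst.
  + exact: mc.
  + exact: integrable_norm i2.
  + by move=> n zw; rewrite -mulrA normrM ler_piMl ?norm_tent1.
  + by move=> zw; under eq_fun do rewrite -mulrA; exact: cvg_tentM.
Qed.

Let square_diff (a b c : R) : (a - b) ^+ 2 * c = a ^+ 2 * c + b ^+ 2 * c - 2 * (a * b * c).
Proof. by ring. Qed.

Let twice (a b : R) : a + a - 2 * b = 2 * (a - b). Proof. by ring. Qed.

(** By the reproducing property the variance is half of the energy of [tent t]
    for [`|Kx|^2]. Passing from [Kx] to [K] costs the defect, which is square
    integrable. *)
Lemma tent_var_bounded : exists C : R, forall t, 1 <= t -> tent_cov t t <= C.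
Proof.
have [C hC] := palm_defect_square_integrable x.
exists (8 + C) => t t1; have t0 : 0 < t by exact: lt_le_trans t1.
pose f := tent t.
have mf2 : measurable_fun setT (fun z => f z ^+ 2) by apply: measurable_funX; exact: mt.
have nf2 z : `|f z ^+ 2| <= disk_indic t z.
  rewrite normrX expr2; have h := nt t0 z; have h1 := norm_tent1 z t0.
  by rewrite (le_trans _ h)// ler_piMl.
have i1 := integrable_cutoff_corr1 x mf2 nf2.
have i2 := integrable_cutoff_corr2 x mf2 nf2.
have i3 := integrable_cutoff_corr x (mt t0) (fun z => norm_tent1 z t0) (mt t0) (nt t0).
have i4 := integrableZl measurableT 2 i3.
have i12 := integrableD measurableT i1 i2.
have iE : gg.-integrable setT (fun zw => ((f zw.1 - f zw.2) ^+ 2 * pc zw.1 zw.2)%:E).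
  have := integrableB measurableT i12 i4; apply: eq_integrable => // zw _.
  by rewrite square_diff EFinB EFinD EFinM.
have E : 2 * tent_cov t t = \int[gg]_zw ((f zw.1 - f zw.2) ^+ 2 * pc zw.1 zw.2).
  transitivity (\int[gg]_zw (f zw.1 ^+ 2 * pc zw.1 zw.2 +
    f zw.2 ^+ 2 * pc zw.1 zw.2 - 2 * (f zw.1 * f zw.2 * pc zw.1 zw.2))); last first.
    by apply: eq_Rintegral => zw _; exact/esym/square_diff.
  rewrite (RintegralB measurableT i12 i4) (RintegralD measurableT i1 i2) RintegralZl//.
  rewrite (integral_cutoff_corr1 x mf2 nf2) (integral_cutoff_corr2 x mf2 nf2) twice (tent_covE t0 t0).
  rewrite (_ : \int[g]_z (tent t z * tent t z * pd z) = \int[g]_z (f z ^+ 2 * pd z)); last first.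
    by apply: eq_Rintegral => z _; rewrite expr2.
  by [].
have m1 : measurable_fun setT (fun zw : plane R * plane R =>
    ((f zw.1 - f zw.2) ^+ 2 * normc (K zw.1 zw.2) ^+ 2)%:E).
  apply/measurable_EFinP; apply: measurable_funM; last exact: measurable_ginibre_sqr.
  apply: measurable_funX; apply: measurable_funB.
    by apply: (measurableT_comp (mt t0)); exact: measurable_fst.
  by apply: (measurableT_comp (mt t0)); exact: measurable_snd.
have m2 : measurable_fun setT (fun zw : plane R * plane R =>
    (normc (K zw.1 zw.2 - palm_kernel K x zw.1 zw.2) ^+ 2)%:E).
  by apply/measurable_EFinP; exact: measurable_palm_defect_sqr.
have mP : measurable_fun setT (fun zw : plane R * plane R =>
    ((f zw.1 - f zw.2) ^+ 2 * pc zw.1 zw.2)%:E) by case/integrableP : iE.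
have f1 z w : (f z - f w) ^+ 2 <= 1.
  have /andP[a0 _] := tent_bounds z t0; have a1 := tent_le1 z t0.
  have /andP[b0 _] := tent_bounds w t0; have b1 := tent_le1 w t0.
  rewrite /f; move: (tent t z) (tent t w) a0 a1 b0 b1 => a b *; nra.
have bnd : (\int[gg]_zw ((f zw.1 - f zw.2) ^+ 2 * pc zw.1 zw.2)%:E <=
    \int[gg]_zw (2%:E * (((f zw.1 - f zw.2) ^+ 2 * normc (K zw.1 zw.2) ^+ 2)%:E +
      (normc (K zw.1 zw.2 - palm_kernel K x zw.1 zw.2) ^+ 2)%:E)))%E.
  apply: ge0_le_integral => //.
  - by move=> zw _; rewrite lee_fin mulr_ge0 ?sqr_ge0 ?palm_corr_ge0.
  - by apply: measurable_funeM; exact: emeasurable_funD.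
  - move=> zw _; rewrite -EFinD -EFinM lee_fin.
    have h1 := f1 zw.1 zw.2; have h0 := sqr_ge0 (f zw.1 - f zw.2).
    have h2 := palm_corr_split x zw.1 zw.2.
    rewrite (le_trans (ler_wpM2l h0 h2))// mulrDr mulrDr mulrCA lerD2l mulrCA ler_wpM2l//.
    by rewrite ler_piMl ?sqr_ge0.
rewrite -(ler_pM2l (ltr0n R 2)) E -lee_fin -integral_Rintegral//.
apply: (le_trans bnd).
rewrite ge0_integralZl//; last 2 first.
- exact: emeasurable_funD.
- move=> zw _; rewrite -EFinD lee_fin; apply: addr_ge0; last exact: sqr_ge0.
  by apply: mulr_ge0; exact: sqr_ge0.
rewrite ge0_integralD//; last 2 first.
- by move=> zw _; rewrite lee_fin; apply: mulr_ge0; exact: sqr_ge0.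
- by move=> zw _; rewrite lee_fin sqr_ge0.
by rewrite EFinM lee_wpmul2l ?lee_fin// EFinD leeD ?tent_energy.
Qed.

End asymptotics.

(** * Almost orthogonal sequences tend weakly to zero *)

Section weak_convergence.
Context d (T : measurableType d) (R : realType).
Variable mu : {measure set T -> \bar R}.
Implicit Types f h : T -> R.

Lemma Lfun2_intro f : measurable_fun setT f ->
  mu.-integrable setT (fun t => (f t * f t)%:E) -> f \in Lfun mu 2%:E.
Proof.
move=> mf i2; rewrite inE/=; apply/andP; split; rewrite inE//=.
rewrite /finite_norm unlock; apply: poweR_lty.
have /integrableP[_] := i2; apply: le_lt_trans.
rewrite le_eqVlt; apply/orP; left; apply/eqP; apply: eq_integral => t _.
by rewrite /= powR_mulrn// -normrX expr2.
Qed.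

Lemma Lfun2_product f h : f \in Lfun mu 2%:E -> h \in Lfun mu 2%:E ->
  mu.-integrable setT (fun t => (f t * h t)%:E).
Proof. by move=> f2 h2; have /Lfun1_integrable := Lfun2_mul_Lfun1 f2 h2. Qed.

Lemma Lfun2_lin f h (c : R) : f \in Lfun mu 2%:E -> h \in Lfun mu 2%:E ->
  (fun t => f t + c * h t) \in Lfun mu 2%:E.
Proof.
move=> f2 h2.
have p1 : (1 <= 2%:E :> \bar R)%E by rewrite lee_fin ler1n.
have h2' : (fun t => c * h t) \in Lfun mu 2%:E.
  have := Lfun_scale c (_ : 1 <= 2) h2; rewrite ler1n => /(_ isT).
  by rewrite (_ : (fun t => c * h t) = c \o* h)//; apply/funext => t; rewrite mulrC.
exact: (Lfun_addr_closed mu p1).2 _ _ f2 h2'.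
Qed.

Definition inner f h : R := \int[mu]_t (f t * h t).

Lemma innerC f h : inner f h = inner h f.
Proof. by apply: eq_Rintegral => t _; rewrite mulrC. Qed.

Lemma inner_linl f k h (c : R) : f \in Lfun mu 2%:E -> k \in Lfun mu 2%:E ->
  h \in Lfun mu 2%:E -> inner (fun t => f t + c * k t) h = inner f h + c * inner k h.
Proof.
move=> f2 k2 h2; have i1 := Lfun2_product f2 h2; have i2 := Lfun2_product k2 h2.
have i3 := integrableZl measurableT c i2.
rewrite /inner -RintegralZl// -RintegralD//.
by apply: eq_Rintegral => t _; rewrite mulrDl mulrA.
Qed.

Lemma inner_ge0 f : 0 <= inner f f.
Proof. by apply: Rintegral_ge0 => t _; rewrite -expr2 sqr_ge0. Qed.

Let quadratic_bound (a b c t u : R) :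
  0 <= a + - t * b + - t * (b + - t * c) -> u <= t * b -> t * (t * c) <= u -> u <= a.
Proof.
have -> : a + - t * b + - t * (b + - t * c) = a - 2 * (t * b) + t * (t * c) by ring.
lra.
Qed.

(** If the products with [h] stayed above [eps] in absolute value, the sum of [N]
    terms, taken with suitable signs and far enough apart to be almost
    orthogonal, would have norm of order [sqrt N] but product at least [N * eps]
    with [h], against the Cauchy-Schwarz inequality. *)
Lemma weakly_cvg0 (Y : nat -> T -> R) (C : R) :
  (forall n, Y n \in Lfun mu 2%:E) ->
  (\forall n \near \oo, inner (Y n) (Y n) <= C) ->
  (forall m, inner (Y n) (Y m) @[n --> \oo] --> (0 : R)) ->
  forall h, h \in Lfun mu 2%:E -> inner (Y n) h @[n --> \oo] --> (0 : R).
Proof.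
move=> Y2 YC Yo h h2; apply: contrapT => ncvg.
have [eps eps0 often] : exists2 e : R, 0 < e &
    forall P : set nat, (\forall n \near \oo, P n) -> exists2 n, P n & e <= `|inner (Y n) h|.
  apply: contrapT => H; apply: ncvg; apply/cvgr0Pnorm_lt => e e0.
  apply: contrapT => nP; apply: H; exists e => // P PP.
  apply: contrapT => nn; apply: nP.
  near=> n; rewrite ltNge; apply/negP => en; apply: nn; exists n => //.
  by near: n.
have C0 : 0 <= C.
  near \oo => n; rewrite (le_trans (inner_ge0 (Y n)))//; near: n; exact: YC.
have build N : exists Z : T -> R, [/\ Z \in Lfun mu 2%:E,
    inner (Y n) Z @[n --> \oo] --> (0 : R), inner Z Z <= N%:R * (C + 2) &
    N%:R * eps <= inner Z h].
  elim: N => [|N [Z [Z2 YZ ZZ Zh]]].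
    exists (fun=> 0); have z2 : (fun=> 0 : R) \in Lfun mu 2%:E.
      apply: Lfun2_intro; first exact: measurable_cst.
      under eq_fun do rewrite mul0r; exact: integrable0.
    have z0 (f : T -> R) : inner (fun=> 0) f = 0.
      by rewrite /inner; under eq_Rintegral do rewrite mul0r; rewrite /Rintegral integral0.
    split=> //; rewrite ?z0 ?mul0r//.
    by under eq_fun do rewrite innerC z0; exact: cvg_cst.
  have YZ1 : \forall n \near \oo, `|inner (Y n) Z| <= 1.
    by move/cvgr0Pnorm_le : YZ => /(_ 1 ltr01).
  have [n [Cn Zn] hn] := often _ (filterI YC YZ1).
  pose c : R := Num.sg (inner (Y n) h).
  have c2 : c * c <= 1 by rewrite -expr2 sqr_sg; case: (_ == 0).
  have cZ : c * inner (Y n) Z <= 1.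
    rewrite (le_trans (ler_norm _))// normrM -[leRHS]mulr1 ler_pM//.
    by rewrite normr_sg; case: (_ == 0).
  exists (fun t => Z t + c * Y n t); split.
  - exact: Lfun2_lin.
  - under eq_fun => m do rewrite innerC inner_linl// (innerC Z) (innerC (Y n)).
    have lim : (fun m => inner (Y m) Z + c * inner (Y m) (Y n)) @ \oo --> (0 + c * 0 : R).
      by apply: cvgD => //; apply: cvgM; [exact: cvg_cst|exact: Yo].
    by rewrite mulr0 addr0 in lim; exact: lim.
  - rewrite inner_linl//; last exact: Lfun2_lin.
    rewrite [inner Z _]innerC [inner (Y n) _]innerC !inner_linl// [inner Z (Y n)]innerC mulrDr mulrA.
    have h3 : c * c * inner (Y n) (Y n) <= C.
      by rewrite (le_trans _ Cn)// ler_piMl ?inner_ge0.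
    by rewrite -natr1; lra.
  - rewrite inner_linl// -natr1 mulrDl mul1r lerD//.
    by rewrite /c -normrEsg.
pose D := C + 2; have D0 : 0 < D by rewrite ltr_wpDl.
have bound N : N%:R * (eps ^+ 2 / D) <= inner h h.
  have [Z [Z2 _ ZZ Zh]] := build N.
  (* the minimizer of the quadratic bound on the norm of [h - t Z] *)
  pose t := eps / D.
  have t0 : 0 < t by exact: divr_gt0.
  have := inner_ge0 (fun s => h s + (- t) * Z s).
  rewrite inner_linl//; last exact: Lfun2_lin.
  rewrite [inner h _]innerC [inner Z _]innerC !inner_linl// [inner h Z]innerC => H.
  have h1 : t * (N%:R * eps) <= t * inner Z h by rewrite ler_pM2l.
  have h3 : t * (t * inner Z Z) <= t * (t * (N%:R * D)) by rewrite !ler_pM2l.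
  have e1 : t * (N%:R * eps) = N%:R * (eps ^+ 2 / D) by rewrite /t; field; rewrite gt_eqF.
  have e2 : t * (t * (N%:R * D)) = N%:R * (eps ^+ 2 / D) by rewrite /t; field; rewrite gt_eqF.
  by rewrite e1 in h1; rewrite e2 in h3; exact: quadratic_bound H h1 h3.
have e0 : 0 < eps ^+ 2 / D by rewrite divr_gt0// exprn_gt0.
have [N hN] : exists N : nat, inner h h / (eps ^+ 2 / D) < N%:R.
  exists (Num.truncn (inner h h / (eps ^+ 2 / D))).+1; exact: truncnS_gt.
have := bound N; rewrite -ler_pdivlMr//; by rewrite leNgt hN.
Unshelve. all: by end_near. Qed.

End weak_convergence.

(** * The weak limit of the averaged discrepancy *)

Section discrepancy.
Variables (R : realType) (l : nat) (x : 'rV[plane R]_l).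
Variables (Gx : probability (configuration R) R).
Hypothesis hGx : is_ginibre_palm x Gx.
Local Notation g := (@gaussian R).
Local Notation gg := (@gaussian R \x @gaussian R)%E.

Lemma Lfun2_tent_stat (t : R) : 0 < t -> tent_stat t \in Lfun Gx 2%:E.
Proof.
move=> t0; apply: Lfun2_intro; first exact: measurable_tent_stat.
apply: (dominated_integrable_real _ (disk_count_product hGx t t).1).
  by apply: measurable_funM; exact: measurable_tent_stat.
move=> s; have /andP[h0 h1] := tent_stat_bounds s t0.
by rewrite normrM ger0_norm// ler_pM.
Qed.

Lemma Lfun2_one : (fun=> 1 : R) \in Lfun Gx 2%:E.
Proof. exact: Lfun_cst. Qed.

Lemma inner_one : inner Gx (fun=> 1) (fun=> 1) = 1.
Proof.
rewrite /inner mulr1 Rintegral_cst// mul1r.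
exact: (congr1 fine (@probability_setT _ _ _ Gx)).
Qed.

Lemma inner_tent_stat (t q : R) : 0 < t -> 0 < q ->
  inner Gx (tent_stat t) (tent_stat q) =
  tent_cov x t q + tent_mean x t * tent_mean x q.
Proof. by move=> t0 q0; rewrite /inner (tent_stat_product hGx)// /tent_cov subrK. Qed.

Lemma inner_tent_one (t : R) : 0 < t -> inner Gx (tent_stat t) (fun=> 1) = tent_mean x t.
Proof.
move=> t0; rewrite -[RHS](tent_stat_mean hGx t0).
by apply: eq_Rintegral => s _; rewrite mulr1.
Qed.

Let centre_shuffle (k m1 m2 a b : R) :
  k + m1 * m2 + b * m1 + a * (m2 + b * 1) = k + (m1 + a) * (m2 + b).
Proof. by ring. Qed.

Lemma inner_centred (t q a b : R) : 0 < t -> 0 < q ->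
  inner Gx (fun s => tent_stat t s + a * 1) (fun s => tent_stat q s + b * 1) =
  tent_cov x t q + (tent_mean x t + a) * (tent_mean x q + b).
Proof.
move=> t0 q0.
have t2 := Lfun2_tent_stat t0; have q2 := Lfun2_tent_stat q0; have o2 := Lfun2_one.
rewrite inner_linl//; last exact: Lfun2_lin.
rewrite [inner Gx (tent_stat t) _]innerC [inner Gx (fun=> 1) _]innerC !inner_linl//.
rewrite (innerC _ (fun=> 1) (tent_stat t)) inner_one !inner_tent_one//.
rewrite (innerC _ (tent_stat q) (tent_stat t)) (inner_tent_stat t0 q0).
exact: centre_shuffle.
Qed.

End discrepancy.

Lemma cvg_translate (R : realType) (f : nat -> R) (a b : R) :
  f n @[n --> \oo] --> a -> f n + b @[n --> \oo] --> a + b.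
Proof. by move=> fa; apply: cvgD; [exact: fa|exact: cvg_cst]. Qed.

Theorem theorem1p3 (R : realType) (l : nat) (x : 'rV[plane R]_l)
    (Gx : probability (configuration R) R) (hGx : is_ginibre_palm x Gx) :
  weakly_cvg_L2 Gx averaged_discrepancy (fun=> - l%:R).
Proof.
have avgE t : 0 < t -> averaged_discrepancy t = fun s : configuration R => tent_stat t s + (- (t / 2)) * 1.
  by move=> t0; apply/funext => s; rewrite averaged_discrepancyE// mulr1.
have avg2 t : 0 < t -> averaged_discrepancy t \in Lfun Gx 2%:E.
  move=> t0; rewrite avgE//; apply: Lfun2_lin; last exact: Lfun2_one.
  exact: (Lfun2_tent_stat hGx).
split=> [//||h h2]; first exact: Lfun_cst.
apply/cvg_pinftyP => u u_oo.
(* [u n] may be small at first, whereas the bounds hold from [1] on. *)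
pose a n := Num.max 1 (u n).
have a1 n : 1 <= a n by rewrite le_max lexx.
have a0 n : 0 < a n by exact: lt_le_trans (a1 n).
have au : \forall n \near \oo, a n = u n.
  by near=> n; apply: max_r; near: n; exact: cvgry_ge.
have a_oo : a n @[n --> \oo] --> +oo.
  apply: cvg_trans u_oo; apply: near_eq_cvg.
  by move: au; apply: filterS => n ->.
pose c n : R := l%:R - a n / 2.
pose Y n (s : configuration R) : R := tent_stat (a n) s + c n * 1.
have Y2 n : Y n \in Lfun Gx 2%:E.
  by apply: Lfun2_lin; [exact: (Lfun2_tent_stat hGx)|exact: Lfun2_one].
have mean0 : (fun n => tent_mean x (a n) + c n) @ \oo --> (0 : R).
  have lim := cvg_translate (b := l%:R) (cvg_tent_mean x a0 a_oo).
  rewrite addNr in lim; apply: cvg_trans lim; apply: near_eq_cvg; apply: nearW => n.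
  by rewrite /c /=; ring.
have innerY n m : inner Gx (Y n) (Y m) =
    tent_cov x (a n) (a m) + (tent_mean x (a n) + c n) * (tent_mean x (a m) + c m).
  exact: inner_centred.
have orth m : inner Gx (Y n) (Y m) @[n --> \oo] --> (0 : R).
  rewrite (funext (innerY ^~ m)).
  rewrite -[X in _ --> X]addr0; apply: cvgD; first exact: cvg_tent_cov.
  rewrite -[X in _ --> X](mul0r (tent_mean x (a m) + c m)); apply: cvgM; first exact: mean0.
  exact: cvg_cst.
have [C hC] := tent_var_bounded x.
have bnd : \forall n \near \oo, inner Gx (Y n) (Y n) <= C + 1.
  have /cvgr0Pnorm_le/(_ 1 ltr01) := mean0; apply: filterS => n h1.
  rewrite innerY; apply: lerD; first exact: hC.
  by rewrite -expr2 -real_normK ?num_real// exprn_ile1.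
have lim := weakly_cvg0 Y2 bnd orth h2.
have {}lim := cvg_translate (b := \int[Gx]_s (- l%:R * h s)) lim.
rewrite add0r in lim; apply: cvg_trans lim; apply: near_eq_cvg.
move: au; apply: filterS => n aun /=.
have o2 := Lfun2_one Gx.
have i1 := Lfun2_product (Y2 n) h2.
have i2 := integrableZl measurableT (- l%:R) (Lfun2_product o2 h2).
have E : \int[Gx]_s (averaged_discrepancy (u n) s * h s) =
  \int[Gx]_s (Y n s * h s) + \int[Gx]_s (- l%:R * (1 * h s)).
  rewrite -RintegralD//; apply: eq_Rintegral => s _.
  by rewrite -aun avgE// /Y /c; ring.
rewrite E; congr (_ + _); apply: eq_Rintegral => s _; by rewrite mul1r.
Unshelve. all: by end_near. Qed.
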